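(* Let $\mathbf E$ be a conditional Banach space which is conditionally weakly compactly generated, i.e. there is a conditional subset $\mathbf C$ of $\mathbf E$ on $1$ which is conditionally $\sigma(\mathbf E,\mathbf E^* )$-compact, conditionally convex and conditionally balanced, and such that the conditional norm closure of $\mathrm{span}_{\mathbf R}\mathbf C$ equals $\mathbf E$. Then the conditional dual unit ball $\mathbf B_{\mathbf E^*}$ is conditionally weakly-$*$ sequentially compact (i.e. conditionally sequentially compact for $\sigma(\mathbf E^*,\mathbf E)$).
   Context: Throughout, $\mathcal A$ is a fixed complete Boolean algebra with operations $\vee,\wedge,{}^c$ and bounds $0,1$; $\mathcal A_a=\{b\in\mathcal A: b\le a\}$; $p(a)$ is the set of families $\{a_i\}_{i\in I}$ of pairwise disjoint elements of $\mathcal A$ (some possibly $0$) with supremum $a$. Conditional sets. A conditional set $\mathbf E$ of a nonempty set $E$ is a collection of objects $x|a$ ($x\in E$, $a\in\mathcal A$) such that: $x|a=y|b$ implies $a=b$; if $a\le b$ and $x|b=y|b$ then $x|a=y|a$; for all $\{a_i\}\in p(1)$ and $\{x_i\}\subset E$ there is a unique $x\in E$, denoted $\sum x_i|a_i$, with $x|a_i=x_i|a_i$ for all $i$. The conditional elements of $\mathbf E$ are the objects $\mathbf x=x|1$, $x\in E$; write $\mathbf x\in\mathbf E$. A nonempty $F\subset E$ is stable if it contains all $\sum x_i|a_i$ with $\{a_i\}\in p(1)$, $\{x_i\}\subset F$; the stable hull of a nonempty set is the smallest stable set containing it. For $F$ stable and $a\in\mathcal A$, $\mathbf F|a=\{x|b: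 x\in F,\ b\le a\}$ is called a conditional subset of $\mathbf E$ on $a$ (and $\mathbf F=\mathbf F|1$); it is a conditional set of $\{x|a:x\in F\}$ over the algebra $\mathcal A_a$ (with $(x|a)|b=x|b$), its conditional elements are the $x|a$ with $x\in F$, and all notions for it are taken relative to $\mathcal A_a$. We write $\mathbf F\sqsubset\mathbf E$ for ''$\mathbf F$ is a conditional subset of $\mathbf E$ on some $a$''; between conditional subsets, $\sqsubset$ is inclusion of collections. $\mathbf E|0$ is the null conditional subset. $[\mathbf x\in\mathbf E:\phi(\mathbf x)]$ is the conditional subset on $1$ generated by the stable hull of the (nonempty) set $\{x:\phi(\mathbf x)\}$. $\sqcap$ is intersection, $\sqcup$ is the smallest conditional subset containing the given ones, and $\mathbf F^{\sqsubset}$ is the largest conditional subset $\mathbf G$ with $\mathbf F\sqcap\mathbf G=\mathbf E|0$. Functions and families. A function $f:E\to F$ is stable if $f(\sum x_i|a_i)=\sum f(x_i)|a_i$; it then defines a conditional function $\mathbf f:\mathbf E\to\mathbf F$, $\mathbf f(\mathbf x)=f(x)|1$. It is conditionally injective if ($x|a\ne x'|a$ for all $a\neq0$) implies ($f(x)|a\ne f(x')|a$ for all $a\ne0$), conditionally surjective if $f$ is surjective, conditionally bijective if both. $\mathbf E\Join\mathbf F$ is the conditional set of $E\times F$ with $(x,y)|a=(x|a,y|a)$. A conditional family $\{\mathbf x_{\mathbf i}\}_{\mathbf i\in\mathbf I}$ in $\mathbf E$ is a conditional function $\mathbf i\mapsto\mathbf x_{\mathbf i}$ on a conditional set $\mathbf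 I$. A conditional family of conditional subsets $\{\mathbf E_{\mathbf i}\}_{\mathbf i\in\mathbf I}$ consists of conditional subsets on $1$ with $\mathbf E_{\mathbf i}|a_j=\mathbf E_{\mathbf i_j}|a_j$ for all $j$ whenever $i=\sum i_j|a_j$. Numbers. $\mathbf N$ (resp. $\mathbf Q$) is the conditional set whose generating set $N$ (resp. $Q$) consists of formal sums $\sum n_i|a_i$ with $\{a_i\}\in p(1)$ and $n_i\in\mathbb N=\{1,2,\dots\}$ (resp. $n_i\in\mathbb Q$), where $(\sum n_i|a_i)|a=(\sum m_j|b_j)|a$ iff $n_i=m_j$ whenever $a_i\wedge b_j\wedge a\ne0$; operations and order are componentwise ($\sum n_i|a_i\le\sum m_j|b_j$ iff $n_i\le m_j$ whenever $a_i\wedge b_j\ne0$; similarly $<$). $\mathbf R$ denotes the conditional real numbers: the conditionally totally ordered, conditionally Dedekind complete field containing $\mathbf Q$ (extending its operations and order). That is, $\mathbf R$ is a conditional set of a set $R$ with stable commutative ring operations such that every $r$ with $r|a\neq 0|a$ for all $a\ne0$ is invertible, and with a stable partial order compatible with the ring operations such that for all $r,s$ there is $a$ with $r|a\le s|a$ and $s|a^c\le r|a^c$ (where $r|a\le s|a$ means $r|a+s|a^c\le s$), and every conditional subset on $1$ with an upper bound has a supremum. It is unique up to isomorphism; for the measure algebra of a $\sigma$-finite measure space $R=L^0$. $\mathbf r<\mathbf s$ means $\mathbf r\le\mathbf s$ and $r|a\ne s|a$ for all $a\neq0$. $\mathbf R^+=[\mathbf r\ge\mathbf 0]$, $\mathbf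 R^{++}=[\mathbf r>\mathbf 0]$, and $|\mathbf r|$ is the supremum of $\mathbf r,-\mathbf r$. A conditional set is conditionally finite if it is in conditional bijection with $[\mathbf k\in\mathbf N:\mathbf 1\le\mathbf k\le\mathbf n]$ for some $\mathbf n\in\mathbf N$. Topology. A conditional topology on $\mathbf E$ is a stable collection of conditional subsets of $\mathbf E$, called conditionally open, containing $\mathbf E$ and closed under restriction to any $a\in\mathcal A$, $\sqcap$ of two members and arbitrary $\sqcup$. A conditional subset $\mathbf F$ is conditionally closed if $\mathbf F^{\sqsubset}$ is conditionally open; the conditional closure is the $\sqcap$ of all conditionally closed conditional subsets containing it. $\mathbf U$ is a conditional neighborhood of $\mathbf x$ if $\mathbf x\in\mathbf O\sqsubset\mathbf U$ for some conditionally open $\mathbf O$. The space $\mathbf E$ is conditionally compact if for every conditional family $\{\mathbf O_{\mathbf i}\}_{\mathbf i\in\mathbf I}$ of conditionally open subsets with $\mathbf E=\sqcup\mathbf O_{\mathbf i}$ there is a conditionally finite $\mathbf J\sqsubset\mathbf I$ with $\mathbf E=\sqcup_{\mathbf i\in\mathbf J}\mathbf O_{\mathbf i}$. A conditional sequence is a conditional family indexed by $\mathbf N$; a conditional subsequence of $\{\mathbf x_{\mathbf n}\}$ is $\{\mathbf x_{\mathbf n_{\mathbf k}}\}_{\mathbf k\in\mathbf N}$ with $\{\mathbf n_{\mathbf k}\}$ a conditional sequence in $\mathbf N$ such that $\mathbf k<\mathbf k'$ implies $\mathbf n_{\mathbf k}<\mathbf n_{\mathbf k'}$. $\mathbf x$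 is a conditional limit point of $\{\mathbf x_{\mathbf n}\}$ if for every conditional neighborhood $\mathbf U$ of $\mathbf x$ there is $\mathbf m$ with $\mathbf x_{\mathbf n}\in\mathbf U$ for all $\mathbf n\ge\mathbf m$. The space $\mathbf E$ is conditionally sequentially compact if every conditional sequence in $\mathbf E$ has a conditional subsequence with a conditional limit point in $\mathbf E$. A conditional subset $\mathbf K$ on $a$ is conditionally (sequentially) compact if it is so as a conditional set over $\mathcal A_a$ with the relative conditional topology $\{\mathbf O\sqcap\mathbf K:\mathbf O\text{ conditionally open}\}$. Normed spaces. A conditional vector space is a conditional set $\mathbf E$ with stable operations $+:\mathbf E\Join\mathbf E\to\mathbf E$, $\cdot:\mathbf R\Join\mathbf E\to\mathbf E$ making $E$ a unital $R$-module. Every conditional vector space is assumed to have support $1$: $\bigvee\{a:\exists x\in E,\ x|b\neq0|b\ \forall\,0\ne b\le a\}=1$. A conditionally normed space is a conditional vector space with a conditional function $\|\cdot\|:\mathbf E\to\mathbf R^+$ with $\|\mathbf r\mathbf x\|=|\mathbf r|\|\mathbf x\|$, $\|\mathbf x+\mathbf y\|\le\|\mathbf x\|+\|\mathbf y\|$, and $\|\mathbf x\|=\mathbf 0$ only if $\mathbf x=\mathbf 0$. In the norm topology $\mathbf O$ on $a$ is conditionally open iff for every $x\in E$ with $x|a\in\mathbf O$ there is $\mathbf r\in\mathbf R^{++}$ with $\mathbf B_{\mathbf r}(\mathbf x)|a\sqsubset\mathbf O$, where $\mathbf B_{\mathbf r}(\mathbf x)=[\mathbf y:\|\mathbf x-\mathbf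 y\|\le\mathbf r]$. $\mathbf E$ is a conditional Banach space if every conditional sequence $\{\mathbf x_{\mathbf n}\}$ that is conditionally Cauchy (for each $\mathbf r\in\mathbf R^{++}$ there is $\mathbf n\in\mathbf N$ with $\|\mathbf x_{\mathbf p}-\mathbf x_{\mathbf q}\|\le\mathbf r$ for all $\mathbf p,\mathbf q>\mathbf n$) has a conditional limit. A conditionally linear function $\mathbf f:\mathbf E\to\mathbf R$ is a conditional function with $f$ $R$-linear; it is conditionally continuous iff there is $\mathbf r\in\mathbf R$ with $|\mathbf f(\mathbf x)|\le\mathbf r\|\mathbf x\|$ for all $\mathbf x\in\mathbf E$. $\mathbf E^*$ is the conditional vector space of conditionally linear, conditionally continuous $\mathbf f:\mathbf E\to\mathbf R$ (with $f|a=g|a$ iff $f(x)|a=g(x)|a$ for all $x$), normed by $\|\mathbf f\|=\sup[|\mathbf f(\mathbf x)|:\|\mathbf x\|\le\mathbf 1]$; $\mathbf B_{\mathbf E^*}=[\mathbf x^*\in\mathbf E^*:\|\mathbf x^*\|\le\mathbf 1]$. Weak topologies. In $\sigma(\mathbf E,\mathbf E^* )$, $\mathbf O\sqsubset\mathbf E$ on $a$ is conditionally open iff for every $x\in E$ with $x|a\in\mathbf O$ there are a conditionally finite $\mathbf G\sqsubset\mathbf E^*$ on $1$ and $\mathbf r\in\mathbf R^{++}$ with $(\mathbf x+\mathbf U_{\mathbf G,\mathbf r})|a\sqsubset\mathbf O$, where $\mathbf U_{\mathbf G,\mathbf r}=[\mathbf y\in\mathbf E:\sup_{\mathbf x^*\in\mathbf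 G}|\mathbf x^*(\mathbf y)|\le\mathbf r]$. The topology $\sigma(\mathbf E^*,\mathbf E)$ on $\mathbf E^*$ is defined in the same way with conditionally finite $\mathbf G\sqsubset\mathbf E$ on $1$ and $\mathbf U_{\mathbf G,\mathbf r}=[\mathbf y^*\in\mathbf E^*:\sup_{\mathbf x\in\mathbf G}|\mathbf y^*(\mathbf x)|\le\mathbf r]$. Convexity and span. $\mathbf C$ is conditionally convex if $\mathbf r\mathbf x_1+(\mathbf 1-\mathbf r)\mathbf x_2\in\mathbf C$ for $\mathbf x_1,\mathbf x_2\in\mathbf C$, $\mathbf 0\le\mathbf r\le\mathbf 1$, and conditionally balanced if $\mathbf r\mathbf x\in\mathbf C$ for $\mathbf x\in\mathbf C$, $|\mathbf r|\le\mathbf 1$. For conditional families $\{\mathbf r_{\mathbf k}\}_{\mathbf 1\le\mathbf k\le\mathbf n}$ in $\mathbf R$ and $\{\mathbf x_{\mathbf k}\}_{\mathbf 1\le\mathbf k\le\mathbf n}$ in $\mathbf E$ with $n=\sum n_i|a_i$, the sum $\sum_{\mathbf 1\le\mathbf k\le\mathbf n}\mathbf r_{\mathbf k}\mathbf x_{\mathbf k}$ is the conditional element given by $\sum_i(\sum_{k=1}^{n_i}r_kx_k)|a_i$. $\mathrm{span}_{\mathbf R}\mathbf C$ is the conditional subset of all such sums with $\mathbf n\in\mathbf N$ and all $\mathbf x_{\mathbf k}\in\mathbf C$. *)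

(* Defs.v *)
From HB Require Import structures.
From mathcomp Require Import all_boot all_order all_algebra.
From mathcomp Require Import boolp classical_sets functions.

Set Implicit Arguments.
Unset Strict Implicit.
Unset Printing Implicit Defensive.

Import Order.Theory GRing.Theory.
Local Open Scope classical_set_scope.
Local Open Scope ring_scope.

HB.mixin Record isCompleteLattice d T of Order.CTBDistrLattice d T := {
  has_supremums : forall S : set T, supremums S !=set0
}.

#[short(type="completeBoolType")]
HB.structure Definition CompleteBool d :=
  { T of Order.CTBDistrLattice d T & isCompleteLattice d T }.

Section Partition.
Context {d : Order.disp_t} {A : completeBoolType d}.
Implicit Types (a b c t : A).

(* The families belonging to p(t). *)
Definition cpartition (I : Type) (a : I -> A) t :=
  (forall i j, i <> j -> (a i `&` a j = \bot)%O) /\ supremums (range a) t.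

Lemma meet_le_sup S s b c :
  supremums S s -> (forall a, S a -> (a `&` b <= c)%O) -> (s `&` b <= c)%O.
Proof.
move=> [_ sl] Sc; rewrite -[b]complK -diffE leBLR; apply: sl => a Sa.
by rewrite -leBLR diffE complK; apply: Sc.
Qed.

Lemma partition_le I (a : I -> A) b c :
  cpartition a \top%O -> (forall i, (b `&` a i <= c)%O) -> (b <= c)%O.
Proof.
move=> [_ sa] bc; rewrite -[b]meet1x; apply: (meet_le_sup sa) => _ [i _ <-].
by rewrite meetC.
Qed.

Lemma partition_compl a :
  cpartition (fun b : bool => if b then a else (~` a)%O) \top%O.
Proof.
split=> [[] [] // _|]; rewrite ?meetxC ?meetCx //; split=> [x _|x ux].
  exact: lex1.
rewrite -(joinxC a) leUx; apply/andP; split; apply: ux.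
  by exists true.
by exists false.
Qed.

Lemma partition_meet I (a : I -> A) b : cpartition a \top%O ->
  cpartition (fun p : I * bool => a p.1 `&` (if p.2 then b else ~` b))%O \top%O.
Proof.
move=> pa; split=> [[i c] [j c'] ij /=|].
  rewrite meetACA; have [iE|/pa.1 ->] := EM (i = j); last by rewrite meet0x.
  have /(partition_compl b).1 -> : c <> c' by move=> cE; apply: ij; rewrite iE cE.
  by rewrite meetx0.
split=> [x _|x ux]; first exact: lex1.
apply: (partition_le pa) => i; rewrite meet1x.
apply: (partition_le (partition_compl b)) => c.
by apply: ux; exists (i, c).
Qed.

End Partition.

(* A conditional set of the nonempty set E: [obj] is the collection of objects *)
(* and [rst x a] is x|a. By [rst_glue] with a one-element family, x|1 = y|1    *)
(* implies x = y, so the conditional elements x|1 are identified with the      *)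
(* elements x of E throughout.                                                 *)
Record condSet d (A : completeBoolType d) (E : Type) := CondSet {
  obj : Type;
  rst : E -> A -> obj;
  rst_nonempty : inhabited E;
  rst_alg : forall x y a b, rst x a = rst y b -> a = b;
  rst_le : forall x y a b, (a <= b)%O -> rst x b = rst y b -> rst x a = rst y a;
  rst_glue : forall (I : Type) (a : I -> A) (x : I -> E), cpartition a \top%O ->
    exists! z, forall i, rst z (a i) = rst (x i) (a i)
}.

Section CondSet.
Context d {A : completeBoolType d} {E : Type} (X : condSet A E).
Implicit Types (a b : A) (S : set E) (F G : set (obj X)).

(* [glue a x z] reads z = sum_i x_i|a_i. *)
Definition glue (I : Type) (a : I -> A) (x : I -> E) (z : E) :=
  forall i, rst X z (a i) = rst X (x i) (a i).

Lemma rst_cover (I : Type) (a : I -> A) b x y : cpartition a \top%O ->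
  (forall i, rst X x (a i `&` b)%O = rst X y (a i `&` b)%O) ->
  rst X x b = rst X y b.
Proof.
move=> pa xy.
have [t [tP _]] := rst_glue X (fun c : bool => if c then y else x) (partition_compl b).
suff <- : t = x by exact: (tP true).
have [v [_ vU]] := rst_glue X (fun=> t) (partition_meet b pa).
rewrite -(vU t) //; apply: vU => -[i []] /=.
  by rewrite xy; apply: rst_le (leIr _ _) _; rewrite (tP true).
by apply: rst_le (leIr _ _) _; rewrite (tP false).
Qed.

Definition stable S := S !=set0 /\
  forall (I : Type) (a : I -> A) (x : I -> E) z,
    cpartition a \top%O -> (forall i, S (x i)) -> glue a x z -> S z.

(* For nonempty S, the stable hull of S. *)
Definition hull S : set E :=
  [set x | forall S', stable S' -> S `<=` S' -> S' x].

(* S|a, as a collection of objects. *)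
Definition csub_of S a : set (obj X) :=
  [set o | exists x b, [/\ S x, (b <= a)%O & o = rst X x b]].

Definition is_csub_on a F := exists2 S, stable S & F = csub_of S a.
Definition is_csub F := exists a, is_csub_on a F.

(* The collection of all the conditional elements [x : S x], on 1. *)
Definition bracket S := csub_of (hull S) \top%O.

Definition cfull := csub_of setT \top%O.
Definition cnull := csub_of setT \bot%O.

(* The restriction F|a of a conditional subset. *)
Definition crestr F a : set (obj X) :=
  [set o | F o /\ exists x b, (b <= a)%O /\ o = rst X x b].

Definition cjoin (FF : set (set (obj X))) : set (obj X) :=
  [set o | forall G, is_csub G -> (forall F, FF F -> F `<=` G) -> G o].

Definition is_ccompl F G := [/\ is_csub G, F `&` G = cnull &
  forall G', is_csub G' -> F `&` G' = cnull -> G' `<=` G].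

End CondSet.

Arguments glue {d A E} X {I} a x z.
Arguments csub_of {d A E} X S a.
Arguments bracket {d A E} X S.
Arguments cfull {d A E} X.
Arguments cnull {d A E} X.

Section CondFun.
Context d {A : completeBoolType d} {E F : Type}.
Variables (X : condSet A E) (Y : condSet A F).

(* f restricted to S induces a conditional function on S|a, relatively to the *)
(* algebra of the elements below a. The values of f outside S are irrelevant. *)
Definition cfun_on (a : A) (S : set E) (f : E -> F) :=
  forall (I : Type) (b : I -> A) (x : I -> E) z, cpartition b a ->
    (forall i, S (x i)) -> S z -> glue X b x z -> glue Y b (f \o x) (f z).

Definition cfun (f : E -> F) := cfun_on \top%O setT f.

Lemma cfun_local f x y a : cfun f ->
  rst X x a = rst X y a -> rst Y (f x) a = rst Y (f y) a.
Proof.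
move=> cf xy.
have gx : glue X (fun b : bool => if b then a else (~` a)%O)
    (fun b => if b then y else x) x by move=> -[] /=.
exact: (cf _ _ _ _ (partition_compl a) (fun=> Logic.I) Logic.I gx true).
Qed.

Let prod_rst (p : E * F) a := (rst X p.1 a, rst Y p.2 a).

Lemma prod_nonempty : inhabited (E * F).
Proof. by case: (rst_nonempty X) (rst_nonempty Y) => x [y]; exists; exact: (x, y). Qed.

Lemma prod_alg p q a b : prod_rst p a = prod_rst q b -> a = b.
Proof. by move=> -[pq _]; apply: rst_alg pq. Qed.

Lemma prod_le p q a b :
  (a <= b)%O -> prod_rst p b = prod_rst q b -> prod_rst p a = prod_rst q a.
Proof.
by move=> ab [p1 p2]; rewrite /prod_rst (rst_le ab p1) (rst_le ab p2).
Qed.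

Lemma prod_glue (I : Type) (a : I -> A) (p : I -> E * F) : cpartition a \top%O ->
  exists! z, forall i, prod_rst z (a i) = prod_rst (p i) (a i).
Proof.
move=> pa; have [x [xP xU]] := rst_glue X (fst \o p) pa.
have [y [yP yU]] := rst_glue Y (snd \o p) pa.
exists (x, y); split=> [i|[x' y'] H]; first by rewrite /prod_rst /= xP yP.
by congr pair; [apply: xU|apply: yU] => i; case: (H i).
Qed.

Definition cprod : condSet A (E * F) :=
  CondSet prod_nonempty prod_alg prod_le prod_glue.

End CondFun.

(* A formal sum of terms t_i|a_i with t_i in T and {a_i} in p(1), given in      *)
(* normal form by t |-> sup {a_i : t_i = t}. See [rst_stepP] for its objects.   *)
Record step d (A : completeBoolType d) (T : Type) := Step {
  step_at :> T -> A;
  step_part : cpartition step_at \top%O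
}.
Arguments step {d} A T.

Section Step.
Context d {A : completeBoolType d} {T : Type}.
Implicit Types (f g : step A T).

Lemma step_eq f g : step_at f = step_at g -> f = g.
Proof.
case: f g => f fP [g gP] /= fg; case: _ / fg in gP *.
by rewrite (Prop_irrelevance fP gP).
Qed.

Lemma step_const_part (t0 : T) :
  cpartition (fun t => if `[< t = t0 >] then \top else \bot : A)%O \top%O.
Proof.
split=> [s t st|].
  case: asboolP => [sE|_]; last by rewrite meet0x.
  case: asboolP => [tE|_]; last by rewrite meetx0.
  by case: st; rewrite sE tE.
split=> [a _|a ua]; first exact: lex1.
by apply: ua; exists t0 => //; case: asboolP.
Qed.

(* The formal sum t0|1. *)
Definition step_const (t0 : T) : step A T := Step (step_const_part t0).

(* Componentwise relations and operations. *)
Definition step_rel (P : T -> T -> Prop) f g :=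
  forall s t, (f s `&` g t)%O <> \bot%O -> P s t.

Definition step_op (op : T -> T -> T) f g h :=
  forall s t u, (f s `&` g t `&` h u)%O <> \bot%O -> u = op s t.

Let step_rst f a := (a, fun t => (f t `&` a)%O).

Lemma step_alg f g a b : step_rst f a = step_rst g b -> a = b.
Proof. by case. Qed.

Lemma step_le f g a b :
  (a <= b)%O -> step_rst f b = step_rst g b -> step_rst f a = step_rst g a.
Proof.
move=> /meet_idPr ab [/funeqP fg]; congr pair; apply/funext => t.
by rewrite -ab !meetA fg.
Qed.

Lemma step_glue (I : Type) (a : I -> A) (f : I -> step A T) :
  cpartition a \top%O ->
  exists! z, forall i, step_rst z (a i) = step_rst (f i) (a i).
Proof.
move=> pa.
have /choice [g gP] t := has_supremums (range (fun i => f i t `&` a i)%O).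
have ga t i : (g t `&` a i = f i t `&` a i)%O.
  apply/le_anti/andP; split.
    apply: (meet_le_sup (gP t)) => _ [j _ <-].
    have [->|ji] := EM (j = i); first by rewrite -meetA meetxx.
    by rewrite -meetA pa.1 // meetx0 le0x.
  by rewrite lexI leIr andbT; apply: (gP t).1; exists i.
have gpart : cpartition g \top%O.
  split=> [s t st|].
    apply/eqP; rewrite -lex0; apply: (partition_le pa) => i.
    by rewrite -[a i]meetxx meetACA !ga meetACA (step_part (f i)).1 // meet0x.
  split=> [x _|u ug]; first exact: lex1.
  apply: (partition_le pa) => i; apply: (meet_le_sup (step_part (f i)).2) => _ [t _ <-].
  by rewrite -ga; apply: (le_trans (leIl _ _)); apply: ug; exists t.
exists (Step gpart); split=> [i|h hP].
  by congr pair; apply/funext => t; exact: ga.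
apply: step_eq; apply/funext => t /=.
have ha i : (h t `&` a i = f i t `&` a i)%O by case: (hP i) => /funeqP.
by apply/le_anti/andP; split; apply: (partition_le pa) => i; rewrite ?ga -?ha ?leIl // ha -ga leIl.
Qed.

Definition step_cset (t0 : T) : condSet A (step A T) :=
  CondSet (inhabits (step_const t0)) step_alg step_le step_glue.

Lemma rst_stepP t0 f g a : rst (step_cset t0) f a = rst (step_cset t0) g a <->
  (forall s t, (f s `&` g t `&` a)%O <> \bot%O -> s = t).
Proof.
split=> [[/funeqP fg] s t|H].
  apply: contra_notP => st; rewrite meetAC fg -meetA [(a `&` _)%O]meetC meetA.
  by rewrite (step_part g).1 ?meet0x.
congr pair; apply/funext => t; apply/le_anti/andP; split.
  apply: (partition_le (step_part g)) => s.
  have [->|st] := EM (s = t).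
    by rewrite lexI leIr /=; apply: le_trans (leIl _ _) (leIr _ _).
  have -> : (f t `&` a `&` g s)%O = \bot%O; last exact: le0x.
  by rewrite meetAC; apply: contra_notP st => /H ->.
apply: (partition_le (step_part f)) => s.
have [->|st] := EM (s = t).
    by rewrite lexI leIr /=; apply: le_trans (leIl _ _) (leIr _ _).
have -> : (g t `&` a `&` f s)%O = \bot%O; last exact: le0x.
by rewrite meetAC [(g t `&` _)%O]meetC; apply: contra_notP st => /H ->.
Qed.

End Step.

Definition posnat := {n : nat | (0 < n)%N}.
Definition posnat1 : posnat := exist _ 1%N isT.

Section Numbers.
Context d (A : completeBoolType d).

Definition cN := step A posnat.
Definition csetN : condSet A cN := step_cset posnat1.
Definition cQ := step A rat.
Definition csetQ : condSet A cQ := step_cset 0.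

Definition Nle (k n : cN) := step_rel (fun i j => val i <= val j)%N k n.
Definition Nlt (k n : cN) := step_rel (fun i j => val i < val j)%N k n.

(* [k : 1 <= k <= n] *)
Definition segment (n : cN) : set cN :=
  hull csetN [set k | Nle (step_const posnat1) k /\ Nle k n].

End Numbers.

Arguments csetN {d A}.
Arguments csetQ {d A}.

(* The conditional subset J on a is in conditional bijection with              *)
(* [k : 1 <= k <= n]|a. Formal sums of natural numbers over a partition of a    *)
(* are the k|a with k : cN, so no generality is lost by taking n in cN.         *)
Definition cfinite_on d (A : completeBoolType d) (E : Type) (X : condSet A E)
    (a : A) (J : set (obj X)) :=
  is_csub_on a J /\ exists (n : cN A) (f : cN A -> E),
  [/\ cfun_on csetN X a (segment n) f,
      (forall k l, segment n k -> segment n l ->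
        (forall b, (b <= a)%O -> b <> \bot%O -> rst csetN k b <> rst csetN l b) ->
        forall b, (b <= a)%O -> b <> \bot%O -> rst X (f k) b <> rst X (f l) b) &
      (forall x, J (rst X x a) <->
        exists2 k, segment n k & rst X x a = rst X (f k) a)].

(* The conditional real numbers: a model of the axioms, unique up to isomorphism. *)
Record creals d (A : completeBoolType d) := CReals {
  R_ring :> comPzRingType;
  csetR : condSet A R_ring;
  Rle : R_ring -> R_ring -> Prop;
  R_add_stable : cfun (cprod csetR csetR) csetR (fun p => p.1 + p.2);
  R_mul_stable : cfun (cprod csetR csetR) csetR (fun p => p.1 * p.2);
  R_inv : forall r, (forall a, a <> \bot%O -> rst csetR r a <> rst csetR 0 a) ->
    exists s, r * s = 1;
  Rle_refl : forall r, Rle r r;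
  Rle_anti : forall r s, Rle r s -> Rle s r -> r = s;
  Rle_trans : forall r s t, Rle r s -> Rle s t -> Rle r t;
  Rle_stable : forall (I : Type) (a : I -> A) (r s : I -> R_ring) u v,
    cpartition a \top%O -> (forall i, Rle (r i) (s i)) ->
    glue csetR a r u -> glue csetR a s v -> Rle u v;
  Rle_add : forall r s t, Rle r s -> Rle (r + t) (s + t);
  Rle_mul : forall r s, Rle 0 r -> Rle 0 s -> Rle 0 (r * s);
  (* z = r|a + s|a^c *)
  Rle_total : forall r s, exists a z, [/\ rst csetR z a = rst csetR r a,
    rst csetR z (~` a)%O = rst csetR s (~` a)%O, Rle z s & Rle z r];
  R_dedekind : forall S, stable csetR S ->
    (exists u, forall r, S r -> Rle r u) ->
    exists s, (forall r, S r -> Rle r s) /\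
      (forall u, (forall r, S r -> Rle r u) -> Rle s u);
  R_of_Q : exists iota : cQ A -> R_ring,
    [/\ forall (p q : cQ A) a, rst csetR (iota p) a = rst csetR (iota q) a <->
          rst csetQ p a = rst csetQ q a,
        cfun csetQ csetR iota,
        iota (step_const 1) = 1,
        (forall p q s : cQ A, step_op +%R p q s -> iota s = iota p + iota q) /\
        (forall p q s : cQ A, step_op *%R p q s -> iota s = iota p * iota q) &
        forall p q : cQ A, Rle (iota p) (iota q) <->
          step_rel (fun x y => (x <= y)%R) p q]
}.

Section Reals.
Context d {A : completeBoolType d} {R : creals A}.
Implicit Types (r s t u : R) (S : set R).

Definition Rlt r s := Rle r s /\
  forall a : A, a <> \bot%O -> rst (csetR R) r a <> rst (csetR R) s a.

Definition is_Rsup S s := (forall r, S r -> Rle r s) /\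
  (forall u, (forall r, S r -> Rle r u) -> Rle s u).

(* The supremum when it exists, and 0 otherwise. *)
Definition Rsup S : R := xget 0 [set s | is_Rsup S s].

Definition Rabs r : R := Rsup [set r; - r].

Lemma Radd_local (a : A) r r' s s' :
  rst (csetR R) r a = rst (csetR R) r' a ->
  rst (csetR R) s a = rst (csetR R) s' a ->
  rst (csetR R) (r + s) a = rst (csetR R) (r' + s') a.
Proof.
move=> rr ss; apply: (cfun_local (x := (r, s)) (y := (r', s')) (@R_add_stable _ _ R)).
by rewrite /= rr ss.
Qed.

Lemma Rmul_local (a : A) r r' s s' :
  rst (csetR R) r a = rst (csetR R) r' a ->
  rst (csetR R) s a = rst (csetR R) s' a ->
  rst (csetR R) (r * s) a = rst (csetR R) (r' * s') a.
Proof.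
move=> rr ss; apply: (cfun_local (x := (r, s)) (y := (r', s')) (@R_mul_stable _ _ R)).
by rewrite /= rr ss.
Qed.

Lemma Ropp_local (a : A) r r' :
  rst (csetR R) r a = rst (csetR R) r' a ->
  rst (csetR R) (- r) a = rst (csetR R) (- r') a.
Proof.
move=> rr; have := Radd_local rr (erefl (rst (csetR R) (- r - r') a)).
by rewrite addrA subrr add0r addrC subrK => ->.
Qed.

Lemma Rle_opp r s : Rle r s -> Rle (- s) (- r).
Proof.
by move=> /(Rle_add (- r - s)); rewrite addrA subrr add0r addrC subrK.
Qed.

Lemma Rle_addl r r' s s' : Rle r r' -> Rle s s' -> Rle (r + s) (r' + s').
Proof.
move=> /(Rle_add s) rr /(Rle_add r'); rewrite addrC [s' + r']addrC.
exact: Rle_trans.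
Qed.

Lemma is_Rsup_uniq S s t : is_Rsup S s -> is_Rsup S t -> s = t.
Proof. by move=> [s1 s2] [t1 t2]; apply: Rle_anti; [apply: s2|apply: t2]. Qed.

Lemma Rsup_eq S s : is_Rsup S s -> Rsup S = s.
Proof. by move=> Ss; apply: xget_unique => // t /is_Rsup_uniq; apply. Qed.

Lemma Rabs_is_sup r : is_Rsup [set r; - r] (Rabs r).
Proof.
suff [s Ps] : exists s, is_Rsup [set r; - r] s by rewrite /Rabs (Rsup_eq Ps).
have [a [z [za zc zN zr]]] := Rle_total r (- r).
exists (- z); split=> [_ [->|->]|u uP].
- by rewrite -[X in Rle X _]opprK; apply: Rle_opp.
- exact: Rle_opp.
- apply: (@Rle_stable _ _ R _ _ (fun b : bool => if b then - r else r) (fun=> u)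
    _ _ (partition_compl a)) => [[]|[]|//]; first by apply: uP; right.
  + by apply: uP; left.
  + exact: Ropp_local.
  + by rewrite (Ropp_local zc) opprK.
Qed.

Lemma Rabs_least r u : Rle r u -> Rle (- r) u -> Rle (Rabs r) u.
Proof. by move=> ru nu; apply: (Rabs_is_sup r).2 => _ [->|->]. Qed.

Lemma Rabs_ge r : Rle r (Rabs r).
Proof. by apply: (Rabs_is_sup r).1; left. Qed.

Lemma Rabs_geN r : Rle (- r) (Rabs r).
Proof. by apply: (Rabs_is_sup r).1; right. Qed.

Lemma Rabs_stable : cfun (csetR R) (csetR R) Rabs.
Proof.
move=> I a x z pa _ _ xz.
have [s [sP _]] := rst_glue (csetR R) (Rabs \o x) pa.
suff -> : Rabs z = s by [].
apply: Rsup_eq; split=> [_ [->|->]|u uP].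
- by apply: Rle_stable pa _ xz sP => i; apply: Rabs_ge.
- apply: (Rle_stable (r := fun i => - x i)) pa _ _ sP => i; first exact: Rabs_geN.
  exact: Ropp_local.
have /choice [v vP] i : exists v, Rle (Rabs (x i)) v /\
    rst (csetR R) v (a i) = rst (csetR R) u (a i).
  have pc := partition_compl (a i).
  have [v [vP _]] := rst_glue (csetR R) (fun b : bool => if b then u else Rabs (x i)) pc.
  exists v; split; last exact: (vP true).
  apply: Rabs_least.
    apply: (Rle_stable (r := fun b : bool => if b then z else x i)) pc _ _ vP => [[]|[]//=].
    + by apply: uP; left.
    + exact: Rabs_ge.
  apply: (Rle_stable (r := fun b : bool => if b then - z else - x i)) pc _ _ vP => [[]|[]//=].
  + by apply: uP; right.
  + exact: Rabs_geN.
  + exact/Ropp_local/esym/xz.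
by apply: (Rle_stable (s := v)) pa _ sP _ => i; case: (vP i).
Qed.

Lemma RabsN r : Rabs (- r) = Rabs r.
Proof. by rewrite /Rabs opprK setUC. Qed.

Lemma RabsD r s : Rle (Rabs (r + s)) (Rabs r + Rabs s).
Proof.
apply: Rabs_least; first by apply: Rle_addl; apply: Rabs_ge.
by rewrite opprD; apply: Rle_addl; apply: Rabs_geN.
Qed.

Lemma Rabs0 : Rabs 0 = 0.
Proof.
by apply: Rsup_eq; rewrite oppr0 setUid; split=> [_ ->|u]; [exact: Rle_refl|apply].
Qed.

End Reals.

Record cnormed d (A : completeBoolType d) (R : creals A) := CNormed {
  E_mod :> lmodType R;
  csetE : condSet A E_mod;
  E_add_stable : cfun (cprod csetE csetE) csetE (fun p => p.1 + p.2);
  E_scale_stable : cfun (cprod (csetR R) csetE) csetE (fun p => p.1 *: p.2);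
  E_support : supremums [set a | exists x, forall b, b <> \bot%O -> (b <= a)%O ->
    rst csetE x b <> rst csetE 0 b] \top%O;
  norm : E_mod -> R;
  norm_stable : cfun csetE (csetR R) norm;
  norm_ge0 : forall x, Rle 0 (norm x);
  normZ : forall r x, norm (r *: x) = Rabs r * norm x;
  norm_triangle : forall x y, Rle (norm (x + y)) (norm x + norm y);
  norm_eq0 : forall x, norm x = 0 -> x = 0
}.

Section Topology.
Context d {A : completeBoolType d} {E : Type} (X : condSet A E).
(* T is the collection of the conditionally open conditional subsets. *)
Implicit Types (T : set (set (obj X))) (K F U : set (obj X)).

Definition cclosed T F := exists2 G, is_ccompl F G & T G.

Definition cclosure T F : set (obj X) :=
  \bigcap_(G in [set G | [/\ is_csub G, cclosed T G & F `<=` G]]) G.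

Definition reltop T K : set (set (obj X)) :=
  [set V | exists2 O, T O & V = O `&` K].

(* In the definitions below K is the whole space, on 1, and T its topology. *)

Definition cfamily (I : Type) (Y : condSet A I) (U : I -> set (obj X)) :=
  (forall i, is_csub_on \top%O (U i)) /\
  forall (J : Type) (a : J -> A) (i : J -> I) k, cpartition a \top%O ->
    glue Y a i k -> forall j, crestr (U k) (a j) = crestr (U (i j)) (a j).

Definition ccompact_space T K :=
  forall (I : Type) (Y : condSet A I) (U : I -> set (obj X)),
    cfamily Y U -> (forall i, T (U i)) -> K = cjoin (range U) ->
    exists a J, cfinite_on (X := Y) a J /\
      K = cjoin [set crestr (U i) a | i in [set i | J (rst Y i a)]].

Definition cnbhs T K x U := [/\ is_csub U, U `<=` K &
  exists O, [/\ T O, O (rst X x \top%O) & O `<=` U]].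

Definition climit T K (u : cN A -> E) x :=
  forall U, cnbhs T K x U ->
    exists m, forall n, Nle m n -> U (rst X (u n) \top%O).

Definition cseq_compact_space T K :=
  forall u : cN A -> E, cfun csetN X u -> (forall n, K (rst X (u n) \top%O)) ->
  exists phi : cN A -> cN A,
    [/\ cfun csetN csetN phi, (forall k l, Nlt k l -> Nlt (phi k) (phi l)) &
        exists2 x, K (rst X x \top%O) & climit T K (u \o phi) x].

(* Compactness of a conditional subset on 1, in its relative topology. *)
Definition ccompact T K := ccompact_space (reltop T K) K.
Definition cseq_compact T K := cseq_compact_space (reltop T K) K.

End Topology.

Section WeakTopology.
Context d {A : completeBoolType d} {R : creals A}.
Variables (E : zmodType) (X : condSet A E) (F : Type) (Y : condSet A F).
(* The duality pairing. *)
Variable p : E -> F -> R.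

Definition weak_ball (G : set (obj Y)) (r : R) : set E :=
  hull X [set y | Rle (Rsup (hull (csetR R)
    [set Rabs (p y f) | f in [set f | G (rst Y f \top%O)]])) r].

Definition weak_open : set (set (obj X)) :=
  [set O | exists2 a, is_csub_on a O &
    forall x, O (rst X x a) ->
    exists G r, [/\ cfinite_on (X := Y) \top%O G, Rlt 0 r &
      csub_of X [set x + y | y in weak_ball G r] a `<=` O]].

End WeakTopology.

Arguments weak_open {d A R E} X {F} Y p.

Section Normed.
Context d {A : completeBoolType d} {R : creals A} (E : cnormed R).
Implicit Types (x y : E) (r : R) (C : set (obj (csetE E))).

Definition closed_ball x r : set E :=
  hull (csetE E) [set y | Rle (norm (x - y)) r].

Definition norm_open : set (set (obj (csetE E))) :=
  [set O | exists2 a, is_csub_on a O &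
    forall x, O (rst (csetE E) x a) ->
    exists2 r, Rlt 0 r & csub_of (csetE E) (closed_ball x r) a `<=` O].

Definition ccauchy (u : cN A -> E) := forall r, Rlt 0 r ->
  exists n, forall k l, Nlt n k -> Nlt n l -> Rle (norm (u k - u l)) r.

Definition cbanach := forall u : cN A -> E, cfun csetN (csetE E) u ->
  ccauchy u -> exists x, climit norm_open (cfull (csetE E)) u x.

Definition cconvex C := forall r x y, C (rst _ x \top%O) -> C (rst _ y \top%O) ->
  Rle 0 r -> Rle r 1 -> C (rst _ (r *: x + (1 - r) *: y) \top%O).

Definition cbalanced C := forall r x, C (rst _ x \top%O) ->
  Rle (Rabs r) 1 -> C (rst _ (r *: x) \top%O).

(* z is the sum of r_k x_k over 1 <= k <= n. For n = sum_i n_i|a_i, the natural *)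
(* number k <= n_i need not index the families globally: on a_i it is          *)
(* represented by any kappa k in the segment such that kappa k = k on a_i.      *)
Definition is_csum (n : cN A) (r : cN A -> R) (u : cN A -> E) (z : E) :=
  forall m : posnat, exists kappa : posnat -> cN A,
    (forall k : posnat, (val k <= val m)%N -> segment n (kappa k) /\
      rst csetN (kappa k) (n m) = rst csetN (step_const k) (n m)) /\
    rst (csetE E) z (n m) = rst (csetE E)
      (\sum_(i < val m) let k := kappa (exist _ i.+1 isT) in r k *: u k) (n m).

Definition cspan C : set (obj (csetE E)) := csub_of (csetE E)
  [set z | exists (n : cN A) (r : cN A -> R) (u : cN A -> E),
    [/\ cfun_on csetN (csetR R) \top%O (segment n) r,
        cfun_on csetN (csetE E) \top%O (segment n) u,
        forall k, segment n k -> C (rst _ (u k) \top%O) &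
        is_csum n r u z]] \top%O.

End Normed.

Arguments norm_open {d A R} E.
Arguments cbanach {d A R} E.

(* The conditionally linear, conditionally continuous functions from E to R. *)
Record cdual d (A : completeBoolType d) (R : creals A) (E : cnormed R) := Dual {
  dual_fun :> E -> R;
  dual_stable : cfun (csetE E) (csetR R) dual_fun;
  dual_linear : forall r x y, dual_fun (r *: x + y) = r * dual_fun x + dual_fun y;
  dual_cont : exists r, forall x, Rle (Rabs (dual_fun x)) (r * norm x)
}.

Section Dual.
Context d {A : completeBoolType d} {R : creals A} {E : cnormed R}.
Implicit Types (f g h : cdual E).

Lemma dual_eq f g : (forall x, f x = g x) -> f = g.
Proof.
case: f g => f f1 f2 f3 [g g1 g2 g3] /= /funext fg.
case: _ / fg in g1 g2 g3 *.
by rewrite (Prop_irrelevance f1 g1) (Prop_irrelevance f2 g2) (Prop_irrelevance f3 g3).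
Qed.

HB.instance Definition _ := gen_eqMixin (cdual E).
HB.instance Definition _ := gen_choiceMixin (cdual E).

Fact dual0_stable : cfun (csetE E) (csetR R) (fun=> 0).
Proof. by []. Qed.
Fact dual0_linear (r : R) (x y : E) : 0 = r * 0 + 0 :> R.
Proof. by rewrite mulr0 addr0. Qed.
Fact dual0_cont : exists r, forall x : E, Rle (Rabs (0 : R)) (r * norm x).
Proof. by exists 0 => x; rewrite Rabs0 mul0r; apply: Rle_refl. Qed.
Definition dual0 : cdual E := Dual dual0_stable dual0_linear dual0_cont.

Fact dualN_stable f : cfun (csetE E) (csetR R) (fun x => - f x).
Proof.
by move=> I a x z pa _ _ xz i; apply: Ropp_local; apply: (cfun_local (dual_stable f)).
Qed.
Fact dualN_linear f r x y : - f (r *: x + y) = r * (- f x) - f y.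
Proof. by rewrite dual_linear opprD mulrN. Qed.
Fact dualN_cont f : exists r, forall x, Rle (Rabs (- f x)) (r * norm x).
Proof. by have [r rP] := dual_cont f; exists r => x; rewrite RabsN. Qed.
Definition dualN f : cdual E :=
  Dual (dualN_stable f) (dualN_linear f) (dualN_cont f).

Fact dualD_stable f g : cfun (csetE E) (csetR R) (fun x => f x + g x).
Proof.
by move=> I a x z pa _ _ xz i; apply: Radd_local; apply: (cfun_local (dual_stable _)).
Qed.
Fact dualD_linear f g r x y :
  f (r *: x + y) + g (r *: x + y) = r * (f x + g x) + (f y + g y).
Proof. by rewrite !dual_linear mulrDr addrACA. Qed.
Fact dualD_cont f g : exists r, forall x, Rle (Rabs (f x + g x)) (r * norm x).
Proof.
have [r rP] := dual_cont f; have [s sP] := dual_cont g; exists (r + s) => x.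
by rewrite mulrDl; apply: Rle_trans (RabsD _ _) _; apply: Rle_addl.
Qed.
Definition dualD f g : cdual E :=
  Dual (dualD_stable f g) (dualD_linear f g) (dualD_cont f g).

Fact dualDA : associative dualD.
Proof. by move=> f g h; apply: dual_eq => x; rewrite /= addrA. Qed.
Fact dualDC : commutative dualD.
Proof. by move=> f g; apply: dual_eq => x; rewrite /= addrC. Qed.
Fact dual0D : left_id dual0 dualD.
Proof. by move=> f; apply: dual_eq => x; rewrite /= add0r. Qed.
Fact dualND : left_inverse dual0 dualN dualD.
Proof. by move=> f; apply: dual_eq => x; rewrite /= addNr. Qed.

HB.instance Definition _ :=
  GRing.isZmodule.Build (cdual E) dualDA dualDC dual0D dualND.

Let dual_rst f (a : A) := (a, fun x => rst (csetR R) (f x) a).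

Lemma dual_alg f g a b : dual_rst f a = dual_rst g b -> a = b.
Proof. by case. Qed.

Lemma dual_le f g a b :
  (a <= b)%O -> dual_rst f b = dual_rst g b -> dual_rst f a = dual_rst g a.
Proof.
move=> ab [/funeqP fg]; congr pair; apply/funext => x.
exact: rst_le ab (fg x).
Qed.

Lemma dual_glue (I : Type) (a : I -> A) (f : I -> cdual E) :
  cpartition a \top%O ->
  exists! z, forall i, dual_rst z (a i) = dual_rst (f i) (a i).
Proof.
move=> pa.
have /choice [h hP] x : exists r, forall i,
    rst (csetR R) r (a i) = rst (csetR R) (f i x) (a i).
  by have [r [rP _]] := rst_glue (csetR R) (fun i => f i x) pa; exists r.
have hI x b i : rst (csetR R) (h x) (a i `&` b)%O = rst (csetR R) (f i x) (a i `&` b)%O.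
  exact: rst_le (leIl _ _) (hP x i).
have uniq (r s : R) : (forall i, rst (csetR R) r (a i) = rst (csetR R) s (a i)) -> r = s.
  by move=> rs; have [t [_ tU]] := rst_glue (csetR R) (fun i => s) pa; rewrite -(tU r) // (tU s).
have hs : cfun (csetE E) (csetR R) h.
  move=> J b x z _ _ _ xz j; apply: (rst_cover pa) => i; rewrite !hI.
  by apply: (cfun_local (dual_stable (f i))); apply: rst_le (leIr _ _) (xz j).
have hl r x y : h (r *: x + y) = r * h x + h y.
  apply: uniq => i; rewrite hP dual_linear.
  by apply: Radd_local; [apply: Rmul_local|]; rewrite ?hP.
have hc : exists r, forall x, Rle (Rabs (h x)) (r * norm x).
  have /choice [r rP] i := dual_cont (f i).
  have [s [sP _]] := rst_glue (csetR R) r pa.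
  exists s => x; apply: (Rle_stable (r := fun i => Rabs (f i x))) pa (fun i => rP i x) _ _ => i.
    by apply: (cfun_local (@Rabs_stable _ _ R)); rewrite hP.
  by apply: Rmul_local; rewrite ?sP.
exists (Dual hs hl hc); split=> [i|g gP].
  rewrite /dual_rst; congr pair; apply/funext => x; exact: hP.
apply: dual_eq => x; apply: uniq => i; rewrite /= hP.
by have [/funeqP ->] := gP i.
Qed.

Definition csetDual : condSet A (cdual E) :=
  CondSet (inhabits dual0) dual_alg dual_le dual_glue.

(* sup [ |f(x)| : ||x|| <= 1 ] *)
Definition dual_norm f : R := Rsup (hull (csetR R)
  [set Rabs (f x) | x in hull (csetE E) [set x | Rle (norm x) 1]]).

Definition dual_ball : set (obj csetDual) :=
  bracket csetDual [set f | Rle (dual_norm f) 1].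

End Dual.

Arguments csetDual {d A R} E.
Arguments dual_ball {d A R} E.

Section WeakTopologies.
Context d {A : completeBoolType d} {R : creals A} (E : cnormed R).

(* sigma(E, E* ) and sigma(E*, E) *)
Definition sigma_weak : set (set (obj (csetE E))) :=
  weak_open (csetE E) (csetDual E) (fun (x : E) (f : cdual E) => f x).
Definition sigma_weak_star : set (set (obj (csetDual E))) :=
  weak_open (csetDual E) (csetE E) (fun (f : cdual E) (x : E) => f x).

End WeakTopologies.

Arguments sigma_weak {d A R} E.
Arguments sigma_weak_star {d A R} E.

(* Main.v *)
(** Let u be a conditional sequence in the dual ball, f_n = u(n) for standard n.
    The conditional set C has a countable subset D that is dense in C for the
    pseudometrics |f_n(x) - f_n(y)|, because a countable power of R is
    separable. By a diagonal Bolzano-Weierstrass argument a conditional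
    subsequence g of u converges on D. Let p(x) be the oscillation of g(x), a seminorm. If p(x) > 0
    for some x in C, then every y in C is separated from the elements of D that
    approximate x: by some f_n if f_n(y) <> f_n(x), and otherwise p(y) = p(x) > 0
    and a Hahn-Banach functional below p is nonzero at y but vanishes on D. By
    weak compactness finitely many separating functionals suffice for all y in C,
    which is absurd for y in D close enough to x. Hence p vanishes on C, on its
    span and, being continuous, on E, so g converges pointwise to an element of
    the dual ball.

    Conditional statements are proved by density, as in forcing: a local property
    holds on a as soon as every nonzero b <= a has a nonzero c <= b on which it
    holds, and local witnesses are glued into global ones. *)

Require Import Defs.
From mathcomp Require Import all_boot all_order all_algebra.
From mathcomp Require Import boolp classical_sets.
From mathcomp Require Import ring lra.

Set Implicit Arguments.
Unset Strict Implicit.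
Unset Printing Implicit Defensive.

Import Order.Theory GRing.Theory Num.Theory.
Local Open Scope classical_set_scope.
Local Open Scope ring_scope.

(** * Local properties and mixing *)

(** The obstacle is that statements about elements have no global truth value: an inequality may
    hold on one part of 1 and fail on another, and R has zero divisors. Two devices deal with this.
    Restriction to a is expressed by multiplication by an indicator, so linear and sublinear maps
    are local for free. And an inequality that fails does so by a standard rational 1/(n+1) on some
    nonzero part, which gives concrete gaps to contradict. Countability is external: a conditional
    sequence is determined by its values at standard integers, and a conditional natural number is
    locally standard, so most of the argument runs on sequences indexed by [nat]. E need not be norm
    separable, hence D is dense only for the pseudometrics given by the f_n. The Hahn-Banach
    functional takes care of the points that these do not separate: p vanishes wherever all f_n do,
    so p(x - y) = 0 there; and the functional is squeezed between -p and p, hence vanishes on D.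
    Separating pairs are normalized to gap 1, so that one threshold serves on all parts. *)

Section Locally.
Context {d : Order.disp_t} {A : completeBoolType d}.
Implicit Types (a b c : A) (P Q : A -> Prop).

(* Density of P below b, in the sense of forcing. *)
Definition locally P b := forall c, (c <= b)%O -> c <> \bot%O ->
  exists c', [/\ (c' <= c)%O, c' <> \bot%O & P c'].

Definition antitone P := forall b c, (c <= b)%O -> P b -> P c.

Lemma le_neq_bot b c : (b <= c)%O -> b <> \bot%O -> c <> \bot%O.
Proof. by move=> bc b0 c0; apply: b0; apply/eqP; rewrite -lex0 -c0. Qed.

Lemma meet_bot_le b c : (b `&` c)%O = \bot%O -> (b <= ~` c)%O.
Proof. by move=> bc; rewrite -[b]meetx1 -(joinxC c) meetUr bc join0x leIr. Qed.

Lemma locally_le P b c : (c <= b)%O -> locally P b -> locally P c.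
Proof. by move=> cb Pb e ec; apply: Pb; apply: le_trans ec cb. Qed.

Lemma locally_imp P Q b : (forall c, (c <= b)%O -> P c -> Q c) ->
  locally P b -> locally Q b.
Proof.
move=> PQ Pb c cb c0; have [c' [c'c c'0 Pc']] := Pb c cb c0.
by exists c'; split=> //; apply: PQ Pc'; apply: le_trans c'c cb.
Qed.

Lemma locally_self P b : antitone P -> P b -> locally P b.
Proof. by move=> aP Pb c cb c0; exists c; split=> //; apply: aP Pb. Qed.

Lemma locally_locally P b : locally (locally P) b -> locally P b.
Proof.
move=> Pb c cb c0; have [c' [c'c c'0 Pc']] := Pb c cb c0.
have [e [ec' e0 Pe]] := Pc' c' (lexx _) c'0.
by exists e; split=> //; apply: le_trans ec' c'c.
Qed.

Lemma locally_part I (a : I -> A) P : cpartition a \top%O ->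
  (forall i, locally P (a i)) -> locally P \top%O.
Proof.
move=> pa Pa c _ c0; have [i ci0] : exists i, (c `&` a i)%O <> \bot%O.
  apply: contra_notP c0 => /forallNP H; apply/eqP; rewrite -lex0.
  by apply: (partition_le pa) => i; have /contrapT -> := H i.
have [e [ec e0 Pe]] := Pa i _ (leIr (a i) c) ci0.
by exists e; split=> //; apply: le_trans ec (leIl _ _).
Qed.

Lemma locally_sup (D : set A) s P : supremums D s ->
  (forall b, D b -> locally P b) -> locally P s.
Proof.
move=> Ds PD c cs c0; have [b [Db cb0]] : exists b, D b /\ (c `&` b)%O <> \bot%O.
  apply: contra_notP c0 => /forallNP H; apply/eqP; rewrite -lex0.
  have -> : c = (s `&` c)%O by rewrite meetC; apply/esym/meet_idPl.
  apply: (meet_le_sup Ds) => b Db; rewrite meetC.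
  by have := H b; case/not_andP => // /contrapT ->.
have [e [ec e0 Pe]] := PD b Db _ (leIr b c) cb0.
by exists e; split=> //; apply: le_trans ec (leIl _ _).
Qed.

(** A maximal disjoint family of nonzero elements satisfying P, given by Zorn's lemma, has supremum
    1: below the complement of a smaller upper bound, density would provide one more member. *)
Lemma locally_partition P : locally P \top%O ->
  exists (I : Type) (a : I -> A), cpartition a \top%O /\ forall i, P (a i).
Proof.
move=> Pt.
pose good (D : set A) := (forall x, D x -> x <> \bot%O /\ P x) /\
  forall x y, D x -> D y -> x <> y -> (x `&` y = \bot)%O.
have [F FP Ftot|D [[Dn Dd] Dmax]] := @Zorn_bigcup A good.
  split=> [x [X FX Xx]|x y [X FX Xx] [Y FY Yy]]; first by have [+ _] := FP _ FX; apply.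
  have [XY|YX] := Ftot _ _ FX FY.
    by have [_] := FP _ FY; apply=> //; apply: XY.
  by have [_] := FP _ FX; apply=> //; apply: YX.
exists {x | D x}, (fun x => sval x); split=> [|[x Dx]] /=; last by case: (Dn x Dx).
split=> [[x Dx] [y Dy] xy|] /=.
  apply: Dd => // xyE; apply: xy; case: _ / xyE in Dy *.
  by rewrite (Prop_irrelevance Dx Dy).
split=> [x _|u uD]; first exact: lex1.
have [uc0|uc0] := EM ((~` u)%O = \bot%O :> A).
  by rewrite -[u]complK uc0 compl0 lexx.
have [c [cu c0 Pc]] := Pt _ (lex1 _) uc0.
have Dcbot x : D x -> (x `&` c)%O = \bot%O.
  move=> Dx; have xu : (x <= u)%O by apply: uD; exists (exist _ x Dx).
  apply/eqP; rewrite -lex0 -(meetxC u); exact: leI2.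
exfalso; apply: (Dmax (D `|` [set c])).
  split=> [x Dx|/(_ c (or_intror erefl)) Dc]; first by left.
  by apply: c0; rewrite -(Dcbot c Dc) meetxx.
split=> [x [/Dn //|->//]|x y [Dx|->] [Dy|->] xy]; [exact: Dd|exact: Dcbot| |by []].
by rewrite meetC; exact: Dcbot.
Qed.

End Locally.

Section Mixing.
Context {d : Order.disp_t} {A : completeBoolType d}.
Implicit Types (a b c : A).

Definition local_pred {E} (X : condSet A E) (P : E -> A -> Prop) :=
  forall x y b, rst X x b = rst X y b -> P x b -> P y b.

Context {E : Type} (X : condSet A E).
Implicit Types (S : set E) (x y z : E).

Lemma rst_top x y : rst X x \top%O = rst X y \top%O -> x = y.
Proof.
move=> xy; have pc := partition_compl (\top%O : A).
have [z [_ zU]] := rst_glue X (fun=> y) pc.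
by rewrite -(zU x) ?(zU y) // => i; apply: rst_le (lex1 _) xy.
Qed.

Lemma rst_top_inj x y b : rst X x \top%O = rst X y b -> b = \top%O /\ x = y.
Proof. by move=> xy; have bE := rst_alg xy; rewrite -bE in xy *; split=> //; apply: rst_top. Qed.

(** The family 1, 0 is a partition of 1, so x on 1 may be glued with y on 0. *)
Lemma rst_bot x y : rst X x \bot%O = rst X y \bot%O.
Proof.
have [z [zP _]] := rst_glue X (fun b : bool => if b then x else y) (partition_compl (\top%O : A)).
have := zP false; rewrite /= compl1 => <-.
by apply/esym; apply: rst_le (le0x _) (zP true).
Qed.

Lemma paste_ex a x y : exists z, rst X z a = rst X x a /\
  rst X z (~` a)%O = rst X y (~` a)%O.
Proof.
have [z [zP _]] := rst_glue X (fun b : bool => if b then x else y) (partition_compl a).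
by exists z; split; [exact: (zP true)|exact: (zP false)].
Qed.

(** The sum x|a + y|a^c. *)
Definition paste a x y : E := sval (cid (paste_ex a x y)).

Lemma paste_in a x y b : (b <= a)%O -> rst X (paste a x y) b = rst X x b.
Proof. by rewrite /paste; case: cid => z /= [zx _] ba; apply: rst_le ba zx. Qed.

Lemma paste_out a x y b : (b <= ~` a)%O -> rst X (paste a x y) b = rst X y b.
Proof. by rewrite /paste; case: cid => z /= [_ zy] ba; apply: rst_le ba zy. Qed.

Lemma stable_paste S a x y : stable X S -> S x -> S y -> S (paste a x y).
Proof.
move=> [_ SS] Sx Sy.
apply: (SS bool (fun b : bool => if b then a else (~` a)%O) (fun b : bool => if b then x else y)).
- exact: partition_compl.
- by case.
- by case; [exact: paste_in|exact: paste_out].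
Qed.

(** Parts of 1 disjoint from b are harmless because all restrictions to 0 agree; hence a partition
    of 1 can replace one of b. *)
Lemma rst_locally x y b :
  locally (fun c => rst X x c = rst X y c) b -> rst X x b = rst X y b.
Proof.
move=> xy.
have [|I [a [pa aP]]] := @locally_partition _ _
    (fun c => rst X x (c `&` b)%O = rst X y (c `&` b)%O); last exact: rst_cover pa aP.
move=> c _ c0; have [cb0|cb0] := EM ((c `&` b)%O = \bot%O).
  by exists c; split=> //; rewrite cb0; apply: rst_bot.
have [e [ec e0 eP]] := xy _ (leIr b c) cb0.
by exists e; split=> //; [apply: le_trans ec (leIl _ _)|apply: rst_le (leIl _ _) eP].
Qed.

(** The mixing principle of Boolean-valued models: witnesses chosen on the members of a partition
    are glued, and stability keeps the result in S. *)
Lemma mix_in S (P : E -> A -> Prop) : stable X S -> local_pred X P ->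
  (forall x, antitone (P x)) ->
  locally (fun b => exists2 x, S x & P x b) \top%O ->
  exists2 z, S z & locally (P z) \top%O.
Proof.
move=> [_ SS] lP aP /locally_partition[I [a [pa aS]]].
have /choice [x xP] i : exists x, S x /\ P x (a i) by have [x] := aS i; exists x.
have [z [zP _]] := rst_glue X x pa.
exists z; first by apply: (SS _ _ _ _ pa _ zP) => i; case: (xP i).
apply: (locally_part pa) => i; apply: locally_self => //.
by apply: lP (esym (zP i)) _; case: (xP i).
Qed.

Lemma mix (P : E -> A -> Prop) : local_pred X P -> (forall x, antitone (P x)) ->
  locally (fun b => exists x, P x b) \top%O -> exists z, locally (P z) \top%O.
Proof.
move=> lP aP PP; suff [z _ Pz] : exists2 z, setT z & locally (P z) \top%O by exists z.
apply: mix_in => //; first by case: (rst_nonempty X) => x; split; [exists x|].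
by apply: locally_imp PP => c _ [x Px]; exists x.
Qed.

(** Below any c, either some x of S satisfies P on a nonzero part and is chosen there, or none does
    and any element of S serves. Mixing these choices gives one z that is a witness wherever there
    is one. *)
Lemma mix_max S (P : E -> A -> Prop) : stable X S -> local_pred X P ->
  (forall x, antitone (P x)) ->
  exists2 z, S z & forall x b, S x -> P x b -> locally (P z) b.
Proof.
move=> sS lP aP.
have [[x0 Sx0] _] := sS.
pose Q z b := forall x c, (c <= b)%O -> S x -> P x c -> P z c.
have [||c _ c0|z Sz Qz] := @mix_in S Q sS.
- by move=> x y b xy Qx z c cb Sz Pzc; apply: lP (rst_le cb xy) _; apply: Qx Sz Pzc.
- by move=> x b c cb Qx z e ec; apply: Qx; apply: le_trans ec cb.
- have [[x [e [ec e0 Sx Px]]]|H] := EM (exists x e, [/\ (e <= c)%O, e <> \bot%O, S x & P x e]).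
    exists e; split=> //; exists x => // y f fe _ _; exact: aP Px.
  exists c; split=> //; exists x0 => // y f fc Sy Py.
  have [f0|f0] := EM (f = \bot%O); last by case: H; exists y, f.
  rewrite f0 in Py *; exact: (lP _ _ _ (rst_bot _ _) Py).
exists z => // x b Sx Pxb c cb c0.
have [e [ec e0 Qe]] := Qz c (lex1 _) c0.
by exists e; split=> //; apply: Qe Sx _ => //; apply: aP Pxb; apply: le_trans cb.
Qed.

Lemma stable_setT : stable X setT.
Proof. by case: (rst_nonempty X) => x; split; [exists x|]. Qed.

Lemma hull_sub S S' : stable X S' -> S `<=` S' -> hull X S `<=` S'.
Proof. by move=> sS SS x; apply. Qed.

Lemma sub_hull S : S `<=` hull X S.
Proof. by move=> x Sx S' _; apply. Qed.

Lemma stable_hull S : S !=set0 -> stable X (hull X S).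
Proof.
move=> [x Sx]; split; first by exists x; apply: sub_hull.
move=> I a y z pa yS yz S' sS SS'; have [_] := sS.
by apply; [exact: pa| |exact: yz] => i; apply: yS.
Qed.

Lemma stable_pred (P : E -> A -> Prop) : local_pred X P ->
  (forall x, antitone (P x)) -> (forall x, locally (P x) \top%O -> P x \top%O) ->
  (exists x, P x \top%O) -> stable X [set x | P x \top%O].
Proof.
move=> lP aP lPl Pn; split=> // I a y z pa yP yz; apply: lPl.
apply: (locally_part pa) => i; apply: locally_self => //.
by apply: lP (esym (yz i)) _; apply: aP (lex1 _) (yP i).
Qed.

Lemma stable_setI S S' : stable X S -> stable X S' -> S `&` S' !=set0 ->
  stable X (S `&` S').
Proof.
move=> [_ SS] [_ SS'] n; split=> // I a x z pa xS xz.
split; [apply: (SS _ _ _ _ pa _ xz) => i|apply: (SS' _ _ _ _ pa _ xz) => i].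
  by case: (xS i).
by case: (xS i).
Qed.

Lemma csub_ofP S x b a : csub_of X S a (rst X x b) <->
  (b <= a)%O /\ exists2 y, S y & rst X x b = rst X y b.
Proof.
split=> [[y [c [Sy ca xy]]]|[ba [y Sy xy]]].
  by have bc := rst_alg xy; rewrite -bc in ca xy; split=> //; exists y.
by exists y, b.
Qed.

Lemma csub_of_top S x : csub_of X S \top%O (rst X x \top%O) <-> S x.
Proof.
split=> [/csub_ofP[_ [y Sy /rst_top ->//]]|Sx].
by apply/csub_ofP; split=> //; exists x.
Qed.

Lemma csub_of_sub S S' a : S `<=` S' -> csub_of X S a `<=` csub_of X S' a.
Proof. by move=> SS o [x [b [Sx ba ->]]]; exists x, b; split=> //; apply: SS. Qed.

Lemma is_csub_of S a : stable X S -> is_csub (csub_of X S a).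
Proof. by move=> sS; exists a, S. Qed.

Lemma crestr_csub_of S a : crestr (csub_of X S \top%O) a = csub_of X S a.
Proof.
apply/seteqP; split=> [_ [[x [b [Sx _ ->]]] [y [c [ca xy]]]]|_ [x [b [Sx ba ->]]]].
  by exists x, b; split=> //; rewrite (rst_alg xy).
by split; [exists x, b; split=> //; exact: lex1|exists x, b].
Qed.

End Mixing.

(** * The conditional real numbers *)

Section LocalOrder.
Context {d : Order.disp_t} {A : completeBoolType d} {R : creals A}.
Implicit Types (a b c : A) (r s t u : R).
Local Notation X := (csetR R).

(** The indicator of a. It turns equality and order on a into relations between products, so that
    ring reasoning applies. *)
Definition idem a : R := paste X a 1 0.

Lemma idem_in a b : (b <= a)%O -> rst X (idem a) b = rst X 1 b.
Proof. exact: paste_in. Qed.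

Lemma idem_out a b : (b <= ~` a)%O -> rst X (idem a) b = rst X 0 b.
Proof. exact: paste_out. Qed.

Lemma rst_idemM r a b : (b <= a)%O -> rst X (idem a * r) b = rst X r b.
Proof.
by move=> ba; rewrite -{2}[r]mul1r; apply: Rmul_local => //; apply: idem_in.
Qed.

Lemma rst_idemM0 r a b : (b <= ~` a)%O -> rst X (idem a * r) b = rst X 0 b.
Proof.
by move=> ba; rewrite -[0](mul0r r); apply: Rmul_local => //; apply: idem_out.
Qed.

Lemma rst_compl r s a : rst X r a = rst X s a ->
  rst X r (~` a)%O = rst X s (~` a)%O -> r = s.
Proof.
move=> h1 h2; apply: (@rst_top _ _ _ X).
apply: (rst_cover (partition_compl a)) => b; rewrite meetx1.
by case: b; [exact: h1|exact: h2].
Qed.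

Lemma rst_idem r s a : rst X r a = rst X s a <-> idem a * r = idem a * s.
Proof.
split=> rs; last by rewrite -(rst_idemM r (lexx a)) rs rst_idemM.
by apply: (rst_compl (a := a)); [rewrite !rst_idemM|rewrite !rst_idemM0].
Qed.

Lemma idem_mul a b : (b <= a)%O -> idem b * idem a = idem b.
Proof. by move=> ba; rewrite -[RHS]mulr1; apply/rst_idem/idem_in. Qed.

Lemma idem_idem a : idem a * idem a = idem a.
Proof. exact: idem_mul. Qed.

Lemma idemT : idem \top%O = 1.
Proof. by apply: (@rst_top _ _ _ X); apply: idem_in. Qed.

(** The minimum z of 0 and 1, produced by [Rle_total], is idempotent. Since z <= 0, also z =
    (-z)(-z) >= 0, so z = 0. *)
Lemma Rle01 : Rle (0 : R) 1.
Proof.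
have [a [z [za zc z1 z0]]] := Rle_total (0 : R) 1.
have zz : z * z = z.
  apply: (rst_compl (a := a)).
    by rewrite (Rmul_local za za) mulr0 za.
  by rewrite (Rmul_local zc zc) mulr1 zc.
have z0' : Rle 0 (- z) by rewrite -oppr0; apply: Rle_opp.
have : Rle 0 z by have := Rle_mul z0' z0'; rewrite mulrNN zz.
move=> /(Rle_anti z0) zE; rewrite zE in z1; exact: z1.
Qed.

Lemma idem_ge0 a : Rle 0 (idem a).
Proof.
apply: (@Rle_stable _ _ R _ _ (fun=> 0) (fun b : bool => if b then 1 else 0) _ _
  (partition_compl a)) => [[]|//|[]].
- exact: Rle01.
- exact: Rle_refl.
- exact: idem_in.
- exact: idem_out.
Qed.

Definition Rle_on a r s := Rle (idem a * r) (idem a * s).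

Lemma Rle_onT r s : Rle_on \top%O r s <-> Rle r s.
Proof. by rewrite /Rle_on idemT !mul1r. Qed.

Lemma Rle_sub0 r s : Rle r s <-> Rle 0 (s - r).
Proof.
split=> [/(Rle_add (- r))|/(Rle_add r)]; first by rewrite subrr.
by rewrite subrK add0r.
Qed.

Lemma Rle_mull t r s : Rle 0 t -> Rle r s -> Rle (t * r) (t * s).
Proof.
by move=> t0 /Rle_sub0 rs; apply/Rle_sub0; rewrite -mulrBr; apply: Rle_mul.
Qed.

Lemma Rle_on_antitone r s : antitone (fun a => Rle_on a r s).
Proof.
move=> a b ba; rewrite /Rle_on => /(Rle_mull (idem_ge0 b)).
by rewrite !mulrA !idem_mul.
Qed.

Lemma Rle_onW a r s : Rle r s -> Rle_on a r s.
Proof. by apply: Rle_mull; apply: idem_ge0. Qed.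

Lemma Rle_on_eq a r s : rst X r a = rst X s a -> Rle_on a r s.
Proof. by move=> /rst_idem rs; rewrite /Rle_on rs; apply: Rle_refl. Qed.

Lemma Rle_on_refl a r : Rle_on a r r.
Proof. exact: Rle_refl. Qed.

Lemma Rle_on_trans a r s t : Rle_on a r s -> Rle_on a s t -> Rle_on a r t.
Proof. exact: Rle_trans. Qed.

Lemma Rle_on_anti a r s : Rle_on a r s -> Rle_on a s r -> rst X r a = rst X s a.
Proof. by move=> rs sr; apply/rst_idem/Rle_anti. Qed.

Lemma Rle_on_local a r r' s s' : rst X r a = rst X r' a -> rst X s a = rst X s' a ->
  Rle_on a r s -> Rle_on a r' s'.
Proof. by rewrite /Rle_on => /rst_idem -> /rst_idem ->. Qed.

Lemma Rle_on_sub0 a r s : Rle_on a r s <-> Rle_on a 0 (s - r).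
Proof. by rewrite /Rle_on mulr0 mulrBr; apply: Rle_sub0. Qed.

Lemma Rle_on_add a r s r' s' : Rle_on a r s -> Rle_on a r' s' ->
  Rle_on a (r + r') (s + s').
Proof. by rewrite /Rle_on !mulrDr; apply: Rle_addl. Qed.

Lemma Rle_on_opp a r s : Rle_on a r s -> Rle_on a (- s) (- r).
Proof. by rewrite /Rle_on !mulrN; apply: Rle_opp. Qed.

Lemma Rle_on_mull a t r s : Rle_on a 0 t -> Rle_on a r s -> Rle_on a (t * r) (t * s).
Proof.
rewrite /Rle_on mulr0 => t0 rs; have := Rle_mull t0 rs.
have e u : idem a * t * (idem a * u) = idem a * (t * u).
  by rewrite -[in RHS](idem_idem a); ring.
by rewrite !e.
Qed.

Lemma Rle_on_mul0 a r s : Rle_on a 0 r -> Rle_on a 0 s -> Rle_on a 0 (r * s).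
Proof. by move=> r0 /(Rle_on_mull r0); rewrite mulr0. Qed.

(* Reduces linear arithmetic in the order to ring identities. *)
Lemma Rle_on_by a r s r' s' : Rle_on a r' s' -> s - r = s' - r' -> Rle_on a r s.
Proof. by move=> /Rle_on_sub0 rs e; apply/Rle_on_sub0; rewrite e. Qed.

Lemma Rle_by r s r' s' : Rle r' s' -> s - r = s' - r' -> Rle r s.
Proof. by move=> /Rle_sub0 rs e; apply/Rle_sub0; rewrite e. Qed.

Lemma Rle_on_cases r s : exists a, Rle_on a r s /\ Rle_on (~` a)%O s r.
Proof.
have [a [z [/rst_idem za /rst_idem zc zs zr]]] := Rle_total r s.
by exists a; rewrite /Rle_on -za -zc; split; apply: Rle_mull (idem_ge0 _) _.
Qed.

Lemma Rle_on_total r s b : b <> \bot%O -> exists c, [/\ (c <= b)%O, c <> \bot%O &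
  Rle_on c r s \/ Rle_on c s r].
Proof.
move=> b0; have [a [rs sr]] := Rle_on_cases r s.
have [ba0|ba0] := EM ((b `&` a)%O = \bot%O).
  exists b; split=> //; right; apply: Rle_on_antitone sr.
  exact: meet_bot_le.
by exists (b `&` a)%O; rewrite leIl; split=> //; left; apply: Rle_on_antitone rs; apply: leIr.
Qed.

Lemma Rle_on_part I (a : I -> A) r s : cpartition a \top%O ->
  (forall i, Rle_on (a i) r s) -> Rle r s.
Proof.
move=> pa rs; apply: (Rle_stable (r := fun i => idem (a i) * r)) pa rs _ _ => i.
  by rewrite rst_idemM.
by rewrite rst_idemM.
Qed.

(** Multiplying both sides by [idem b] makes the inequality trivial off b, so that a partition of 1
    serves. *)
Lemma Rle_on_locally b r s : locally (fun c => Rle_on c r s) b -> Rle_on b r s.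
Proof.
move=> rs; have [|I [a [pa aP]]] := @locally_partition _ _
    (fun c => Rle_on c (idem b * r) (idem b * s)); last exact: Rle_on_part pa aP.
move=> c _ c0; have [cb0|cb0] := EM ((c `&` b)%O = \bot%O).
  by exists c; split=> //; apply: Rle_on_eq; rewrite !rst_idemM0 //; apply: meet_bot_le.
have [e [ec e0 eP]] := rs _ (leIr b c) cb0.
exists e; split=> //; first by apply: le_trans ec (leIl _ _).
have eb : (e <= b)%O by apply: le_trans ec (leIr _ _).
by apply: Rle_on_local eP; rewrite rst_idemM.
Qed.

Lemma Rle_locally r s : locally (fun c => Rle_on c r s) \top%O -> Rle r s.
Proof. by move=> /Rle_on_locally /Rle_onT. Qed.

End LocalOrder.

Lemma step_const_at d (A : completeBoolType d) (T : Type) (t : T) :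
  (step_const t : step A T) t = \top%O.
Proof. by rewrite /=; case: asboolP. Qed.

(** * Standard rationals and the archimedean property *)

Section Rationals.
Context {d : Order.disp_t} {A : completeBoolType d} {R : creals A}.
Implicit Types (a b c : A) (r s t u : R) (p q : rat) (S : set R).
Local Notation X := (csetR R).

Definition qR q : R := sval (cid (@R_of_Q _ _ R)) (step_const q).

Lemma step_op_const (op : rat -> rat -> rat) p q :
  step_op op (step_const p : cQ A) (step_const q) (step_const (op p q)).
Proof.
move=> i j k /=; case: asboolP => [->|_]; last by rewrite !meet0x.
case: asboolP => [->|_]; last by rewrite meetx0 meet0x.
by case: asboolP => [->//|_]; rewrite meetx0.
Qed.

Lemma qRD p q : qR (p + q) = qR p + qR q.
Proof.
by rewrite /qR; case: cid => i /= [_ _ _ [H _] _]; apply: H; apply: step_op_const.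
Qed.

Lemma qRM p q : qR (p * q) = qR p * qR q.
Proof.
by rewrite /qR; case: cid => i /= [_ _ _ [_ H] _]; apply: H; apply: step_op_const.
Qed.

Lemma qR1 : qR 1 = 1.
Proof. by rewrite /qR; case: cid => i /= []. Qed.

Lemma qR0 : qR 0 = 0.
Proof. by have := qRD 0 0; rewrite addr0 => /(congr1 (fun x => x - qR 0)); rewrite addrK subrr. Qed.

Lemma qRN q : qR (- q) = - qR q.
Proof.
by have := qRD (- q) q; rewrite addNr qR0 => /(congr1 (fun x => x - qR q)); rewrite addrK sub0r.
Qed.

Lemma qRB p q : qR (p - q) = qR p - qR q.
Proof. by rewrite qRD qRN. Qed.

Lemma qR_le p q : (p <= q)%R -> Rle (qR p) (qR q).
Proof.
move=> pq; rewrite /qR; case: cid => i /= [_ _ _ _ H]; apply/H => x y /=.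
case: asboolP => [->|_]; last by rewrite !meet0x.
by case: asboolP => [->|_]; last by rewrite !meetx0.
Qed.

Lemma qR_le_on a p q : (p <= q)%R -> Rle_on a (qR p) (qR q).
Proof. by move=> /qR_le; apply: Rle_onW. Qed.

(** The embedding of Q reflects equality of restrictions, which reduces the question to the standard
    rationals 0 and 1. *)
Lemma rst01 a : rst X 1 a = rst X 0 a -> a = \bot%O.
Proof.
rewrite -qR1 -qR0 /qR; case: cid => i /= [H _ _ _ _] /H /rst_stepP.
move=> /(_ 0 1 0); rewrite !step_const_at !meet1x => H1.
by apply: contrapT => a0; move: (H1 a0) => /eqP; rewrite oner_eq0.
Qed.

(** Division by p - q turns the assumption into 1 <= 0 on a. Many arguments by contradiction end
    here. *)
Lemma qR_lt_on a p q : (q < p)%R -> Rle_on a (qR p) (qR q) -> a = \bot%O.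
Proof.
move=> qp pq.
have pq0 : (0 < p - q)%R by rewrite subr_gt0.
have i0 : Rle_on a 0 (qR (p - q)^-1) by rewrite -qR0; apply: qR_le_on; rewrite invr_ge0 ltW.
have H := Rle_on_mull i0 pq; have : Rle_on a (1 : R) 0.
  apply: (Rle_on_by H).
  rewrite -mulrBr -qRB -qRM -[q - p]opprB mulrN mulVf ?gt_eqF //.
  by rewrite qRN qR1 sub0r.
move=> /Rle_on_anti H1; apply: rst01; apply: H1; apply: Rle_onW; exact: Rle01.
Qed.

Lemma Rle_on_compl a r s : Rle_on a r s -> Rle_on (~` a)%O r s -> Rle r s.
Proof.
by move=> h1 h2; apply: (Rle_on_part (partition_compl a)) => -[].
Qed.

Lemma stable_le u : stable X [set r | Rle r u].
Proof.
split=> [|I a r s pa ru rs]; first by exists u; apply: Rle_refl.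
by apply: (Rle_stable (s := fun=> u)) pa ru _ _.
Qed.

Lemma Rsup_ex S : S !=set0 -> (exists u, forall r, S r -> Rle r u) ->
  is_Rsup S (Rsup S).
Proof.
move=> S0 [u uP].
have [|s [s1 s2]] := R_dedekind (stable_hull X S0).
  by exists u => r Sr; apply: (Sr _ (stable_le u)).
have sP : is_Rsup S s.
  split=> [r Sr|v vP]; first by apply: s1; apply: sub_hull.
  by apply: s2 => r Sr; apply: (Sr _ (stable_le v)).
by rewrite (Rsup_eq sP).
Qed.

(** The bound t is known on a only; pasted with s itself off a, it bounds S everywhere. *)
Lemma sup_le_on S s a t : is_Rsup S s -> (forall r, S r -> Rle_on a r t) ->
  Rle_on a s t.
Proof.
move=> [s1 s2] St; apply: (@Rle_on_local _ _ R a s s (paste X a t s) t) => //.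
  exact: paste_in.
apply: Rle_onW; apply: s2 => r Sr; apply: (Rle_on_compl (a := a)).
  by apply: Rle_on_local (St r Sr) => //; rewrite paste_in.
apply: (Rle_on_local (r := r) (s := s)) => //; first by rewrite paste_out.
exact/Rle_onW/s1.
Qed.

(** With s the supremum of the multiples on c, n t = (n + 1) t - t <= s - t for every n, whence s <=
    s - t. *)
Lemma archi0 c t u : (forall n : nat, Rle_on c (qR n%:R * t) u) -> Rle_on c t 0.
Proof.
move=> H; pose S := [set r | exists n : nat, r = idem c * (qR n%:R * t)].
have S0 : S !=set0 by exists (idem c * (qR 0 * t)), 0%N.
have [|s1 s2] := Rsup_ex S0.
  by exists (idem c * u) => _ [n ->]; apply: H.
have {}s2 : Rle (Rsup S) (Rsup S - idem c * t).
  apply: s2 => _ [n ->]; apply/Rle_sub0.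
  have /s1/Rle_sub0 : S (idem c * (qR n.+1%:R * t)) by exists n.+1.
  rewrite -addn1 natrD qRD qR1.
  set x := (X in Rle 0 X); set y := (X in _ -> Rle 0 X).
  by have -> : x = y by rewrite /x /y; ring.
rewrite /Rle_on mulr0; apply/Rle_sub0; move/Rle_sub0: s2.
set x := (X in Rle 0 X); set y := (X in _ -> Rle 0 X).
by have -> : x = y by rewrite /x /y; ring.
Qed.

Lemma not_locally (P : A -> Prop) b : ~ locally P b ->
  exists c, [/\ (c <= b)%O, c <> \bot%O & forall e, (e <= c)%O -> e <> \bot%O -> ~ P e].
Proof.
move=> /existsNP[c] /not_implyP[cb] /not_implyP[c0] H.
by exists c; split=> // e ec e0 Pe; apply: H; exists e.
Qed.

Lemma Rle_on_never c r s :
  (forall e, (e <= c)%O -> e <> \bot%O -> ~ Rle_on e r s) -> Rle_on c s r.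
Proof.
move=> H; apply: Rle_on_locally => e ec e0.
have [f [fe f0 [rs|sr]]] := Rle_on_total r s e0; last by exists f.
by case: (H f) => //; apply: le_trans fe ec.
Qed.

Definition tick (n : nat) : rat := n.+1%:R^-1.

Lemma tick_gt0 n : (0 < tick n)%R.
Proof. by rewrite invr_gt0 ltr0Sn. Qed.

(** The integer is only local: like a function in L^0, r need not be bounded by one standard
    integer. Where no n works, every n is below r and [archi0] gives 1 <= 0. *)
Lemma archimedean r b : locally (fun c => exists n : nat, Rle_on c r (qR n%:R)) b.
Proof.
apply: contrapT => /not_locally[c [cb c0 H]]; apply: c0; apply: rst01.
apply: Rle_on_anti; last exact/Rle_onW/Rle01.
apply: (archi0 (u := r)) => n; rewrite mulr1; apply: Rle_on_never => e ec e0 rn.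
by apply: (H e ec e0); exists n.
Qed.

(** If no standard gap occurred, r - s <= 1/(n+1) would hold on some part for every n, the multiples
    of r - s would be bounded by 1 and [archi0] would give r <= s there. *)
Lemma Rnle_on a r s : ~ Rle_on a r s ->
  exists b n, [/\ (b <= a)%O, b <> \bot%O & Rle_on b (s + qR (tick n)) r].
Proof.
move=> /(contra_not (@Rle_on_locally _ _ _ _ _ _)) /not_locally[c [ca c0 H]].
apply: contrapT => G; apply: (H c) => //; apply/Rle_on_sub0.
suff : Rle_on c (r - s) 0 by move=> /Rle_on_opp; rewrite oppr0 opprB.
apply: (archi0 (u := 1)) => -[|n].
  by rewrite qR0 mul0r; exact/Rle_onW/Rle01.
have H1 : Rle_on c (r - s) (qR (tick n)).
  apply: Rle_on_never => e ec e0 le; apply: G; exists e, n; split=> //.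
    exact: le_trans ec ca.
  by apply: Rle_on_by le _; ring.
have n0 : Rle_on c 0 (qR n.+1%:R) by rewrite -qR0; apply: qR_le_on; rewrite ler0n.
by have := Rle_on_mull n0 H1; rewrite -qRM /tick divff ?pnatr_eq0 // qR1.
Qed.

End Rationals.

Section RealLemmas.
Context {d : Order.disp_t} {A : completeBoolType d} {R : creals A}.
Implicit Types (a b c : A) (r s t u : R) (p q : rat) (S : set R).
Local Notation X := (csetR R).

(** The bound |r - s| <= t on a, split into two linear inequalities so that [Rle_on_by] and [ring]
    handle the estimates. *)
Definition Rclose a r s t := Rle_on a (r - s) t /\ Rle_on a (s - r) t.

Lemma Rclose_sym a r s t : Rclose a r s t -> Rclose a s r t.
Proof. by case. Qed.

Lemma Rclose_antitone r s t : antitone (fun a => Rclose a r s t).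
Proof. by move=> a b ba [h1 h2]; split; apply: Rle_on_antitone ba _. Qed.

Lemma Rclose_local a r r' s s' t t' : rst X r a = rst X r' a ->
  rst X s a = rst X s' a -> rst X t a = rst X t' a ->
  Rclose a r s t -> Rclose a r' s' t'.
Proof.
move=> rr ss tt [h1 h2]; split; [apply: Rle_on_local h1|apply: Rle_on_local h2] => //;
  by apply: Radd_local => //; apply: Ropp_local.
Qed.

Lemma Rclose_trans a r s t e e' : Rclose a r s e -> Rclose a s t e' ->
  Rclose a r t (e + e').
Proof.
move=> [h1 h2] [h3 h4]; split; first by apply: Rle_on_by (Rle_on_add h1 h3) _; ring.
by apply: Rle_on_by (Rle_on_add h2 h4) _; ring.
Qed.

Lemma Rclose_le a r s t t' : Rle_on a t t' -> Rclose a r s t -> Rclose a r s t'.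
Proof. by move=> tt [h1 h2]; split; [apply: Rle_on_trans h1 tt|apply: Rle_on_trans h2 tt]. Qed.

Lemma Rclose_eq a r s t : rst X r a = rst X s a -> Rle_on a 0 t -> Rclose a r s t.
Proof.
move=> rs t0; have e : rst X (r - s) a = rst X 0 a.
  by rewrite -(subrr s); apply: Radd_local.
split; apply: Rle_on_local t0; rewrite ?e //.
by rewrite -opprB -[0]oppr0; apply: Ropp_local.
Qed.

(** Induction on the number k of cells of width 1/(n+1) between the bounds: locally, r lies below
    the last inner grid point or in the last cell. *)
Lemma Rgrid_approx (k n : nat) (l : rat) r c : c <> \bot%O ->
  Rle_on c (qR l) r -> Rle_on c r (qR (l + k%:R * tick n)%R) ->
  exists e, [/\ (e <= c)%O, e <> \bot%O & exists q, Rclose e r (qR q) (qR (tick n))].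
Proof.
have t0 e : Rle_on e (0 : R) (qR (tick n)) by rewrite -qR0; apply: qR_le_on; apply/ltW/tick_gt0.
elim: k c => [|k IH] c c0 lr ru.
  exists c; split=> //; exists l; apply: Rclose_eq => //.
  by apply: Rle_on_anti => //; rewrite mul0r addr0 in ru.
have [e [ec e0 [H|H]]] := Rle_on_total r (qR (l + k%:R * tick n)%R) c0.
  have [|f [fe f0 fP]] := IH e e0 _ H; first exact: Rle_on_antitone lr.
  by exists f; split=> //; apply: le_trans fe ec.
exists e; split=> //; exists (l + k%:R * tick n)%R; split; last first.
  apply: Rle_on_trans (t0 e).
  by apply: Rle_on_by H _; ring.
apply: Rle_on_by (Rle_on_antitone ec ru) _.
by rewrite -addn1 natrD mulrDl mul1r addrA [X in X - r]qRD; ring.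
Qed.

Lemma Rrat_approx r n b :
  locally (fun c => exists q, Rclose c r (qR q) (qR (tick n))) b.
Proof.
move=> c cb c0; have [e [ec e0 [m rm]]] := archimedean r (lexx c) c0.
have [f [fe f0 [m' rm']]] := archimedean (- r) (lexx e) e0.
have [||g [gf g0 gP]] := @Rgrid_approx ((m + m') * n.+1) n (- m'%:R)%R r f f0.
- by rewrite qRN; have := Rle_on_opp rm'; rewrite opprK.
- apply: Rle_on_trans (Rle_on_antitone fe rm) _; apply: qR_le_on.
  by rewrite natrM -mulrA /tick divff ?pnatr_eq0 // mulr1 natrD; lra.
by exists g; split=> //; apply: le_trans gf (le_trans fe ec).
Qed.

Lemma Rsqr_ge0 r : Rle 0 (r * r).
Proof.
have [a [h1 h2]] := Rle_on_cases 0 r; apply: (Rle_on_compl (a := a)).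
  exact: Rle_on_mul0.
have {h2} := Rle_on_opp h2; rewrite oppr0 => h.
by rewrite -mulrNN; apply: Rle_on_mul0.
Qed.

(** A nonnegative inverse is kept so that inequalities on c can be divided by r. *)
Definition pos_unit c r :=
  Rle_on c 0 r /\ exists2 r', Rle 0 r' & rst X (r * r') c = rst X 1 c.

(** The inversion axiom wants an element that is nowhere zero, so r is replaced by 1 off c. The
    inverse s' of the result s >= 0 is nonnegative because s' = s' s' s. *)
Lemma pos_unit_ge n c r : Rle_on c (qR (tick n)) r -> pos_unit c r.
Proof.
move=> nr; have t0 e : Rle_on e (0 : R) (qR (tick n)).
  by rewrite -qR0; apply: qR_le_on; apply/ltW/tick_gt0.
split; first exact: Rle_on_trans nr.
pose s := paste X c r 1.
have sc e : (e <= c)%O -> rst X s e = rst X r e by exact: paste_in.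
have sn e : (e <= ~` c)%O -> rst X s e = rst X 1 e by exact: paste_out.
have s0 : Rle 0 s.
  apply: (Rle_on_compl (a := c)).
    by apply: Rle_on_local (Rle_on_trans (t0 c) nr); rewrite ?sc.
  by apply: Rle_on_local (Rle_onW _ Rle01); rewrite ?sn.
have [a a0 sa|s' ss'] := @R_inv _ _ R s.
  apply: a0; have ac0 : (a `&` c)%O = \bot%O.
    apply: (@qR_lt_on _ _ R _ _ 0 (tick_gt0 n)); rewrite qR0.
    apply: (Rle_on_trans (Rle_on_antitone (leIr c a) nr)); apply: Rle_on_eq.
    by rewrite -sc ?leIr //; apply: rst_le (leIl _ _) sa.
  apply: (@rst01 _ _ R); rewrite -sn ?sa //; exact: meet_bot_le.
exists s'.
  have -> : s' = s' * s' * s by rewrite -mulrA [s' * s]mulrC ss' mulr1.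
  by apply: Rle_mul => //; apply: Rsqr_ge0.
by rewrite -ss'; apply: Rmul_local => //; rewrite sc.
Qed.

Lemma pos_unit_locally c r : ~ Rle_on c r 0 ->
  exists b, [/\ (b <= c)%O, b <> \bot%O & pos_unit b r].
Proof.
move=> /Rnle_on[b [n [bc b0 H]]]; exists b; split=> //.
by apply: (@pos_unit_ge n); rewrite add0r in H.
Qed.

(** Trichotomy, together with invertibility, is available only after passing to a smaller part. *)
Lemma sign_cases r b : locally (fun c =>
  [\/ rst X r c = rst X 0 c, pos_unit c r | pos_unit c (- r)]) b.
Proof.
move=> c cb c0; have [rc|/pos_unit_locally[e [ec e0 H]]] := EM (Rle_on c r 0); last first.
  by exists e; split=> //; apply: Or32.
have [nr|/pos_unit_locally[e [ec e0 H]]] := EM (Rle_on c (- r) 0); last first.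
  by exists e; split=> //; apply: Or33.
exists c; split=> //; apply: Or31; apply: Rle_on_anti => //.
by have := Rle_on_opp nr; rewrite oppr0 opprK.
Qed.

Lemma pos_unit_cancel c r s t : pos_unit c r -> Rle_on c (r * s) (r * t) -> Rle_on c s t.
Proof.
move=> [_ [r' r'0 rr']] /(Rle_on_mull (Rle_onW c r'0)).
have e x : rst X (r' * (r * x)) c = rst X x c.
  by rewrite mulrA [r' * r]mulrC -{2}[x]mul1r; apply: Rmul_local.
exact: Rle_on_local.
Qed.

(** The scalar may vanish on some parts, where both sides are 0; where it has an inverse r', an
    upper bound u of the scaled set gives the upper bound r' u of S. *)
Lemma Rsup_scale S s r : Rle 0 r -> S !=set0 -> is_Rsup S s ->
  is_Rsup [set r * t | t in S] (r * s).
Proof.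
move=> r0 [t0 St0] sS; split=> [_ [t St <-]|u uP].
  by apply: Rle_mull => //; apply: sS.1.
apply: Rle_locally => c _ c0; have [b [bc b0 rb]] := sign_cases r (lexx c) c0.
exists b; split=> //; case: rb => [rb|rb|[rb [r' _ rr']]].
- have e x : rst X (r * x) b = rst X 0 b by rewrite -(mul0r x); apply: Rmul_local.
  have := uP (r * t0); move/(_ (ex_intro2 _ _ t0 St0 erefl))/(Rle_onW b).
  by apply: Rle_on_local; rewrite ?e.
- have [_ [r' r'0 rr']] := rb.
  have rr x : rst X (r * (r' * x)) b = rst X x b.
    by rewrite mulrA -{2}[x]mul1r; apply: Rmul_local.
  have /(Rle_on_mull rb.1) : Rle_on b s (r' * u).
    apply: (sup_le_on sS) => t St; apply: (pos_unit_cancel rb).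
    apply: (Rle_on_local (r := r * t) (s := u)) => //.
    by apply: Rle_onW; apply: uP; exists t.
  by apply: Rle_on_local.
- have rb0 : rst X r b = rst X 0 b.
    apply: Rle_on_anti; last exact: Rle_onW.
    by have := Rle_on_opp rb; rewrite oppr0 opprK.
  have e x : rst X (r * x) b = rst X 0 b by rewrite -(mul0r x); apply: Rmul_local.
  have := uP (r * t0); move/(_ (ex_intro2 _ _ t0 St0 erefl))/(Rle_onW b).
  by apply: Rle_on_local; rewrite ?e.
Qed.

Definition is_Rinf S s := is_Rsup [set - r | r in S] (- s).

Lemma Rinf_ex S : S !=set0 -> (exists u, forall r, S r -> Rle u r) ->
  exists s, is_Rinf S s.
Proof.
move=> [r Sr] [u uP]; exists (- Rsup [set - r | r in S]).
rewrite /is_Rinf opprK; apply: Rsup_ex; first by exists (- r); exists r.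
by exists (- u) => _ [t St <-]; apply: Rle_opp; apply: uP.
Qed.

Lemma inf_le S s r : is_Rinf S s -> S r -> Rle s r.
Proof. by move=> [h _] Sr; rewrite -[s]opprK -[r]opprK; apply: Rle_opp; apply: h; exists r. Qed.

Lemma le_inf_on S s a t : is_Rinf S s -> (forall r, S r -> Rle_on a t r) -> Rle_on a t s.
Proof.
move=> sS St; have : Rle_on a (- s) (- t).
  by apply: (sup_le_on sS) => _ [r Sr <-]; apply: Rle_on_opp; apply: St.
by move=> /Rle_on_opp; rewrite !opprK.
Qed.

Lemma le_inf S s t : is_Rinf S s -> (forall r, S r -> Rle t r) -> Rle t s.
Proof. by move=> sS St; apply/Rle_onT; apply: le_inf_on sS _ => r /St /Rle_onT. Qed.

Lemma Rinf_scale S s r : Rle 0 r -> S !=set0 -> is_Rinf S s ->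
  is_Rinf [set r * t | t in S] (r * s).
Proof.
move=> r0 [t0 St0] sS.
have := @Rsup_scale [set - t | t in S] (- s) r r0 (ex_intro _ _ (ex_intro2 _ _ t0 St0 erefl)) sS.
rewrite /is_Rinf mulrN; congr (is_Rsup _ _).
apply/seteqP; split=> [_ [_ [t St <-] <-]|_ [_ [t St <-] <-]].
  by exists (r * t); [exists t|rewrite mulrN].
by exists (- t); [exists t|rewrite mulrN].
Qed.

Lemma is_Rinf_uniq S s t : is_Rinf S s -> is_Rinf S t -> s = t.
Proof. by move=> h1 h2; apply: oppr_inj; apply: is_Rsup_uniq h1 h2. Qed.

Lemma Rabs_pos r : Rle 0 r -> Rabs r = r.
Proof.
move=> r0; apply: Rle_anti; last exact: Rabs_ge.
apply: Rabs_least; first exact: Rle_refl.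
by apply: Rle_trans (r0); rewrite -oppr0; apply: Rle_opp.
Qed.

Lemma Rabs_ge0 r : Rle 0 (Rabs r).
Proof.
have := Rle_addl (Rabs_ge r) (Rabs_geN r); rewrite subrr => H.
have h : Rle 0 (qR (2^-1)%R : R) by rewrite -qR0; apply: qR_le.
have := Rle_mull h H; rewrite mulr0 mulrDr -mulrDl -qRD.
by rewrite (_ : 2^-1 + 2^-1 = 1 :> rat)%R ?qR1 ?mul1r //; lra.
Qed.

Lemma Rabs_le r t : Rle (Rabs r) t <-> Rle r t /\ Rle (- r) t.
Proof.
split=> [H|[h1 h2]]; last exact: Rabs_least.
by split; apply: Rle_trans H; [apply: Rabs_ge|apply: Rabs_geN].
Qed.

Lemma Rsup_hull_ub S u r : (forall t, S t -> Rle t u) -> S r -> Rle r (Rsup (hull X S)).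
Proof.
move=> Su Sr; have [|s1 _] := @Rsup_ex _ _ _ (hull X S) (ex_intro _ r (sub_hull Sr)).
  by exists u => t; apply: hull_sub (stable_le u) Su t.
by apply: s1; apply: sub_hull.
Qed.

Lemma Rsup_hull_le S u : S !=set0 -> (forall t, S t -> Rle t u) -> Rle (Rsup (hull X S)) u.
Proof.
move=> [r Sr] Su; have Hu t : hull X S t -> Rle t u := @hull_sub _ _ _ _ _ _ (stable_le u) Su t.
have [|_ s2] := @Rsup_ex _ _ _ (hull X S) (ex_intro _ r (sub_hull Sr)); first by exists u.
exact: s2.
Qed.

End RealLemmas.

(** * The Hahn-Banach theorem *)

Section NormedSpace.
Context {d : Order.disp_t} {A : completeBoolType d} {R : creals A} {E : cnormed R}.
Implicit Types (a b c : A) (r s t u : R) (x y z : E) (f g : cdual E).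
Local Notation X := (csetR R).
Local Notation XE := (csetE E).
Local Notation idemR := (@idem _ _ R).

Lemma Eadd_local a x x' y y' : rst XE x a = rst XE x' a -> rst XE y a = rst XE y' a ->
  rst XE (x + y) a = rst XE (x' + y') a.
Proof.
move=> xx yy; apply: (cfun_local (x := (x, y)) (y := (x', y')) (@E_add_stable _ _ _ E)).
by rewrite /= xx yy.
Qed.

Lemma Escale_local a r r' x x' : rst X r a = rst X r' a -> rst XE x a = rst XE x' a ->
  rst XE (r *: x) a = rst XE (r' *: x') a.
Proof.
move=> rr xx; apply: (cfun_local (x := (r, x)) (y := (r', x')) (@E_scale_stable _ _ _ E)).
by rewrite /= xx rr.
Qed.

(** Locality thus becomes homogeneity under indicators, which every linear or sublinear map has. *)
Lemma rst_idemE a x y : rst XE x a = rst XE y a <->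
  idemR a *: x = idemR a *: y.
Proof.
have e1 z : rst XE (idemR a *: z) a = rst XE z a.
  by rewrite -{2}[z]scale1r; apply: Escale_local => //; apply: idem_in.
have e0 z : rst XE (idemR a *: z) (~` a)%O = rst XE 0 (~` a)%O.
  by rewrite -[0](scale0r z); apply: Escale_local => //; apply: idem_out.
split=> xy; last by rewrite -(e1 x) xy e1.
apply: (@rst_top _ _ _ XE); apply: (rst_cover (partition_compl a)) => b; rewrite meetx1.
by case: b; rewrite ?e1 ?e0.
Qed.

Lemma dual0E f : f 0 = 0.
Proof. by have := dual_linear f (- 1) 0 0; rewrite scaler0 add0r mulN1r addNr. Qed.

Lemma dualDE f x y : f (x + y) = f x + f y.
Proof. by have := dual_linear f 1 x y; rewrite scale1r mul1r. Qed.

Lemma dualZE f r x : f (r *: x) = r * f x.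
Proof. by have := dual_linear f r x 0; rewrite dual0E !addr0. Qed.

Lemma dualNE f x : f (- x) = - f x.
Proof. by rewrite -scaleN1r dualZE mulN1r. Qed.

Lemma dualBE f x y : f (x - y) = f x - f y.
Proof. by rewrite dualDE dualNE. Qed.

Lemma dual_local f a x y : rst XE x a = rst XE y a -> rst X (f x) a = rst X (f y) a.
Proof. exact/cfun_local/dual_stable. Qed.

Lemma normN x : norm (- x) = norm x.
Proof.
rewrite -scaleN1r normZ RabsN Rabs_pos ?mul1r //; exact: Rle01.
Qed.

Definition sublinear (p : E -> R) := (forall x y, Rle (p (x + y)) (p x + p y)) /\
  (forall r x, Rle 0 r -> p (r *: x) = r * p x).

Lemma sublinear0 p : sublinear p -> p 0 = 0.
Proof. by move=> [_ pZ]; have := pZ 0 0 (Rle_refl _); rewrite scaler0 mul0r. Qed.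

Lemma sublinear_local p a x y : sublinear p ->
  rst XE x a = rst XE y a -> rst X (p x) a = rst X (p y) a.
Proof.
move=> [_ pZ] /rst_idemE xy; apply/rst_idem; rewrite -!pZ ?xy //; exact: idem_ge0.
Qed.

Lemma sublinear_opp p x : sublinear p -> Rle (- p (- x)) (p x).
Proof.
move=> sp; apply/Rle_sub0; rewrite opprK -(sublinear0 sp) -(subrr x).
exact: sp.1.
Qed.

(** For negative r this is -p(-y) <= p(y) scaled by -r; the two signs are separated by the
    indicators of a and its complement. It allows Hahn-Banach to start from the value p(y) at y. *)
Lemma sublinear_ray p y r : sublinear p -> Rle (r * p y) (p (r *: y)).
Proof.
move=> sp; have [_ pZ] := sp.
have [a [r0 r0']] := Rle_on_cases 0 r; apply: (Rle_on_compl (a := a)).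
  have {}r0 : Rle 0 (idemR a * r) by rewrite /Rle_on mulr0 in r0.
  rewrite /Rle_on mulrA -(pZ _ _ r0) -scalerA pZ; first exact: Rle_refl.
  exact: idem_ge0.
have {}r0' : Rle 0 (idemR (~` a)%O * - r).
  by have := Rle_opp r0'; rewrite mulr0 oppr0 -mulrN.
have := Rle_mull r0' (sublinear_opp y sp); move: (pZ _ (- y) r0').
set k := idemR _ * - r => kE; rewrite mulrN -kE => /Rle_opp; rewrite opprK.
have -> : k *: - y = idemR (~` a)%O *: (r *: y).
  by rewrite /k mulrN scaleNr scalerN opprK scalerA.
by rewrite pZ ?/Rle_on; [rewrite /k mulrN mulNr opprK mulrA|exact: idem_ge0].
Qed.

Lemma linear_cfun (g : E -> R) : (forall r x y, g (r *: x + y) = r * g x + g y) ->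
  cfun XE X g.
Proof.
move=> lg I a x z _ _ _ xz i; apply/rst_idem.
have g0 : g 0 = 0 by have := lg (- 1) 0 0; rewrite scaler0 add0r mulN1r addNr.
have gZ r w : g (r *: w) = r * g w by have := lg r w 0; rewrite g0 !addr0.
by rewrite -!gZ /=; congr g; apply/rst_idemE/xz.
Qed.

Section HahnBanach.
Variables (p : E -> R) (y : E) (c : R).
Hypothesis sp : sublinear p.
Hypothesis cp : forall r, Rle (r * c) (p (r *: y)).

(* The empty graph is allowed because Zorn's lemma covers the empty chain. *)
Let good (G : set (E * R)) :=
  [/\ forall r (u v : E * R), G u -> G v -> G (r *: u.1 + v.1, r * u.2 + v.2),
      forall u : E * R, G u -> Rle u.2 (p u.1) &
      G !=set0 -> G (y, c)].

Let goodZ G r (u : E * R) : good G -> G u -> G (r *: u.1, r * u.2).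
Proof.
move=> [GD _ _] Gu.
have G0 : G (0, 0) by have := GD (- 1) u u Gu Gu; rewrite scaleN1r mulN1r !addNr.
by have := GD r u _ Gu G0; rewrite /= !addr0.
Qed.

(** Subadditivity at (m.1 + x) + (m'.1 - x) separates the lower from the upper candidates for the
    value at x. *)
Let good_le G (m m' : E * R) x : good G -> G m -> G m' ->
  Rle (m'.2 - p (m'.1 - x)) (p (m.1 + x) - m.2).
Proof.
move=> gG Gm Gm'; have [GD Gp _] := gG.
have := Gp _ (GD 1 _ _ Gm Gm'); rewrite /= scale1r mul1r => H.
have := sp.1 (m.1 + x) (m'.1 - x); rewrite addrACA subrr addr0 => /(Rle_trans H) /Rle_sub0 {}H.
by apply/Rle_sub0; move: H; rewrite [X in Rle 0 X -> _](_ : _ =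
  p (m.1 + x) - m.2 - (m'.2 - p (m'.1 - x))) //; ring.
Qed.

(** Where r is zero nothing is added; where r or -r has an inverse r', the bound on e is taken at
    the pair m scaled by r' and multiplied back. *)
Let extend_le G (m : E * R) x e r : good G -> G m ->
  (forall m : E * R, G m -> Rle e (p (m.1 + x) - m.2)) ->
  (forall m : E * R, G m -> Rle (m.2 - p (m.1 - x)) e) ->
  Rle (m.2 + r * e) (p (m.1 + r *: x)).
Proof.
move=> gG Gm eU eL; apply: Rle_locally => b _ b0.
have [b' [bb' b'0 H]] := sign_cases r (lexx b) b0; exists b'; split=> //.
case: H => [r0|[r0 [r' r'0 rr']]|[r0 [r' r'0 rr']]].
- have [_ Gp _] := gG; apply: (Rle_on_local (r := m.2) (s := p m.1)) (Rle_onW b' (Gp _ Gm)).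
    by rewrite -{1}[m.2]addr0 -{1}(mul0r e); apply: Radd_local => //; apply: Rmul_local.
  apply: sublinear_local => //; rewrite -{1}[m.1]addr0 -{1}(scale0r x).
  by apply: Eadd_local => //; apply: Escale_local.
- have := eU _ (goodZ r' gG Gm) => /(Rle_onW b') /(Rle_on_mull r0) /= H.
  have e2 : rst X (r * (r' * m.2)) b' = rst X m.2 b'.
    by rewrite mulrA -{2}[m.2]mul1r; apply: Rmul_local.
  have e1 : rst X (r * p (r' *: m.1 + x)) b' = rst X (p (m.1 + r *: x)) b'.
    apply/rst_idem; rewrite mulrA -sp.2; last by rewrite /Rle_on mulr0 in r0.
    rewrite -sp.2; last exact: idem_ge0.
    congr p; rewrite -scalerA; apply/rst_idemE; rewrite scalerDr; apply: Eadd_local => //.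
    by rewrite scalerA -{2}[m.1]scale1r; apply: Escale_local.
  apply: (Rle_on_local (r := r * (r' * m.2) + r * e) (s := r * p (r' *: m.1 + x))) => //.
    exact: Radd_local.
  by apply: Rle_on_by H _; ring.
- have := eL _ (goodZ r' gG Gm) => /(Rle_onW b') /(Rle_on_mull r0) /= H.
  have e2 : rst X (- r * (r' * m.2)) b' = rst X m.2 b'.
    by rewrite mulrA -{2}[m.2]mul1r; apply: Rmul_local.
  have e1 : rst X (- r * p (r' *: m.1 - x)) b' = rst X (p (m.1 + r *: x)) b'.
    apply/rst_idem; rewrite mulrA -sp.2; last by rewrite /Rle_on mulr0 in r0.
    rewrite -sp.2; last exact: idem_ge0.
    congr p; rewrite -scalerA; apply/rst_idemE; rewrite scalerDr; apply: Eadd_local => //.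
      by rewrite scalerA -{2}[m.1]scale1r; apply: Escale_local.
    by rewrite scalerN scaleNr opprK.
  apply: (Rle_on_local (r := - r * (r' * m.2) + r * e) (s := - r * p (r' *: m.1 - x))) => //.
    exact: Radd_local.
  by apply: Rle_on_by H _; ring.
Qed.

(** Since R has zero divisors, the domain of G and the multiples of x need not meet trivially. The
    argument therefore works with relations closed under combinations and bounded by p; that a
    maximal one is single-valued follows at the end from p(0) = 0. *)
Lemma Hahn_Banach : exists g : E -> R,
  [/\ forall r x z, g (r *: x + z) = r * g x + g z, forall x, Rle (g x) (p x) & g y = c].
Proof.
have [F FP Ftot|G [gG Gmax]] := @Zorn_bigcup _ good.
  split=> [r u v [U FU Uu] [V FV Vv]|u [U FU Uu]|[u [U FU Uu]]].
  - have [UV|VU] := Ftot _ _ FU FV.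
      by exists V => //; have [GD _ _] := FP _ FV; apply: GD => //; apply: UV.
    by exists U => //; have [GD _ _] := FP _ FU; apply: GD => //; apply: VU.
  - by have [_ + _] := FP _ FU; apply.
  - by exists U => //; have [_ _] := FP _ FU; apply; exists u.
have Gn : G !=set0.
  apply: contrapT => G0; apply: (Gmax [set u | exists r, u = (r *: y, r * c)]).
    split=> [u Gu|H]; first by case: G0; exists u.
    by apply: G0; exists (0 *: y, 0 * c); apply: H; exists 0.
  split=> [r _ _ [s ->] [t ->]|_ [r ->]|_] /=; last by exists 1; rewrite scale1r mul1r.
    by exists (r * s + t); rewrite scalerDl mulrDl scalerA mulrA.
  exact: cp.
have [GD Gp /(_ Gn) Gy] := gG.
have total x : exists r, G (x, r).
  have [||e eI] := @Rinf_ex _ _ R [set p (m.1 + x) - m.2 | m in G].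
  - by exists (p (y + x) - c); exists (y, c).
  - by exists (c - p (y - x)) => _ [m Gm <-]; apply: (good_le x gG Gm Gy).
  have eU m : G m -> Rle e (p (m.1 + x) - m.2) by move=> Gm; apply: inf_le eI _; exists m.
  have eL m : G m -> Rle (m.2 - p (m.1 - x)) e.
    by move=> Gm; apply: (le_inf eI) => _ [m' Gm' <-]; exact: (good_le x gG Gm' Gm).
  exists e; apply: contrapT => Gx.
  apply: (Gmax [set u | exists m r, G m /\ u = (m.1 + r *: x, m.2 + r * e)]).
    split=> [[m1 m2] Gm|H].
      by exists (m1, m2), 0; rewrite scale0r mul0r !addr0.
    (* If G contains its extension, it contains (y + x, c + e); subtracting (y, c) puts (x, e) in
       G. *)
    apply: Gx; have := GD (- 1) _ _ Gy (H (y + x, c + e) _).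
    rewrite /= scaleN1r mulN1r !addKr; apply.
    by exists (y, c), 1; rewrite scale1r mul1r.
  split=> [r _ _ [m [s [Gm ->]]] [m' [s' [Gm' ->]]]|_ [m [r [Gm ->]]]|_] /=.
  - exists (r *: m.1 + m'.1, r * m.2 + m'.2), (r * s + s'); split; first exact: GD.
    congr pair => /=; last by ring.
    by rewrite scalerDr scalerDl scalerA addrACA.
  - exact: (extend_le r gG Gm eU eL).
  - by exists (y, c), 0; rewrite scale0r mul0r !addr0.
have /choice [g gP] := total.
have uniq x r s : G (x, r) -> G (x, s) -> r = s.
  have le t u : G (x, t) -> G (x, u) -> Rle t u.
    move=> Gt Gu; have := Gp _ (GD (- 1) _ _ Gu Gt).
    rewrite /= scaleN1r addNr sublinear0 // mulN1r => H.
    by apply/Rle_sub0; have := Rle_opp H; rewrite oppr0 opprD opprK.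
  by move=> Gr Gs; apply: Rle_anti; apply: le.
exists g; split=> [r x z|x|]; last exact: uniq (gP y) Gy.
  exact: uniq (gP _) (GD r (x, g x) (z, g z) (gP x) (gP z)).
exact: (Gp _ (gP x)).
Qed.

End HahnBanach.

End NormedSpace.

(** * Upper limits of functionals *)

Section Limsup.
Context {d : Order.disp_t} {A : completeBoolType d} {R : creals A} {E : cnormed R}.
Implicit Types (a b c : A) (r s t u : R) (x y z : E).
Variables (K : Type) (T : nat -> set K) (phi : K -> cdual E) (B : E -> R).
Hypothesis Tn : forall m, T m !=set0.
Hypothesis Tle : forall m n, (m <= n)%N -> T n `<=` T m.
Hypothesis phiB : forall k x, Rle (phi k x) (B x).

Definition upper m x : R := Rsup [set phi k x | k in T m].
(** The infimum over m of [upper m x], that is the upper limit along the tails T. The index type is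
    arbitrary because single indices and pairs are both used later. *)
Definition flimsup x : R := - Rsup [set - u | u in [set upper m x | m in setT]].

Lemma upperP m x : is_Rsup [set phi k x | k in T m] (upper m x).
Proof.
apply: Rsup_ex; first by have [k Tk] := Tn m; exists (phi k x); exists k.
by exists (B x) => _ [k _ <-].
Qed.

Lemma upper_ge m k x : T m k -> Rle (phi k x) (upper m x).
Proof. by move=> Tk; apply: (upperP m x).1; exists k. Qed.

Lemma upper_le m x u : (forall k, T m k -> Rle (phi k x) u) -> Rle (upper m x) u.
Proof. by move=> H; apply: (upperP m x).2 => _ [k Tk <-]; apply: H. Qed.

Lemma upper_antitone m n x : (m <= n)%N -> Rle (upper n x) (upper m x).
Proof. by move=> mn; apply: upper_le => k Tk; apply: upper_ge; apply: Tle Tk. Qed.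

Lemma phi_lower k x : Rle (- B (- x)) (phi k x).
Proof. by have := Rle_opp (phiB k (- x)); rewrite dualNE opprK. Qed.

Lemma flimsupP x : is_Rinf [set upper m x | m in setT] (flimsup x).
Proof.
rewrite /is_Rinf /flimsup opprK; apply: Rsup_ex.
  by exists (- upper 0 x); exists (upper 0 x) => //; exists 0%N.
exists (B (- x)) => _ [_ [m _ <-] <-]; have [k Tk] := Tn m.
rewrite -[B _]opprK; apply: Rle_opp; apply: Rle_trans (upper_ge x Tk); exact: phi_lower.
Qed.

Lemma flimsup_le_upper m x : Rle (flimsup x) (upper m x).
Proof. by apply: inf_le (flimsupP x) _; exists m. Qed.

Lemma le_flimsup_on a t x : (forall m, Rle_on a t (upper m x)) -> Rle_on a t (flimsup x).
Proof. by move=> H; apply: le_inf_on (flimsupP x) _ => _ [m _ <-]. Qed.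

Lemma le_flimsup t x : (forall m, Rle t (upper m x)) -> Rle t (flimsup x).
Proof. by move=> H; apply: le_inf (flimsupP x) _ => _ [m _ <-]. Qed.

Lemma flimsup_le x : Rle (flimsup x) (B x).
Proof. by apply: Rle_trans (flimsup_le_upper 0 x) _; apply: upper_le. Qed.

(** Tails m and n are compared through the common tail [maxn m n]; homogeneity holds on each tail
    and passes to the infimum. *)
Lemma flimsup_sublinear : sublinear flimsup.
Proof.
split=> [x y|r x r0].
  suff H m : Rle (flimsup (x + y) - upper m x) (flimsup y).
    have {}H m : Rle (flimsup (x + y) - flimsup y) (upper m x).
      by apply: Rle_by (H m) _; ring.
    by apply: Rle_by (le_flimsup H) _; ring.
  apply: le_flimsup => n.
  have H : Rle (flimsup (x + y)) (upper (maxn m n) x + upper (maxn m n) y).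
    apply: Rle_trans (flimsup_le_upper (maxn m n) _) _; apply: upper_le => k Tk.
    by rewrite dualDE; apply: Rle_addl; apply: upper_ge.
  have {}H := Rle_trans H (Rle_addl (upper_antitone x (leq_maxl m n)) (upper_antitone y (leq_maxr m n))).
  by apply: Rle_by H _; ring.
have uZ m : upper m (r *: x) = r * upper m x.
  apply: is_Rsup_uniq (upperP m (r *: x)) _.
  have [k Tk] := Tn m.
  have := @Rsup_scale _ _ _ [set phi k x | k in T m] _ r r0
    (ex_intro _ _ (ex_intro2 _ _ k Tk erefl)) (upperP m x).
  congr (is_Rsup _ _); apply/seteqP; split=> [_ [_ [j Tj <-] <-]|_ [j Tj <-]].
    by exists j => //; rewrite dualZE.
  by exists (phi j x); [exists j|rewrite dualZE].
apply: is_Rinf_uniq (flimsupP (r *: x)) _.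
have := Rinf_scale r0 (ex_intro _ _ (ex_intro2 _ _ 0%N Logic.I erefl)) (flimsupP x).
congr (is_Rinf _ _); apply/seteqP; split=> [_ [_ [j Tj <-] <-]|_ [j Tj <-]].
  by exists j => //; rewrite uZ.
by exists (upper j x); [exists j|rewrite uZ].
Qed.

End Limsup.

(** * Conditional natural numbers and finite sets *)

Section ConditionalNaturals.
Context {d : Order.disp_t} {A : completeBoolType d}.
Implicit Types (a b c : A).

Lemma rst_step (T : Type) (t0 : T) (k : step A T) m c : (c <= k m)%O ->
  rst (step_cset t0) k c = rst (step_cset t0) (step_const m) c.
Proof.
move=> ck; apply/rst_stepP => i j.
have [->|jm] := EM (j = m); last by rewrite /= asboolF // meetx0 meet0x.
have [//|im] := EM (i = m).
suff -> : (k i `&` step_const m m `&` c = \bot)%O by [].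
rewrite step_const_at meetx1; apply/eqP; rewrite -lex0 -((step_part k).1 i m im).
exact: leI2.
Qed.

Lemma step_rst (T : Type) (t0 : T) (k : step A T) m c :
  rst (step_cset t0) k c = rst (step_cset t0) (step_const m) c -> (c <= k m)%O.
Proof.
move=> [/funeqP /(_ m)]; have /= -> := step_const_at A m.
by rewrite meet1x => /meet_idPr.
Qed.

Lemma locally_step (T : Type) (k : step A T) b :
  locally (fun c => exists m, (c <= k m)%O) b.
Proof.
apply: (@locally_le _ _ _ \top%O); first exact: lex1.
apply: (locally_part (step_part k)) => m.
by apply: locally_self; [move=> x y yx [n xn]; exists n; apply: le_trans xn|exists m].
Qed.

Lemma step_relI (T : Type) (P : T -> T -> Prop) (f g : step A T) :
  locally (fun c => exists s t, [/\ (c <= f s)%O, (c <= g t)%O & P s t]) \top%O ->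
  step_rel P f g.
Proof.
move=> H s t st0; have [c [cst c0 [s' [t' [cs ct Pst]]]]] := H _ (lex1 _) st0.
have uniq (h : step A T) i j : (c <= h i)%O -> (c <= h j)%O -> i = j.
  move=> ci cj; apply: contrapT => ij; apply: c0; apply/eqP.
  by rewrite -lex0 -((step_part h).1 i j ij) lexI ci.
have -> := uniq f s s' (le_trans cst (leIl _ _)) cs.
by have -> := uniq g t t' (le_trans cst (leIr _ _)) ct.
Qed.

Lemma step_relE (T : Type) (P : T -> T -> Prop) (f g : step A T) c s t :
  step_rel P f g -> c <> \bot%O -> (c <= f s)%O -> (c <= g t)%O -> P s t.
Proof. by move=> H c0 cs ct; apply: H; apply: le_neq_bot c0; rewrite lexI cs. Qed.

(** Turns standard integers that are found locally into a single conditional natural number. *)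
Lemma mixN (Q : A -> posnat -> Prop) :
  (forall m, antitone (Q ^~ m)) -> locally (fun c => exists m, Q c m) \top%O ->
  exists M : cN A, locally (fun c => exists2 m, (c <= M m)%O & Q c m) \top%O.
Proof.
move=> aQ lQ.
have [|||M MP] := @mix _ _ _ (@csetN _ A) (fun M c => forall e, (e <= c)%O ->
    e <> \bot%O -> exists2 m, (e <= M m)%O & Q e m).
- move=> x y b xy H e eb e0; have [m em Qe] := H e eb e0; exists m => //.
  apply: (@step_rst _ posnat1); rewrite -[LHS](rst_le eb xy); exact: rst_step.
- by move=> x b c cb H e ec; apply: H; apply: le_trans cb.
- apply: locally_imp lQ => c _ [m Qc]; exists (step_const m) => e ec e0; exists m.
    by rewrite step_const_at lex1.
  exact: aQ Qc.
exists M => c ct c0; have [e [ec e0 H]] := MP c ct c0.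
by exists e; split=> //; apply: H.
Qed.

(** [segment] is a stable hull; the inequality in local form is itself stable, so the hull adds
    nothing above n. *)
Lemma segment_le (n k : cN A) j m c : segment n k -> c <> \bot%O ->
  (c <= k j)%O -> (c <= n m)%O -> (val j <= val m)%N.
Proof.
move=> sk c0 cj cm; suff H : Nle k n by apply: step_relE H c0 cj cm.
pose P (k : cN A) c := forall e j m, (e <= c)%O -> e <> \bot%O -> (e <= k j)%O ->
  (e <= n m)%O -> (val j <= val m)%N.
have sP : stable csetN [set k | P k \top%O].
  apply: stable_pred.
  - move=> x y b xy H e i l eb e0 ei el; apply: (H e i l) => //.
    apply: (@step_rst _ posnat1); rewrite [LHS](rst_le eb xy); exact: rst_step.
  - by move=> x b c' cb H e i l ec; apply: H; apply: le_trans cb.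
  - move=> x H e i l _ e0 ei el; have [f [fe f0 fP]] := H e (lex1 _) e0.
    by apply: (fP f) => //; [apply: le_trans ei|apply: le_trans el].
  - exists n => e i l _ e0 ei el; suff -> : i = l by [].
    apply: contrapT => il; apply: e0; apply/eqP.
    by rewrite -lex0 -((step_part n).1 i l il) lexI ei.
have kP : P k \top%O.
  apply: (hull_sub sP) sk => x [_ xn] e i l _ e0 ei el; exact: (step_relE xn e0 ei el).
apply: step_relI => c' _ c'0.
have [e [ec' e0 [i ei]]] := locally_step k (lexx c') c'0.
have [f [fe f0 [l fl]]] := locally_step n (lexx e) e0.
exists f; split=> //; first exact: le_trans ec'.
have fi := le_trans fe ei.
by exists i, l; split=> //; apply: kP f0 fi fl; apply: lex1.
Qed.

(** Off [n m] the integer j may exceed n, so it is replaced there by 1, which is below every n. *)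
Lemma segment_paste (n : cN A) j m : (val j <= val m)%N ->
  segment n (paste csetN (n m) (step_const j) (step_const posnat1)).
Proof.
move=> jm; set k := paste _ _ _ _.
have kin e : (e <= n m)%O -> (e <= k j)%O.
  by move=> em; apply: (@step_rst _ posnat1); apply: paste_in.
have kout e : (e <= ~` n m)%O -> (e <= k posnat1)%O.
  by move=> em; apply: (@step_rst _ posnat1); apply: paste_out.
have split c : c <> \bot%O ->
    exists e, [/\ (e <= c)%O, e <> \bot%O & (e <= n m)%O \/ (e <= ~` n m)%O].
  move=> c0; have [cm|cm] := EM ((c `&` n m)%O = \bot%O).
    by exists c; split=> //; right; apply: meet_bot_le.
  by exists (c `&` n m)%O; split=> //; [exact: leIl|left; exact: leIr].
apply: sub_hull; split; apply: step_relI => c _ c0; have [e [ec e0 [em|em]]] := split c c0.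
- by exists e; split=> //; exists posnat1, j; rewrite step_const_at lex1 kin //; case: (j).
- by exists e; split=> //; exists posnat1, posnat1; rewrite step_const_at lex1 kout.
- by exists e; split=> //; exists j, m; rewrite kin.
- have [f [fe f0 [l fl]]] := locally_step n (lexx e) e0.
  exists f; split=> //; first exact: le_trans ec.
  exists posnat1, l; split=> //; first by apply: kout; apply: le_trans fe em.
  by case: (l).
Qed.

Lemma partition_split a e : (e <= a)%O ->
  cpartition (fun b : bool => if b then e else (a `&` ~` e)%O) a.
Proof.
move=> ea; have ee : (e `&` (a `&` ~` e) = \bot)%O.
  by apply/eqP; rewrite -lex0 -(meetxC e); apply: leI2; rewrite ?lexx // leIr.
split=> [[] [] // _ /=|]; first by rewrite meetC.
split=> [_ [[] _ <-] //=|u uP]; first exact: leIl.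
have -> : a = (e `|` (a `&` ~` e))%O by rewrite joinIr joinxC meetx1; apply/esym/join_idPr.
by rewrite leUx; apply/andP; split; apply: uP; [exists true|exists false].
Qed.

(* On a small enough piece, a conditionally finite set is finite. *)
Lemma cfinite_local (E : Type) (X : condSet A E) a J : cfinite_on (X := X) a J ->
  forall b, (b <= a)%O -> b <> \bot%O -> exists c (m : nat) (x : nat -> E),
  [/\ (c <= b)%O, c <> \bot%O, (forall i, (i < m)%N -> J (rst X (x i) a)) &
      forall y e, J (rst X y a) -> (e <= c)%O -> e <> \bot%O ->
        exists e' i, [/\ (e' <= e)%O, e' <> \bot%O, (i < m)%N & rst X y e' = rst X (x i) e']].
Proof.
move=> [_ [n [f [fcfun _ fsurj]]]] b ba b0.
have [c [cb c0 [m cm]]] := locally_step n (lexx b) b0.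
pose kap (i : nat) : cN A :=
  paste csetN (n m) (step_const (exist _ i.+1 isT : posnat)) (step_const posnat1).
have kapS i : (i < val m)%N -> segment n (kap i) by move=> im; apply: segment_paste.
exists c, (val m), (f \o kap); split=> //.
  by move=> i im; apply/fsurj; exists (kap i) => //; apply: kapS.
move=> x e /fsurj[k sk xk] ec e0.
have [e' [ee e'0 [j ej]]] := locally_step k (lexx e) e0.
have en : (e' <= n m)%O by apply: le_trans ee (le_trans ec cm).
have jm := segment_le sk e'0 ej en.
have jE : exist _ (val j).-1.+1 isT = j :> posnat by apply: val_inj; rewrite /= prednK //; case: (j).
have jm' : ((val j).-1 < val m)%N by rewrite prednK //; case: (j).
exists e', (val j).-1; split=> //.
have ea : (e' <= a)%O by apply: le_trans ee (le_trans ec (le_trans cb ba)).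
rewrite (rst_le ea xk).
have kk : rst csetN k e' = rst csetN (kap (val j).-1) e'.
  by rewrite /kap jE paste_in //; apply: rst_step.
(* [cfun_on] speaks of partitions of a, so e' is completed by its relative complement in a. *)
have H := fcfun bool _ (fun i : bool => if i then kap (val j).-1 else k) k (partition_split ea).
by apply: (H _ sk _ true) => [[]|[]] //; apply: kapS.
Qed.

End ConditionalNaturals.

(** * Dense sequences, cluster values and subsequences *)

Section Sequences.
Context {d : Order.disp_t} {A : completeBoolType d} {R : creals A}.
Implicit Types (a b c : A) (r s t : R).
Local Notation X := (csetR R).

Lemma tick_le m n : (m <= n)%N -> (tick n <= tick m)%R.
Proof. by move=> mn; rewrite lef_pV2 ?posrE ?ltr0Sn // ler_nat. Qed.

(** 1/(2n+2) is half of 1/(n+1), whence the indices of the form [n.*2.+1]. *)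
Lemma tick_half n : (tick n.*2.+1 + tick n.*2.+1 = tick n)%R.
Proof.
by rewrite /tick -doubleS -mul2n natrM invfM -mulrDl (_ : _ + _ = 1) ?mul1r //; lra.
Qed.

Lemma tick_ge0 n b : Rle_on b (0 : R) (qR (tick n)).
Proof. by rewrite -qR0; apply: qR_le_on; apply/ltW/tick_gt0. Qed.

Section DenseSequence.
Variables (E : cnormed R) (S : set E) (f : nat -> cdual E).
Hypothesis sS : stable (csetE E) S.
Local Notation XE := (csetE E).

Let box (q : seq rat) x b := forall i, (i < size q)%N ->
  Rclose b (f i x) (qR (nth 0 q i)) (qR (tick (size q).*2.+1)).

Let boxes x N n b : locally (fun c => exists q : seq rat, size q = N /\
  forall i, (i < N)%N -> Rclose c (f i x) (qR (nth 0 q i)) (qR (tick n))) b.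
Proof.
elim: N b => [|N IH] b c cb c0; first by exists c; split=> //; exists [::].
have [e [ec e0 [q [sq qP]]]] := IH c c (lexx _) c0.
have [g [ge g0 [p pP]]] := Rrat_approx (f N x) n (lexx e) e0.
exists g; split=> //; first exact: le_trans ec.
exists (rcons q p); rewrite size_rcons sq; split=> // i; rewrite ltnS leq_eqVlt nth_rcons sq.
case: eqP => [-> _|_ /= iN]; first by rewrite ltnn.
by rewrite iN; apply: Rclose_antitone ge (qP i iN).
Qed.

(* The points are picked in the rational boxes that f maps S into. *)
Lemma dense_sequence : exists D : nat -> E, (forall j, S (D j)) /\
  forall x N b, S x -> locally (fun c => exists j, forall i, (i < N)%N ->
    Rclose c (f i (D j)) (f i x) (qR (tick N))) b.
Proof.
(* Rational lists are countably many, so one point per list suffices; [mix_max] picks it without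
   deciding where S meets the box. *)
have /choice[z zP] q : exists z, S z /\ forall x b, S x -> box q x b -> locally (box q z) b.
  have [||z Sz zP] := mix_max sS (P := box q); last by exists z.
    by move=> x y b xy bx i iq; apply: Rclose_local (bx i iq) => //; apply: dual_local.
  by move=> x b c cb bx i iq; apply: Rclose_antitone cb (bx i iq).
exists (fun j => z (odflt [::] (unpickle j))); split=> [j|x N b Sx].
  by case: (zP (odflt [::] (unpickle j))).
move=> c cb c0; have [e [ec e0 [q [sq qP]]]] := boxes x N N.*2.+1 (lexx c) c0.
have [g [ge g0 gP]] : exists g, [/\ (g <= e)%O, g <> \bot%O & box q (z q) g].
  have [_ H] := zP q; apply: (H x e Sx _ e (lexx _) e0) => i.
  by rewrite sq; apply: qP.
exists g; split=> //; first exact: le_trans ec.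
(* The images of both points are within half of [tick N] of the rational list q. *)
exists (pickle q) => i iN; rewrite pickleK /= -tick_half qRD.
have := gP i; rewrite sq => /(_ iN) H.
by apply: Rclose_trans H _; apply: Rclose_sym; apply: Rclose_antitone ge (qP i iN).
Qed.

End DenseSequence.

(** * Simultaneous cluster values of countably many bounded sequences *)

Section Cluster.
Variables (v : nat -> nat -> R) (w : nat -> R).
Hypothesis v_le : forall n j, Rle (v n j) (w j).
Hypothesis v_ge : forall n j, Rle (- w j) (v n j).

Let near (c : nat -> R) J m b n := (m <= n)%N /\
  forall i, (i < J)%N -> Rclose b (v n i) (c i) (qR (tick m)).

Let good (c : nat -> R) J := forall m, locally (fun b => exists n, near c J m b n) \top%O.

(** The supremum of this set is the upper limit of coordinate J along the indices at which the
    earlier coordinates are close to c. *)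
Let T (c : nat -> R) J : set R := [set r | forall m,
  locally (fun b => exists n, near c J m b n /\ Rle_on b r (v n J)) \top%O].

Let near_le (c : nat -> R) J m m' b n : (m <= m')%N -> near c J m' b n -> near c J m b n.
Proof.
move=> mm' [m'n H]; split=> [|i iJ]; first exact: leq_trans m'n.
apply: Rclose_le (H i iJ); exact/qR_le_on/tick_le.
Qed.

Let near_antitone (c : nat -> R) J m n : antitone (fun b => near c J m b n).
Proof. by move=> b b' bb' [mn H]; split=> // i iJ; apply: Rclose_antitone bb' (H i iJ). Qed.

Let near_eq (c c' : nat -> R) J m b n : (forall i, (i < J)%N -> c i = c' i) ->
  near c J m b n -> near c' J m b n.
Proof. by move=> cc' [mn H]; split=> // i iJ; rewrite -cc' //; apply: H. Qed.

(** By definition of the upper limit, v n J is above c J - [tick m] at arbitrarily late near indices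
    and, on a suitable part, below c J + [tick m] at all late enough ones; an index with both
    properties is extracted. *)
Let goodS (c : nat -> R) J : good c J -> c J = Rsup (T c J) -> good c J.+1.
Proof.
move=> gJ cJ.
have Tw : T c J (- w J).
  move=> m; apply: locally_imp (gJ m) => b _ [n H]; exists n; split=> //.
  exact/Rle_onW.
have := @Rsup_ex _ _ _ (T c J) (ex_intro _ _ Tw); rewrite -cJ => sT.
have {}sT : is_Rsup (T c J) (c J).
  apply: sT; exists (w J) => r Tr; apply: Rle_locally; apply: locally_imp (Tr 0%N) => b _.
  by move=> [n [_ H]]; apply: Rle_on_trans H (Rle_onW _ (v_le _ _)).
move=> m b _ b0.
have [r [Tr [b1 [b1b b10 rb1]]]] : exists r, T c J r /\ exists b1,
    [/\ (b1 <= b)%O, b1 <> \bot%O & Rle_on b1 (c J - qR (tick m)) r].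
  apply: contrapT => H; apply: b0; apply: (@qR_lt_on _ _ R _ _ 0 (tick_gt0 m)); rewrite qR0.
  suff H1 : Rle_on b (c J) (c J - qR (tick m)) by apply: Rle_on_by H1 _; ring.
  apply: (sup_le_on sT) => r Tr; apply: Rle_on_never => e eb e0 H1.
  by apply: H; exists r; split=> //; exists e.
(* Off b1 the value -w J bounds every v n J from below, so the failure of r' to lie in T must be
   visible inside b1. *)
pose r' := paste X b1 (c J + qR (tick m)) (- w J).
have [m' [b2 [b20 b2P]]] : exists m' b2, b2 <> \bot%O /\ forall e, (e <= b2)%O ->
    e <> \bot%O -> ~ exists n, near c J m' e n /\ Rle_on e r' (v n J).
  suff /existsNP[m' /not_locally[b2 [_ b20 H]]] : ~ T c J r' by exists m', b2.
  move=> /sT.1 /(Rle_onW b1) H; apply: b10.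
  apply: (@qR_lt_on _ _ R _ _ 0 (tick_gt0 m)); rewrite qR0.
  have H1 : Rle_on b1 (c J + qR (tick m)) (c J).
    by apply: Rle_on_local H => //; apply: paste_in.
  by apply: Rle_on_by H1 _; ring.
have b3 : (b2 `&` b1)%O <> \bot%O.
  move=> /meet_bot_le b21; have [e [eb2 e0 [n H]]] := gJ m' b2 (lex1 _) b20.
  apply: (b2P e eb2 e0); exists n; split=> //.
  apply: (Rle_on_local (r := - w J) (s := v n J)) => //; last exact: Rle_onW.
  by rewrite paste_out //; apply: le_trans b21.
have [e [eb3 e0 [n [ne rv]]]] := Tr (maxn m m') _ (lex1 _) b3.
have eb2 : (e <= b2)%O := le_trans eb3 (leIl _ _).
have eb1 : (e <= b1)%O := le_trans eb3 (leIr _ _).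
exists e; split=> //; first exact: le_trans b1b.
exists n; split=> [|i]; first by have [+ _] := ne; apply: leq_trans; apply: leq_maxl.
rewrite ltnS leq_eqVlt => /orP[/eqP ->|iJ]; last first.
  by have [_] := near_le (leq_maxl m m') ne; apply.
have H1 : Rle_on e (v n J) (c J + qR (tick m)).
  apply: (Rle_on_local (r := v n J) (s := r')) => //; first exact: paste_in.
  apply: Rle_on_never => g ge g0 H; apply: (b2P g (le_trans ge eb2) g0); exists n; split=> //.
  exact: near_antitone ge (near_le (leq_maxr m m') ne).
have H2 := Rle_on_trans (Rle_on_antitone eb1 rb1) rv.
by split; [apply: Rle_on_by H1 _; ring|apply: Rle_on_by H2 _; ring].
Qed.

(* Bolzano-Weierstrass: the cluster values are successive upper limits, each   *)
(* along the indices that nearly realize the previous ones.                    *)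
Lemma cluster_values : exists c : nat -> R, forall m l, locally (fun b => exists n,
  (l <= n)%N /\ forall i, (i < m)%N -> Rclose b (v n i) (c i) (qR (tick m))) \top%O.
Proof.
(* Strong recursion: the next value depends on all earlier ones, so [cs J] carries the first J of
   them. *)
pose fix cs J : nat -> R := if J is J'.+1 then
  fun i => if (i < J')%N then cs J' i else Rsup (T (cs J') J') else fun=> 0.
pose c i := cs i.+1 i.
have csE J i : (i < J)%N -> cs J i = c i.
  elim: J i => // J IH i; rewrite ltnS leq_eqVlt => /orP[/eqP -> //|iJ] /=.
  by rewrite iJ; apply: IH.
have cE J : c J = Rsup (T c J).
  rewrite /c /= ltnn; congr Rsup; apply/seteqP; split=> r Tr m; apply: locally_imp (Tr m) => b _.
    by move=> [n [H rv]]; exists n; split=> //; apply: near_eq H => i iJ; apply: csE.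
  by move=> [n [H rv]]; exists n; split=> //; apply: near_eq H => i iJ; apply/esym/csE.
have gc J : good c J.
  elim: J => [|J IH]; last exact: goodS.
  by move=> m b _ b0; exists b; split=> //; exists m.
exists c => m l; apply: locally_imp (gc (maxn m l) (maxn m l)) => b _ [n [mn H]]; exists n.
split=> [|i im]; first by apply: leq_trans mn; apply: leq_maxr.
have := H i (leq_trans im (leq_maxl _ _)); apply: Rclose_le.
by apply: qR_le_on; apply: tick_le; apply: leq_maxl.
Qed.

End Cluster.

(** * Conditional subsequences built from standard indices *)

Definition posn (n : nat) : posnat := exist _ n.+1 isT.

Lemma posnK (m : posnat) : posn (val m).-1 = m.
Proof. by apply: val_inj; rewrite /= prednK //; case: m. Qed.

Lemma Nlt_trans (k l m : cN A) : Nlt k l -> Nlt l m -> Nlt k m.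
Proof.
move=> kl lm; apply: step_relI => c _ c0.
have [e1 [ec e10 [i ei]]] := locally_step k (lexx c) c0.
have [e2 [e21 e20 [j ej]]] := locally_step l (lexx e1) e10.
have [e3 [e32 e30 [h eh]]] := locally_step m (lexx e2) e20.
exists e3; split=> //; first exact: le_trans (le_trans e32 e21) ec.
have e31 := le_trans e32 e21.
exists i, h; split=> //; first exact: le_trans ei.
have := step_relE kl e20 (le_trans e21 ei) ej.
by move=> /ltn_trans; apply; apply: step_relE lm e30 (le_trans e32 ej) eh.
Qed.

(** The previous index is a constant l only on small parts, so l is recorded in the predicate [Q']
    that is mixed, together with the demand that the new index exceed it. *)
Lemma increasing_choice (Q : A -> nat -> nat -> Prop) :
  (forall m n, antitone (fun b => Q b m n)) ->
  (forall m l, locally (fun b => exists n, (l <= n)%N /\ Q b m n) \top%O) ->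
  exists nu : nat -> cN A, (forall m, Nlt (nu m) (nu m.+1)) /\
    forall m, locally (fun b => exists2 n, (b <= nu m (posn n))%O & Q b m n) \top%O.
Proof.
move=> aQ lQ.
have /choice[F FP] (p : nat * cN A) : exists M : cN A, Nlt p.2 M /\
    locally (fun b => exists2 n, (b <= M (posn n))%O & Q b p.1 n) \top%O.
  pose Q' b (k : posnat) := exists2 l : posnat, (b <= p.2 l)%O &
     (val l < val k)%N /\ Q b p.1 (val k).-1.
  have [||M MP] := @mixN _ _ Q'.
  - move=> k b c cb [l bl [lk Qb]]; exists l; first exact: le_trans bl.
    by split=> //; apply: aQ Qb.
  - move=> c ct c0; have [e [ec e0 [l el]]] := locally_step p.2 (lexx c) c0.
    (* n >= val l makes [posn n], whose value is n + 1, exceed l. *)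
    have [g [ge g0 [n [ln Qn]]]] := lQ p.1 (val l) e (lex1 _) e0.
    exists g; split=> //; first exact: le_trans ec.
    by exists (posn n), l => //; apply: le_trans el.
  exists M; split.
    apply: step_relI; apply: locally_imp MP => c _ [k ck [l cl [lk _]]].
    by exists l, k.
  apply: locally_imp MP => c _ [k ck [l cl [lk Qc]]].
  by exists (val k).-1 => //; rewrite posnK.
pose fix nu m : cN A := F (m, if m is m'.+1 then nu m' else step_const posnat1).
exists nu; split=> [m|[|m]]; first by case: (FP (m.+1, nu m)).
  by case: (FP (0%N, step_const posnat1)).
by case: (FP (m.+1, nu m)).
Qed.

(** A conditional number k is itself a partition of 1 indexed by its standard values, and [phi k]
    glues the terms of nu along it. *)
Lemma subsequence (nu : nat -> cN A) : (forall m, Nlt (nu m) (nu m.+1)) ->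
  exists phi : cN A -> cN A, [/\ cfun csetN csetN phi,
    forall k l, Nlt k l -> Nlt (phi k) (phi l) &
    forall (k : cN A) n c, (c <= k (posn n))%O -> rst csetN (phi k) c = rst csetN (nu n) c].
Proof.
move=> nuS.
have nu_lt m n : (m < n)%N -> Nlt (nu m) (nu n).
  elim: n => // n IH; rewrite ltnS leq_eqVlt => /orP[/eqP ->|/IH H]; first exact: nuS.
  exact: Nlt_trans H (nuS n).
have /choice[phi phiP] (k : cN A) : exists z, forall m : posnat,
    rst csetN z (k m) = rst csetN (nu (val m).-1) (k m).
  by have [z [zP _]] := rst_glue csetN (fun m : posnat => nu (val m).-1) (step_part k); exists z.
have phiE (k : cN A) n c : (c <= k (posn n))%O -> rst csetN (phi k) c = rst csetN (nu n) c.
  by move=> ck; apply: rst_le ck (phiP k (posn n)).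
exists phi; split=> // [I a x z _ _ _ xz i|k l kl].
  apply: rst_locally => c ca c0; have [e [ec e0 [m em]]] := locally_step (x i) (lexx c) c0.
  exists e; split=> //; rewrite -(posnK m) in em.
  apply: etrans (esym (phiE (x i) _ _ em)); apply: phiE.
  apply: (@step_rst _ _ _ posnat1); rewrite [LHS](rst_le (le_trans ec ca) (xz i)).
  exact: rst_step.
apply: step_relI => c _ c0.
have [e1 [ec e10 [i ei]]] := locally_step k (lexx c) c0.
have [e2 [e21 e20 [j ej]]] := locally_step l (lexx e1) e10.
have ij := step_relE kl e20 (le_trans e21 ei) ej.
rewrite -(posnK i) in ei ij; rewrite -(posnK j) in ej ij.
have [e3 [e32 e30 [i' ei']]] := locally_step (nu (val i).-1) (lexx e2) e20.
have [e4 [e43 e40 [j' ej']]] := locally_step (nu (val j).-1) (lexx e3) e30.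
have e42 := le_trans e43 e32.
exists e4; split=> //; first exact: le_trans e42 (le_trans e21 ec).
exists i', j'; split.
- apply: (@step_rst _ _ _ posnat1); rewrite [LHS](phiE _ _ _ (le_trans e42 (le_trans e21 ei))).
  by apply: rst_step; apply: le_trans ei'.
- by apply: (@step_rst _ _ _ posnat1); rewrite [LHS](phiE _ _ _ (le_trans e42 ej)); apply: rst_step.
- rewrite /= ltnS in ij; exact: (step_relE (nu_lt _ _ ij) e40 (le_trans e43 ei') ej').
Qed.

End Sequences.

(** * Weak compactness *)

Section SubConditionalSet.
Context {d : Order.disp_t} {A : completeBoolType d} {E : Type} (X : condSet A E).
Variables (S : set E) (sS : stable X S).

Let sub_rst (x : {x | S x}) (a : A) := rst X (sval x) a.

Lemma sub_nonempty : inhabited {x | S x}.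
Proof. by case: sS => -[x Sx] _; exists; exists x. Qed.

Lemma sub_alg x y a b : sub_rst x a = sub_rst y b -> a = b.
Proof. exact: rst_alg. Qed.

Lemma sub_le x y a b : (a <= b)%O -> sub_rst x b = sub_rst y b -> sub_rst x a = sub_rst y a.
Proof. exact: rst_le. Qed.

Lemma sub_glue (I : Type) (a : I -> A) (x : I -> {x | S x}) : cpartition a \top%O ->
  exists! z, forall i, sub_rst z (a i) = sub_rst (x i) (a i).
Proof.
move=> pa; have [z [zP zU]] := rst_glue X (fun i => sval (x i)) pa.
have Sz : S z by apply: (sS.2 _ _ _ _ pa _ zP) => i; case: (x i).
exists (exist _ z Sz); split=> // -[w Sw] wP.
have zw := zU w wP; case: _ / zw in Sw wP *.
by rewrite (Prop_irrelevance Sz Sw).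
Qed.

(** Provides the index set of the open cover in the compactness argument, as covers must be
    conditional families. *)
Definition sub_cset : condSet A {x | S x} := CondSet sub_nonempty sub_alg sub_le sub_glue.

End SubConditionalSet.

Lemma rst_prodP d (A : completeBoolType d) (E F : Type) (X : condSet A E) (Y : condSet A F)
  (u v : E * F) a : rst (cprod X Y) u a = rst (cprod X Y) v a <->
  rst X u.1 a = rst X v.1 a /\ rst Y u.2 a = rst Y v.2 a.
Proof. by split=> [[]|[h1 h2]] //; rewrite /= h1 h2. Qed.

Section Strict.
Context {d : Order.disp_t} {A : completeBoolType d} {R : creals A}.
Implicit Types (a b c : A) (r s t : R).
Local Notation X := (csetR R).

Lemma locally_split a b (P : A -> Prop) : locally P (a `&` b)%O ->
  locally P (a `&` ~` b)%O -> locally P a.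
Proof.
move=> h1 h2 c ca c0; have [cb|cb] := EM ((c `&` b)%O = \bot%O).
  by apply: h2 => //; rewrite lexI ca; apply: meet_bot_le.
have [|e [ec e0 Pe]] := h1 (c `&` b)%O _ cb; first exact: leI2.
by exists e; split=> //; apply: le_trans ec (leIl _ _).
Qed.

(** The forcing form of strict inequality; on 1 it agrees with [Rlt]. *)
Definition Rlt_on a r s := forall e, (e <= a)%O -> e <> \bot%O -> ~ Rle_on e s r.

Lemma Rlt_on_antitone r s : antitone (fun a => Rlt_on a r s).
Proof. by move=> a b ba rs e eb; apply: rs; apply: le_trans ba. Qed.

Lemma Rlt_on_local a r s r' s' : rst X r a = rst X r' a -> rst X s a = rst X s' a ->
  Rlt_on a r s -> Rlt_on a r' s'.
Proof.
move=> rr ss rs e ea e0 sr; apply: (rs e ea e0); apply: Rle_on_local sr.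
  exact: rst_le ea (esym ss).
exact: rst_le ea (esym rr).
Qed.

Lemma Rlt_on_locally a r s : locally (fun c => Rlt_on c r s) a -> Rlt_on a r s.
Proof.
move=> rs e ea e0 sr; have [c [ce c0 H]] := rs e ea e0.
exact: H (lexx c) c0 (Rle_on_antitone ce sr).
Qed.

Lemma Rlt_on_le a r s : Rlt_on a r s -> Rle_on a r s.
Proof. by move=> rs; apply: Rle_on_never. Qed.

Lemma Rlt_onT r s : Rlt_on \top%O r s <-> Rlt r s.
Proof.
split=> [rs|[rs H] e _ e0 sr].
  split; first by apply/Rle_onT; apply: Rlt_on_le.
  by move=> a a0 /esym/Rle_on_eq; apply: rs => //; apply: lex1.
by apply: (H e e0); apply: Rle_on_anti sr; apply: Rle_onW.
Qed.

Lemma qR_lt p q a : (p < q)%R -> Rlt_on a (qR p : R) (qR q).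
Proof. by move=> pq e _ e0 /(qR_lt_on pq). Qed.

Lemma Rlt_on_by a r s r' s' : Rlt_on a r' s' -> s - r = s' - r' -> Rlt_on a r s.
Proof.
move=> rs E e ea e0 sr; apply: (rs e ea e0); apply: Rle_on_by sr _.
by rewrite -opprB -E opprB.
Qed.

Lemma half2 : qR 2^-1 + qR 2^-1 = 1 :> R.
Proof. by rewrite -qRD (_ : _ + _ = 1)%R ?qR1 //; lra. Qed.

Lemma Rlt_on_half a r : Rlt_on a 0 r -> Rlt_on a 0 (qR 2^-1 * r).
Proof.
move=> r0 e ea e0 H; apply: (r0 e ea e0).
by have := Rle_on_add H H; rewrite -mulrDl half2 mul1r addr0.
Qed.

Lemma stable_le_pre (T : Type) (Y : condSet A T) (q : T -> R) u :
  (forall x y b, rst Y x b = rst Y y b -> rst X (q x) b = rst X (q y) b) ->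
  (exists x, Rle (q x) u) -> stable Y [set x | Rle (q x) u].
Proof.
move=> lq [x0 x0u]; have -> : [set x | Rle (q x) u] = [set x | Rle_on \top%O (q x) u].
  by apply/seteqP; split=> x /= /Rle_onT.
apply: (stable_pred (P := fun x b => Rle_on b (q x) u)).
- by move=> x y b /lq xy; apply: Rle_on_local.
- by move=> x; apply: Rle_on_antitone.
- by move=> x; apply: Rle_on_locally.
- by exists x0; apply/Rle_onT.
Qed.

Lemma stable_lt_pre (T : Type) (Y : condSet A T) (q : T -> R) a t :
  (forall u v b, rst Y u b = rst Y v b -> rst X (q u) b = rst X (q v) b) ->
  (exists u, Rlt_on a t (q u)) -> stable Y [set u | Rlt_on a t (q u)].
Proof.
move=> lq [x0 hx0].
have -> : [set u | Rlt_on a t (q u)] = [set u | Rlt_on (\top `&` a)%O t (q u)] by rewrite meet1x.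
apply: (stable_pred (P := fun z b => Rlt_on (b `&` a)%O t (q z))).
- move=> x y b xy; apply: Rlt_on_local => //; apply: lq.
  exact: rst_le (leIl _ _) xy.
- by move=> x b c cb; apply: Rlt_on_antitone; apply: leI2.
- move=> x H; rewrite meet1x; apply: Rlt_on_locally => e ea e0.
  have [c [ce c0 cP]] := H e (lex1 _) e0; exists c; split=> //.
  by apply: Rlt_on_antitone cP; rewrite lexI lexx (le_trans ce ea).
- by exists x0; rewrite meet1x.
Qed.

End Strict.

Section DualTools.
Context {d : Order.disp_t} {A : completeBoolType d} {R : creals A} {E : cnormed R}.
Implicit Types (a b c : A) (r s t : R) (x y z : E) (f g h : cdual E).
Local Notation X := (csetR R).
Local Notation XE := (csetE E).
Local Notation XD := (csetDual E).

Lemma rst_dualP h g a : rst XD h a = rst XD g a <-> forall x, rst X (h x) a = rst X (g x) a.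
Proof. by split=> [[/funeqP] //|H]; congr pair; apply/funext. Qed.

Fact dual_scale_stable r f : cfun XE X (fun x => r * f x).
Proof.
move=> I a x z pa _ _ xz i; apply: Rmul_local => //; exact: dual_local.
Qed.
Fact dual_scale_linear r f s x y : r * f (s *: x + y) = s * (r * f x) + r * f y.
Proof. by rewrite dual_linear; ring. Qed.
Fact dual_scale_cont r f : exists s, forall x, Rle (Rabs (r * f x)) (s * norm x).
Proof.
have [s sP] := dual_cont f; exists (Rabs r * s) => x.
have H y : Rle (r * f y) (Rabs r * s * norm y).
  rewrite -mulrA; have /Rabs_le[h1 h2] := sP y.
  have [a [h3 h4]] := Rle_on_cases 0 r; apply: (Rle_on_compl (a := a)).
    apply: Rle_on_trans (Rle_on_mull h3 (Rle_onW a h1)) _.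
    have e0 := Rle_onW a (Rle_trans (Rabs_ge0 (f y)) (sP y)).
    have := Rle_on_mull e0 (Rle_onW a (Rabs_ge r)).
    by rewrite ![_ * r]mulrC ![_ * Rabs r]mulrC.
  have {}h4 : Rle_on (~` a)%O 0 (- r) by have := Rle_on_opp h4; rewrite oppr0.
  have := Rle_on_mull h4 (Rle_onW (~` a)%O h2); rewrite mulrNN => H; apply: Rle_on_trans H _.
  have e0 := Rle_onW (~` a)%O (Rle_trans (Rabs_ge0 (f y)) (sP y)).
  have := Rle_on_mull e0 (Rle_onW (~` a)%O (Rabs_geN r)).
  by rewrite ![_ * - r]mulrC ![_ * Rabs r]mulrC.
apply/Rabs_le; split; first exact: H.
by have := H (- x); rewrite normN dualNE mulrN.
Qed.
Definition dual_scale r f : cdual E :=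
  Dual (dual_scale_stable r f) (dual_scale_linear r f) (dual_scale_cont r f).

(** Hahn-Banach with the value p(y) prescribed at y; the bound on p makes the functional
    continuous. *)
Lemma dual_support (p : E -> R) r0 y : sublinear p ->
  (forall x, Rle (p x) (r0 * norm x)) ->
  exists g, g y = p y /\ forall x, Rle (g x) (p x).
Proof.
move=> sp pb; have [g [lg gp gy]] := Hahn_Banach sp (fun r => sublinear_ray y r sp).
have g0 : g 0 = 0 by have := lg (- 1) 0 0; rewrite scaler0 add0r mulN1r addNr.
have gN x : g (- x) = - g x.
  by have := lg (- 1) x 0; rewrite g0 !addr0 scaleN1r mulN1r.
have bg : exists r, forall x, Rle (Rabs (g x)) (r * norm x).
  exists r0 => x; apply/Rabs_le; split; first exact: Rle_trans (gp x) (pb x).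
  by rewrite -gN -normN; apply: Rle_trans (gp _) (pb _).
by exists (Dual (linear_cfun lg) lg bg).
Qed.

Lemma cfinite1 (T : Type) (Y : condSet A T) (h : T) :
  cfinite_on (X := Y) \top%O (csub_of Y [set h] \top%O).
Proof.
have st : stable Y [set h].
  split=> [|I a x z pa xh xz]; first by exists h.
  apply: (@rst_top _ _ _ Y); apply: (rst_cover pa) => i; rewrite meetx1 xz.
  by congr rst; apply: xh.
split; first by exists [set h].
have s1 : segment (step_const posnat1 : cN A) (step_const posnat1).
  by apply: sub_hull; split; apply: step_relI => c _ c0; exists c; split=> //;
    exists posnat1, posnat1; rewrite !step_const_at lex1.
exists (step_const posnat1), (fun=> h); split=> [//|k l sk sl H b _ b0 _|x].
  suff kl : forall k, segment (step_const posnat1 : cN A) k ->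
      rst csetN k b = rst csetN (step_const posnat1) b.
    by apply: (H b (lex1 _) b0); rewrite (kl k sk) (kl l sl).
  move=> m sm; apply: rst_locally => c cb c0.
  have [e [ec e0 [j ej]]] := locally_step m (lexx c) c0.
  have e1 : (e <= (step_const posnat1 : cN A) posnat1)%O by rewrite step_const_at lex1.
  exists e; split=> //; have j1 := segment_le sm e0 ej e1.
  rewrite [LHS](rst_step posnat1 ej); congr (rst csetN (step_const _) e).
  by apply: val_inj; apply/eqP; rewrite eqn_leq j1; case: (j).
split=> [/csub_of_top xh|[k _ xh]]; last by rewrite xh; apply/csub_of_top.
by exists (step_const posnat1) => //; congr rst; exact: xh.
Qed.

End DualTools.

(** * Vanishing of p on a weakly compact set *)

Section Compactness.
Context {d : Order.disp_t} {A : completeBoolType d} {R : creals A} {E : cnormed R}.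
Implicit Types (a b c : A) (r s t : R) (x y z : E) (f g h : cdual E).
Local Notation X := (csetR R).
Local Notation XE := (csetE E).
Local Notation XD := (csetDual E).
Local Notation half := (qR 2^-1 : R).

Definition half_space a t h : set E := [set z | Rlt_on a t (h z)].

Lemma half_space_stable a t h : half_space a t h !=set0 -> stable XE (half_space a t h).
Proof. by move=> hn; apply: stable_lt_pre => // x y b; apply: dual_local. Qed.

Lemma weak_ball1 h r y : Rle 0 r ->
  weak_ball XE (fun x f => f x) (csub_of XD [set h] \top%O) r y -> Rle (Rabs (h y)) r.
Proof.
move=> r0; have sr : stable XE [set y | Rle (Rabs (h y)) r].
  apply: stable_le_pre; last by exists 0; rewrite dual0E Rabs0.
  move=> x x' b xx; apply: (cfun_local (@Rabs_stable _ _ R)); exact: dual_local.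
apply: hull_sub sr _ y => y H; apply: Rle_trans H.
apply: (Rsup_hull_ub (u := Rabs (h y))) => [_ [f /csub_of_top -> <-]|].
  exact: Rle_refl.
by exists h => //; apply/csub_of_top.
Qed.

Lemma half_space_open a t h : half_space a t h !=set0 ->
  sigma_weak E (csub_of XE (half_space a t h) \top%O).
Proof.
move=> hn; exists \top%O; first by exists (half_space a t h) => //; apply: half_space_stable.
(* Half the gap h x - t on a; off a the radius only has to be positive, so 1 is taken. *)
move=> x /csub_of_top xh; pose r := paste X a (half * (h x - t)) 1.
have w0 : Rlt_on a 0 (half * (h x - t)) by apply: Rlt_on_half; apply: Rlt_on_by xh _; ring.
have rlt : Rlt 0 r.
  apply/Rlt_onT; apply: Rlt_on_locally; apply: (@locally_split _ _ _ a); rewrite meet1x;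
    (apply: locally_self; first exact: Rlt_on_antitone).
    by apply: Rlt_on_local w0; rewrite ?paste_in.
  apply: (Rlt_on_local (r := 0) (s := 1)) => //; first by rewrite paste_out.
  by rewrite -qR0 -qR1; apply: qR_lt.
exists (csub_of XD [set h] \top%O), r; split=> //; first exact: cfinite1.
move=> _ [_ [b [[y yr <-] bt ->]]]; apply/csub_ofP; split=> //; exists (x + y) => //.
have /Rabs_le[_ {}yr] := weak_ball1 rlt.1 yr => e ea e0; rewrite dualDE => H.
apply: (w0 e ea e0).
have H1 : Rle_on e (- h y) (half * (h x - t)).
  by apply: Rle_on_local (Rle_onW e yr) => //; apply: paste_in.
have H2 := Rle_on_add H1 H.
apply: Rle_on_by H2 _; have hxt : h x - t = half * (h x - t) + half * (h x - t).
  by rewrite -mulrDl half2 mul1r.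
transitivity (half * (h x - t) - (h x - t)); last by ring.
by rewrite [X in _ = _ - X]hxt; ring.
Qed.

Variables (S : set E) (f : nat -> cdual E) (p : E -> R) (r0 : R).
Hypothesis sS : stable XE S.
Hypothesis compactS : ccompact (sigma_weak E) (csub_of XE S \top%O).
Hypothesis sp : sublinear p.
Hypothesis p_bound : forall x, Rle (p x) (r0 * norm x).
Hypothesis p_ge0 : forall x, Rle 0 (p x).
Hypothesis p_even : forall x, p (- x) = p x.
Hypothesis p_f : forall b w, (forall n, rst X (f n w) b = rst X 0 b) ->
  rst X (p w) b = rst X 0 b.

(** The points z stand for elements of the dense sequence, of which these properties are all that is
    used. *)
Let approx x N z b := [/\ S z, p z = 0 &
  forall i, (i < N)%N -> Rclose b (f i z) (f i x) (qR (tick N))].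

Hypothesis approx_ex : forall x N, S x -> locally (fun b => exists z, approx x N z b) \top%O.

Let approx_le x M N z b : (M <= N)%N -> approx x N z b -> approx x M z b.
Proof.
move=> MN [Sz pz H]; split=> // i iM; apply: Rclose_le (H i (leq_trans iM MN)).
exact/qR_le_on/tick_le.
Qed.

Let approx_antitone x M z : antitone (approx x M z).
Proof. by move=> b c cb [Sz pz H]; split=> // i iM; apply: Rclose_antitone cb (H i iM). Qed.

(* h tends to t along the approximations of x. *)
Let tends x b (ht : cdual E * R) := forall k, locally (fun c => exists M,
  forall z e, (e <= c)%O -> approx x M z e -> Rclose e (ht.1 z) ht.2 (qR (tick k))) b.

Let tends_antitone x ht : antitone (tends x ^~ ht).
Proof. by move=> b c cb H k; apply: locally_le cb (H k). Qed.

Let tends_local x ht ht' b : rst (cprod XD X) ht b = rst (cprod XD X) ht' b ->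
  tends x b ht -> tends x b ht'.
Proof.
move=> /rst_prodP[/rst_dualP hh tt] H k; apply: locally_imp (H k) => c cb [M MP]; exists M => z e ec ap.
have eb := le_trans ec cb.
by apply: Rclose_local (MP z e ec ap) => //; apply: rst_le eb _.
Qed.

Let tends_locally x ht : locally (tends x ^~ ht) \top%O -> tends x \top%O ht.
Proof.
move=> H k; apply: locally_locally; apply: locally_imp H => c _; exact.
Qed.

Let tends_f x n : tends x \top%O (f n, f n x).
Proof.
move=> k c _ c0; exists c; split=> //; exists (maxn n.+1 k) => z e _ [_ _ H].
apply: Rclose_le (H n _); last exact: leq_maxl.
by apply: qR_le_on; apply: tick_le; apply: leq_maxr.
Qed.

(** g is squeezed between -p and p, and p vanishes at the approximations. *)
Let tends_g x g : (forall x, Rle (g x) (p x)) -> tends x \top%O (g, 0).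
Proof.
move=> gp k c _ c0; exists c; split=> //; exists 0%N => z e _ [_ pz _].
have := gp z; have := gp (- z); rewrite dualNE p_even pz => h1 h2.
split; apply: Rle_on_trans (tick_ge0 _ _); apply: Rle_onW; first by rewrite subr0.
by rewrite sub0r.
Qed.

Let tends_opp x h t : tends x \top%O (h, t) -> tends x \top%O (- h, - t).
Proof.
move=> H k; apply: locally_imp (H k) => c _ [M MP]; exists M => z e ec /(MP z e ec)[h1 h2].
by split; [apply: Rle_on_by h2 _|apply: Rle_on_by h1 _]; rewrite /=; ring.
Qed.

Let tends_scale x h t r : Rle 0 r -> tends x \top%O (h, t) ->
  tends x \top%O (dual_scale r h, r * t).
Proof.
move=> rr0 H k c ct c0; have [c1 [c1c c10 [K rK]]] := archimedean r (lexx c) c0.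
(* r <= K locally, and K/(K(k+1)+1) <= 1/(k+1). *)
have [c2 [c21 c20 [M MP]]] := H (K * k.+1)%N c1 (lex1 _) c10.
exists c2; split=> //; first exact: le_trans c1c.
exists M => z e ec ap.
have kK : Rle_on e (r * qR (tick (K * k.+1))) (qR (tick k)).
  have := Rle_on_mull (tick_ge0 (K * k.+1) e) (Rle_on_antitone (le_trans ec c21) rK).
  rewrite mulrC => /Rle_on_trans; apply; rewrite -qRM; apply: qR_le_on.
  rewrite /tick mulrC ler_pdivrMr ?ltr0Sn // ler_pdivlMl ?ltr0Sn // -natrM ler_nat.
  by rewrite mulnC; apply: leqnSn.
have [h1 h2] := MP z e ec ap.
split; apply: Rle_on_trans kK.
  by apply: Rle_on_by (Rle_on_mull (Rle_onW e rr0) h1) _; rewrite /=; ring.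
by apply: Rle_on_by (Rle_on_mull (Rle_onW e rr0) h2) _; rewrite /=; ring.
Qed.

(** Different parts of a may require different functionals, so the pairs are found on small parts
    and mixed; this is where the locality of [tends] matters. *)
Let separate x y a n : S y -> Rle_on a (qR (tick n)) (p x) ->
  exists ht, tends x \top%O ht /\ rst X (ht.1 y) a = rst X (ht.2 + 1) a.
Proof.
move=> Sy px.
have unit_case c h t : tends x \top%O (h, t) -> pos_unit c (h y - t) ->
    exists ht, tends x \top%O ht /\ rst X (ht.1 y) c = rst X (ht.2 + 1) c.
  move=> ht [_ [r' r'0 rr]]; exists (dual_scale r' h, r' * t); split; first exact: tends_scale.
  rewrite /= -[r' * h y](subrK (r' * t)) -mulrBr addrC.
  by apply: Radd_local => //; rewrite mulrC.
pose Q ht c := tends x c ht /\ rst X (ht.1 y) (c `&` a)%O = rst X (ht.2 + 1) (c `&` a)%O.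
have [|||ht htP] := @mix _ _ _ (cprod XD X) Q.
- move=> u v b uv [tu eu]; split; first exact: tends_local tu.
  move: uv => /rst_prodP[/rst_dualP h1 h2].
  rewrite -(rst_le (leIl b a) (h1 y)) eu; apply: Radd_local => //.
  exact: rst_le (leIl b a) h2.
- move=> u b c cb [tu eu]; split; first exact: tends_antitone tu.
  by apply: rst_le eu; apply: leI2.
- move=> c _ c0; have [ca|ca] := EM ((c `&` a)%O = \bot%O).
    exists c; split=> //; exists (f 0%N, f 0%N x); split.
      by apply: tends_antitone (tends_f x 0); apply: lex1.
    by rewrite ca; apply: rst_bot.
  suff [b [bca b0 [ht [h1 h2]]]] : exists b, [/\ (b <= c `&` a)%O, b <> \bot%O &
      exists ht, tends x \top%O ht /\ rst X (ht.1 y) b = rst X (ht.2 + 1) b].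
    exists b; split=> //; first exact: le_trans bca (leIl _ _).
    exists ht; split; first by apply: tends_antitone h1; apply: lex1.
    exact: rst_le (leIl _ _) h2.
  have sep h t : tends x \top%O (h, t) -> rst X (h y) (c `&` a)%O <> rst X t (c `&` a)%O ->
      exists b, [/\ (b <= c `&` a)%O, b <> \bot%O &
      exists ht, tends x \top%O ht /\ rst X (ht.1 y) b = rst X (ht.2 + 1) b].
    move=> ht hyt; have [le|/pos_unit_locally[b [bc b0 bP]]] := EM (Rle_on (c `&` a)%O (h y - t) 0).
      have [le'|/pos_unit_locally[b [bc b0 bP]]] := EM (Rle_on (c `&` a)%O (- (h y - t)) 0).
        case: hyt; apply: Rle_on_anti; first by apply: Rle_on_by le _; ring.
        by apply: Rle_on_by le' _; ring.
      exists b; split=> //; apply: (unit_case b (- h) (- t) (tends_opp ht)).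
      by have -> : (- h) y - - t = - (h y - t) by rewrite /=; ring.
    by exists b; split=> //; apply: (unit_case b h t ht).
  have [eqs|/existsNP[i ne]] := EM (forall i, rst X (f i y) (c `&` a)%O = rst X (f i x) (c `&` a)%O);
    last exact: sep (tends_f x i) ne.
  (* No f_i separates x from y on this part, so p(x - y) = 0 there and p(y) inherits the lower bound
     of p(x). *)
  have pw : rst X (p (x - y)) (c `&` a)%O = rst X 0 (c `&` a)%O.
    apply: p_f => i; rewrite dualBE -(subrr (f i x)); apply: Radd_local => //.
    exact: Ropp_local.
  have px' : Rle_on (c `&` a)%O (qR (tick n)) (p y).
    apply: Rle_on_trans (Rle_on_antitone (leIr _ _) px) _.
    have H : Rle (p x) (p (x - y) + p y) by rewrite -{1}[x](subrK y); apply: sp.1.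
    apply: Rle_on_local (Rle_onW _ H) => //.
    by rewrite -[p y in RHS]add0r; apply: Radd_local.
  have [g [gy gp]] := dual_support y sp p_bound.
  exists (c `&` a)%O; split=> //; apply: (unit_case _ _ _ (tends_g x gp)).
  by rewrite subr0 gy; apply: pos_unit_ge px'.
exists ht; split.
  by apply: tends_locally; apply: locally_imp htP => c _ [].
apply: rst_locally => c ca c0; have [e [ec e0 [_ H]]] := htP c (lex1 _) c0.
exists e; split=> //; apply: rst_le H; by rewrite lexI lexx (le_trans ec ca).
Qed.

Let combine x (m : nat) (ht : nat -> cdual E * R) k (b : A) : b <> \bot%O ->
  (forall i, (i < m)%N -> tends x \top%O (ht i)) ->
  exists c, [/\ (c <= b)%O, c <> \bot%O & exists M, forall i z e, (i < m)%N -> (e <= c)%O ->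
    approx x M z e -> Rclose e ((ht i).1 z) (ht i).2 (qR (tick k))].
Proof.
move=> b0; elim: m => [|m IH] H; first by exists b; split=> //; exists 0%N.
have [i im|c [cb c0 [M MP]]] := IH; first by apply: H; apply: ltnW.
have [e [ec e0 [N NP]]] := H m (ltnSn m) k c (lex1 _) c0.
exists e; split=> //; first exact: le_trans cb.
exists (maxn M N) => i z g; rewrite ltnS leq_eqVlt => /orP[/eqP ->|im] ge ap.
  by apply: (NP z g ge); apply: approx_le ap; apply: leq_maxr.
by apply: (MP i z g im (le_trans ge ec)); apply: approx_le ap; apply: leq_maxl.
Qed.

(* A pair (h, t) with h y <> t can be scaled so that h y = t + 1; the half     *)
(* space h > t + 1/2 then contains y but no good approximation of x.           *)
Let index x a : set (E * cdual E * R) := [set i | [/\ S i.1.1, tends x \top%O (i.1.2, i.2) &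
  rst X (i.1.2 i.1.1) a = rst X (i.2 + 1) a]].

Let XI := cprod (cprod XE XD) X.

Let index_stable x a : index x a !=set0 -> stable XI (index x a).
Proof.
move=> n; split=> // J b i k pb iP ik.
have ik' j : [/\ rst XE k.1.1 (b j) = rst XE (i j).1.1 (b j),
    rst XD k.1.2 (b j) = rst XD (i j).1.2 (b j) & rst X k.2 (b j) = rst X (i j).2 (b j)].
  by have := ik j => /rst_prodP[/rst_prodP[]].
split.
- apply: (sS.2 _ _ (fun j => (i j).1.1) k.1.1 pb) => j; first by case: (iP j).
  by case: (ik' j).
- apply: tends_locally; apply: (locally_part pb) => j; apply: locally_self.
    exact: tends_antitone.
  have [_ h1 h2] := ik' j; have [_ h3 _] := iP j.
  apply: (@tends_local x ((i j).1.2, (i j).2)); first by apply/rst_prodP; split.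
  by apply: tends_antitone h3; apply: lex1.
- apply: (rst_cover pb) => j; have [h1 /rst_dualP h2 h3] := ik' j; have [_ _ h4] := iP j.
  have ja : (b j `&` a <= a)%O := leIr _ _.
  have jb : (b j `&` a <= b j)%O := leIl _ _.
  rewrite (rst_le jb (h2 _)) (dual_local (i j).1.2 (rst_le jb h1)) (rst_le ja h4).
  by apply: Radd_local => //; apply/esym/(rst_le jb).
Qed.

Let cover_set a (i : E * cdual E * R) : set E := S `&` half_space a (i.2 + half) i.1.2.

Let cover_set_self x a i : index x a i -> cover_set a i i.1.1.
Proof.
move=> [h1 _ h3]; split=> //.
apply: (Rlt_on_local (r := i.2 + half) (s := i.2 + 1)) => //.
have hl : Rlt_on a half 1 by rewrite -qR1; apply: qR_lt.
by apply: Rlt_on_by hl _; ring.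
Qed.

Let cover_set_stable x a i : index x a i -> stable XE (cover_set a i).
Proof.
move=> /cover_set_self H; apply: stable_setI => //; last by exists i.1.1.
by apply: half_space_stable; exists i.1.1; case: H.
Qed.

Let cover_set_paste a b (i : E * cdual E * R) y z : half_space a (i.2 + half) i.1.2 y ->
  Rlt_on (a `&` b)%O (i.2 + half) (i.1.2 z) ->
  half_space a (i.2 + half) i.1.2 (paste XE b z y).
Proof.
move=> hy hz; apply: Rlt_on_locally; apply: (@locally_split _ _ _ b);
  (apply: locally_self; first exact: Rlt_on_antitone).
  by apply: Rlt_on_local hz => //; apply: dual_local; rewrite paste_in // leIr.
apply: Rlt_on_local (Rlt_on_antitone (leIl _ _) hy) => //.
by apply: dual_local; rewrite paste_out // leIr.
Qed.

Let cover_set_local x a (i i' : E * cdual E * R) b : index x a i' -> rst XI i b = rst XI i' b ->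
  csub_of XE (cover_set a i) b `<=` csub_of XE (cover_set a i') b.
Proof.
move=> /cover_set_self[Sy' hy'] /rst_prodP[/rst_prodP[_ /rst_dualP hh] tt] _ [z [c [[Sz hz] cb ->]]].
apply/csub_ofP; split=> //; exists (paste XE b z i'.1.1); last by rewrite paste_in.
split; first exact: stable_paste.
apply: cover_set_paste => //.
apply: Rlt_on_local (Rlt_on_antitone (leIl _ _) hz).
  by apply: Radd_local => //; apply: rst_le tt; apply: leIr.
exact: rst_le (leIr _ _) (hh z).
Qed.

Let cover_set_open x a i : index x a i ->
  reltop (sigma_weak E) (csub_of XE S \top%O) (csub_of XE (cover_set a i) \top%O).
Proof.
move=> /cover_set_self[Sy hy]; exists (csub_of XE (half_space a (i.2 + half) i.1.2) \top%O).
  by apply: half_space_open; exists i.1.1.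
apply/seteqP; split=> [_ [z [b [[Sz hz] bt ->]]]|_ [[z [b [hz bt ->]]] /csub_ofP[_ [z' Sz' zz']]]].
  by split; apply/csub_ofP; split=> //; exists z.
apply/csub_ofP; split=> //; exists (paste XE b z' i.1.1); last by rewrite paste_in.
split; first exact: stable_paste.
apply: cover_set_paste => //; apply: Rlt_on_local (Rlt_on_antitone (leIl _ _) hz) => //.
by apply: dual_local; apply: rst_le zz'; apply: leIr.
Qed.

Lemma compact_vanish x : S x -> p x = 0.
Proof.
move=> Sx; apply: Rle_anti => //; apply/Rle_onT; apply: contrapT => /Rnle_on[a [n [_ a0 px]]].
rewrite add0r in px.
have ex y : S y -> exists h t, index x a (y, h, t).
  by move=> Sy; have [[h t] [h1 h2]] := separate Sy px; exists h, t.
have [i0 i0P] : index x a !=set0 by have [h [t H]] := ex x Sx; exists (x, h, t).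
pose Y := sub_cset (index_stable (ex_intro _ i0 i0P)).
pose U (i : {i | index x a i}) := csub_of XE (cover_set a (sval i)) \top%O.
have [|[i iP]||a' [J [finJ CE]]] := compactS (Y := Y) (U := U).
- split=> [[i iP]|J b i k pb ik j].
    by exists (cover_set a i) => //; apply: cover_set_stable iP.
  rewrite !crestr_csub_of; apply/seteqP; split; apply: cover_set_local.
  + exact: svalP.
  + exact: ik.
  + exact: svalP.
  + exact/esym/ik.
- exact: cover_set_open iP.
- apply/seteqP; split=> [_ [y [b [Sy bt ->]]] G _ GU|o]; last first.
    apply; first exact: is_csub_of.
    by move=> _ [[i iP] _ <-]; apply: csub_of_sub => z [].
  have [h [t iP]] := ex y Sy; apply: (GU (U (exist _ _ iP))); first by exists (exist _ _ iP).
  by apply/csub_ofP; split=> //; exists y => //; apply: (cover_set_self iP).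
(* The finite subcover is given on some a', which must be 1, since otherwise the join would not
   contain x|1. *)
have a'T : a' = \top%O.
  have : csub_of XE S \top%O (rst XE x \top%O) by apply/csub_of_top.
  rewrite CE => /(_ (csub_of XE setT a')) []; first exact/is_csub_of/stable_setT.
    move=> _ [i _ <-]; rewrite crestr_csub_of; exact: csub_of_sub.
  move=> z [b [_ ba xz]]; apply: le_anti; rewrite lex1 /=.
  by have [<- _] := rst_top_inj xz.
rewrite a'T in finJ CE => {a' a'T}.
have [j0 Jj0] : exists j, J (rst Y j \top%O).
  have [[SJ [[j SJj] _] ->] _] := finJ; exists j; exact/csub_of_top.
have [b [m [js [ba b0 Jjs finP]]]] := cfinite_local finJ (lex1 a) a0.
pose ht i := ((sval (js i)).1.2, (sval (js i)).2).
have ht_tends i : (i < m)%N -> tends x \top%O (ht i) by case: (svalP (js i)).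
(* [tick 3] is 1/4, less than the 1/2 by which h exceeds t on the members of the cover. *)
have [c [cb c0 [M MP]]] := combine 3 b0 ht_tends.
have [e [ec e0 [z zP]]] := approx_ex M Sx (lex1 c) c0.
(* A stable condition that every cover set of J satisfies, hence also the points of their join, such
   as z. *)
pose P w (u : A) := locally (fun u' => exists j, J (rst Y j \top%O) /\
  Rlt_on u' ((sval j).2 + half) ((sval j).1.2 w)) (u `&` e)%O.
have sP : stable XE [set w | P w \top%O].
  apply: stable_pred.
  - move=> u v g uv; apply: locally_imp => g' gg [j [Jj H]]; exists j; split=> //.
    apply: Rlt_on_local H => //; apply: dual_local; apply: rst_le uv.
    exact: le_trans gg (leIl _ _).
  - by move=> w g g' gg; apply: locally_le; apply: leI2.
  - move=> w H; apply: locally_locally; rewrite meet1x => g ge g0.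
    have [g' [gg g'0 Pg]] := H g (lex1 _) g0; exists g'; split=> //.
    by apply: locally_le Pg; rewrite lexI lexx (le_trans gg ge).
  - exists (sval j0).1.1; rewrite /P meet1x; apply: locally_self.
      by move=> g g' gg [j [Jj H]]; exists j; split=> //; apply: Rlt_on_antitone gg H.
    exists j0; split=> //; apply: (@Rlt_on_antitone _ _ _ _ _ a).
      exact: le_trans ec (le_trans cb ba).
    by have [] := cover_set_self (svalP j0).
have : csub_of XE S \top%O (rst XE z \top%O) by apply/csub_of_top; case: zP.
rewrite CE => /(_ (csub_of XE [set w | P w \top%O] \top%O)) [].
- exact: is_csub_of.
- move=> _ [j Jj <-]; rewrite crestr_csub_of; apply: csub_of_sub => w [_ H].
  rewrite /P /= meet1x; apply: locally_self.
    by move=> g g' gg [j' [Jj' H']]; exists j'; split=> //; apply: Rlt_on_antitone gg H'.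
  exists j; split=> //; apply: Rlt_on_antitone H.
  exact: le_trans ec (le_trans cb ba).
move=> w [g [Pw _ zw]]; have [_ {}zw] := rst_top_inj zw.
rewrite -zw /= /P meet1x in Pw.
have [g' [ge g'0 [j [Jj H]]]] := Pw e (lexx _) e0.
(* On a smaller part j agrees with some member of the list, for which h z <= t + 1/4, against h z >
   t + 1/2. *)
have [g2 [i [g21 g20 im]]] := finP j g' Jj (le_trans ge (le_trans ec cb)) g'0.
move=> /rst_prodP[/rst_prodP[_ /rst_dualP hh] tt].
have [H1 _] := MP i z g2 im (le_trans g21 (le_trans ge ec)) (approx_antitone (le_trans g21 ge) zP).
have H2 : Rlt_on g2 ((sval (js i)).2 + half) ((sval (js i)).1.2 z).
  by apply: Rlt_on_local (Rlt_on_antitone g21 H) => //; apply: Radd_local.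
apply: (H2 g2 (lexx _) g20); apply: Rle_on_trans (_ : Rle_on _ _ ((sval (js i)).2 + qR (tick 3))) _.
  by apply: Rle_on_by H1 _; rewrite /=; ring.
apply: Rle_on_add; first exact: Rle_on_refl.
exact: qR_le_on.
Qed.

End Compactness.

(** * Norm closure of the span *)

Section Closure.
Context {d : Order.disp_t} {A : completeBoolType d} {R : creals A} {E : cnormed R}.
Implicit Types (a b c : A) (r s t : R) (x y z : E).
Local Notation X := (csetR R).
Local Notation XE := (csetE E).
Local Notation half := (qR 2^-1 : R).

Lemma norm_local x y a : rst XE x a = rst XE y a -> rst X (norm x) a = rst X (norm y) a.
Proof. exact/cfun_local/norm_stable. Qed.

Lemma ball_sub x r y : Rle 0 r -> closed_ball x r y -> Rle (norm (x - y)) r.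
Proof.
move=> r0; have st : stable XE [set y | Rle (norm (x - y)) r].
  apply: stable_le_pre; last by exists x; rewrite subrr -(scale0r x) normZ Rabs0 mul0r.
  move=> z z' b zz; apply: norm_local; apply: Eadd_local => //.
  by rewrite -!scaleN1r; apply: Escale_local.
exact: (hull_sub st (fun _ h => h)).
Qed.

Variables (S : set E) (p : E -> R).
Hypothesis sp : sublinear p.
Hypothesis p_bound : forall x, Rle (p x) (norm x + norm x).
Hypothesis p_ge0 : forall x, Rle 0 (p x).
Hypothesis p_even : forall x, p (- x) = p x.
Hypothesis pS : forall x, S x -> p x = 0.
Hypothesis closureS : cclosure (norm_open E) (cspan (csub_of XE S \top%O)) = cfull XE.

Let V : set E := [set x | p x = 0].

Let V_stable : stable XE V.
Proof.
have -> : V = [set x | Rle (p x) 0].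
  by apply/seteqP; split=> x /= => [->|px]; [exact: Rle_refl|exact: Rle_anti].
apply: stable_le_pre; first by move=> x y b; apply: sublinear_local.
by exists 0; rewrite sublinear0 //; apply: Rle_refl.
Qed.

Let pD0 x y : p x = 0 -> p y = 0 -> p (x + y) = 0.
Proof. by move=> px py; apply: Rle_anti => //; have := sp.1 x y; rewrite px py addr0. Qed.

Let pZ0 r x : p x = 0 -> p (r *: x) = 0.
Proof.
move=> px; apply: Rle_anti => //.
have [a [r0 r0']] := Rle_on_cases 0 r; apply: (Rle_on_compl (a := a)).
  have H : Rle 0 (idem a * r) by rewrite /Rle_on mulr0 in r0.
  rewrite /Rle_on -(sp.2 _ _ (idem_ge0 a)) scalerA (sp.2 _ _ H) px !mulr0; exact: Rle_refl.
have H : Rle 0 (idem (~` a)%O * - r) by have := Rle_on_opp r0'; rewrite oppr0 /Rle_on mulr0.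
rewrite /Rle_on -(sp.2 _ _ (idem_ge0 _)) scalerA -p_even -scaleNr -mulrN (sp.2 _ _ H) px !mulr0.
exact: Rle_refl.
Qed.

Let span_sub : cspan (csub_of XE S \top%O) `<=` csub_of XE V \top%O.
Proof.
apply: csub_of_sub => z [n [r [u [_ _ uS zE]]]]; rewrite /V /=.
apply: (@rst_top _ _ _ X); apply: (rst_cover (step_part n)) => m; rewrite meetx1.
have [kap [kapS zm]] := zE m; rewrite (sublinear_local sp zm); congr (rst X _ _).
apply: (big_ind (fun x => p x = 0)) => [|x y|i _]; [exact: sublinear0|exact: pD0|].
apply: pZ0; apply: pS; apply/csub_of_top; apply: uS.
by have [] := kapS (exist _ i.+1 isT) (ltn_ord i).
Qed.

(** The conditional complement of the kernel of p lives on the largest a on which p can be strictly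
    positive; [mix_max] provides a point x0 that attains it. *)
Let support : exists a x0, Rlt_on a 0 (p x0) /\
  forall x b, Rlt_on b 0 (p x) -> (b <= a)%O.
Proof.
have [||x0 _ x0P] := mix_max (stable_setT XE) (P := fun x b => Rlt_on b 0 (p x)).
- by move=> x y b xy; apply: Rlt_on_local => //; apply: sublinear_local.
- by move=> x; apply: Rlt_on_antitone.
have [s sP] := has_supremums [set b | rst X (p x0) b = rst X 0 b].
have s0 : rst X (p x0) s = rst X 0 s.
  apply: rst_locally; apply: (locally_sup sP) => b /= H; apply: locally_self => //.
  by move=> e e' ee H'; apply: rst_le H'.
exists (~` s)%O, x0; split=> [e es e0 H|x b xb].
  apply: e0; apply/eqP; rewrite -lex0 -(meetxC s) lexI es andbT; apply: sP.1.
  by apply: Rle_on_anti => //; apply: Rle_onW.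
apply: meet_bot_le; apply: contrapT => bs.
have [e [ebs e0 H]] := x0P x b Logic.I xb _ (leIl b s) bs.
apply: (H e (lexx _) e0); apply: Rle_on_eq.
by apply: rst_le s0; apply: le_trans ebs (leIr _ _).
Qed.

(** The kernel of p contains the span and is closed: its conditional complement consists of the
    points with p > 0 on a, restricted to a, and is open because p is dominated by the norm. *)
Lemma closure_vanish x : p x = 0.
Proof.
have [a [x0 [x0P aP]]] := support.
pose Sa : set E := [set z | Rlt_on a 0 (p z)].
have Sa_stable : stable XE Sa.
  by apply: stable_lt_pre; [move=> y z b; apply: sublinear_local|exists x0].
pose F := csub_of XE V \top%O; pose G := csub_of XE Sa a.
have V0 : V 0 := sublinear0 sp.
have FG : is_ccompl F G.
  split; first exact: is_csub_of.
    apply/seteqP; split=> [_ [[y [b [Vy _ ->]]] /csub_ofP[ba [z Sz yz]]]|_ [y [b [_ b0 ->]]]].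
      have b0 : b = \bot%O.
        apply: contrapT => b0; apply: (Sz b ba b0); apply: Rle_on_eq.
        by rewrite -(sublinear_local sp yz) Vy.
      by apply/csub_ofP; split; [rewrite b0|exists y].
    have {}b0 : b = \bot%O by apply/eqP; rewrite -lex0.
    by rewrite b0; split; apply/csub_ofP; (split; first exact: le0x);
      [exists 0|exists x0] => //; apply: rst_bot.
  move=> G' [a' [S' [[y0 Sy0] _] ->]] FG' _ [z [b [Sz ba' ->]]].
  (* On a nonzero part e with p z = 0, [idem e *: z] would be in the kernel, so z|e would lie in
     both F and G'. *)
  have za' : Rlt_on a' 0 (p z).
    move=> e ea e0 pz; apply: e0.
    have pz0 : rst X (p z) e = rst X 0 e by apply: Rle_on_anti => //; apply: Rle_onW.
    have Ve : V (idem e *: z).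
      rewrite /V /= sp.2; last exact: idem_ge0.
      by have /rst_idem -> := pz0; rewrite mulr0.
    have ez : rst XE (idem e *: z) e = rst XE z e.
      by rewrite -{2}[z]scale1r; apply: Escale_local => //; apply: idem_in.
    have : (F `&` csub_of XE S' a') (rst XE z e).
      by split; apply/csub_ofP; split=> //; [exists (idem e *: z)|exists z].
    by rewrite FG' => /csub_ofP[]; rewrite lex0 => /eqP.
  apply/csub_ofP; split; first exact: le_trans ba' (aP _ _ za').
  exists (paste XE a' z x0); last by rewrite paste_in.
  apply: Rlt_on_locally; apply: (@locally_split _ _ _ a');
    (apply: locally_self; first exact: Rlt_on_antitone).
    apply: Rlt_on_local (Rlt_on_antitone (leIr _ _) za') => //.
    by apply: sublinear_local => //; rewrite paste_in // leIr.
  apply: Rlt_on_local (Rlt_on_antitone (leIl _ _) x0P) => //.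
  by apply: sublinear_local => //; rewrite paste_out // leIr.
have GO : norm_open E G.
  exists a; first by exists Sa.
  move=> y /csub_ofP[_ [z Sz yz]].
  have py : Rlt_on a 0 (p y) by apply: Rlt_on_local Sz => //; apply/esym/sublinear_local.
  have hy : Rlt_on a 0 (half * p y) := Rlt_on_half py.
  (* Radius p(y)/4 on a: as p is at most twice the norm, it drops by at most p(y)/2 on the ball. *)
  pose r := paste X a (half * (half * p y)) 1.
  have rlt : Rlt 0 r.
    apply/Rlt_onT; apply: Rlt_on_locally; apply: (@locally_split _ _ _ a); rewrite meet1x;
      (apply: locally_self; first exact: Rlt_on_antitone).
      by apply: Rlt_on_local (Rlt_on_half hy); rewrite ?paste_in.
    apply: (Rlt_on_local (r := 0) (s := 1)) => //; first by rewrite paste_out.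
    by rewrite -qR0 -qR1; apply: qR_lt.
  exists r => //; apply: csub_of_sub => w /(ball_sub rlt.1) yw e ea e0 pw.
  apply: (hy e ea e0).
  have H1 : Rle (p y) (p w + (norm (y - w) + norm (y - w))).
    apply: Rle_trans (Rle_addl (Rle_refl _) (p_bound _)).
    by rewrite -{1}[y](subrK w) addrC; apply: sp.1.
  have H2 : Rle_on e (norm (y - w)) (half * (half * p y)).
    by apply: Rle_on_local (Rle_onW e yw) => //; apply: paste_in.
  have hh s : half * s + half * s = s by rewrite -mulrDl half2 mul1r.
  have H3 := Rle_on_trans (Rle_onW e H1) (Rle_on_add pw (Rle_on_add H2 H2)).
  rewrite hh in H3; apply: Rle_on_by H3 _; rewrite -{3}[p y]hh; ring.
have : cclosure (norm_open E) (cspan (csub_of XE S \top%O)) `<=` F.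
  by move=> o; apply; split; [exact: is_csub_of|exists G|exact: span_sub].
rewrite closureS => /(_ (rst XE x \top%O)) H.
by have /csub_of_top := H (proj2 (csub_of_top XE setT x) Logic.I).
Qed.

End Closure.

(** * The limit functional *)

Section Oscillation.
Context {d : Order.disp_t} {A : completeBoolType d} {R : creals A} {E : cnormed R}.
Implicit Types (a b c : A) (r s t : R) (x y z : E).
Local Notation X := (csetR R).
Local Notation XE := (csetE E).
Variable f : nat -> cdual E.
Hypothesis f_norm : forall k x, Rle (f k x) (norm x).

Let T1 m : set nat := [set k | (m <= k)%N].
Let T2 m : set (nat * nat) := [set k | (m <= k.1)%N /\ (m <= k.2)%N].
(* Both orders of a pair of indices occur, so no absolute value is needed. *)
Let diff (k : nat * nat) : cdual E := f k.1 - f k.2.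

Let T1n m : T1 m !=set0. Proof. by exists m; rewrite /T1 /=. Qed.
Let T2n m : T2 m !=set0. Proof. by exists (m, m); split=> /=. Qed.
Let T1le m n : (m <= n)%N -> T1 n `<=` T1 m.
Proof. by move=> mn k; apply: leq_trans. Qed.
Let T2le m n : (m <= n)%N -> T2 n `<=` T2 m.
Proof. by move=> mn k [h1 h2]; split; apply: leq_trans mn _. Qed.

Let diff_bound k x : Rle (diff k x) (norm x + norm x).
Proof.
apply: Rle_addl; first exact: f_norm.
by rewrite -[X in Rle X _]dualNE -normN; apply: f_norm.
Qed.

Definition osc : E -> R := flimsup T2 diff.

Let oscU m x := upper T2 diff m x.

Lemma osc_sublinear : sublinear osc.
Proof. exact: flimsup_sublinear T2n T2le diff_bound. Qed.

Lemma osc_bound x : Rle (osc x) (norm x + norm x).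
Proof. exact: (flimsup_le T2n diff_bound). Qed.

Lemma osc_ge0 x : Rle 0 (osc x).
Proof.
apply: (le_flimsup T2n diff_bound) => m.
have := @upper_ge _ _ _ _ _ _ _ _ T2n diff_bound m (m, m) x (conj (leqnn m) (leqnn m)).
by rewrite /diff /= subrr.
Qed.

Lemma osc_even x : osc (- x) = osc x.
Proof.
have U m : upper T2 diff m (- x) = upper T2 diff m x.
  congr Rsup; apply/seteqP; split=> _ [[k l] [mk ml] <-]; exists (l, k) => //;
    by rewrite /diff /= !dualNE opprK addrC.
by rewrite /osc /flimsup; congr (- Rsup (image (image _ _) _)); apply/funext => m; apply: U.
Qed.

Lemma osc_local0 b x : (forall k, rst X (f k x) b = rst X 0 b) -> rst X (osc x) b = rst X 0 b.
Proof.
move=> fx; apply: Rle_on_anti; last exact/Rle_onW/osc_ge0.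
apply: Rle_on_trans (Rle_onW _ (flimsup_le_upper T2n diff_bound 0 x)) _.
apply: (sup_le_on (upperP T2n diff_bound 0 x)) => _ [[k l] _ <-]; apply: Rle_on_eq.
rewrite /diff /= -[X in _ = rst _ X _](subrr (0 : R)).
by apply: Radd_local => //; apply: Ropp_local.
Qed.

Lemma osc_cauchy x (c : R) N : (forall k, (N <= k)%N -> Rclose \top%O (f k x) c (qR (tick k))) ->
  osc x = 0.
Proof.
move=> H; apply: Rle_anti; last exact: osc_ge0.
apply/Rle_onT; apply: contrapT => /Rnle_on[b [n [_ b0 tb]]]; apply: b0.
(* Values within 1/(2n+4) of c differ by at most 1/(n+2), less than the gap 1/(n+1). *)
pose m := maxn N n.+1.*2.+1.
have close k : T1 m k -> Rclose \top%O (f k x) c (qR (tick n.+1.*2.+1)).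
  move=> mk; apply: Rclose_le (H k _); last exact: leq_trans (leq_maxl _ _) mk.
  by apply: qR_le_on; apply: tick_le; apply: leq_trans (leq_maxr _ _) mk.
have : Rle_on b (qR (tick n)) (qR (tick n.+1) : R).
  rewrite add0r in tb; apply: Rle_on_trans tb _; apply: Rle_onW.
  apply: Rle_trans (flimsup_le_upper T2n diff_bound m x) _.
  apply: (upper_le T2n diff_bound) => -[k l] [/= mk ml].
  have [h1 _] := Rclose_trans (close k mk) (Rclose_sym (close l ml)).
  by rewrite -tick_half qRD; apply/Rle_onT.
apply: qR_lt_on; rewrite /tick ltf_pV2 ?posrE ?ltr0Sn // ltr_nat; exact: ltnSn.
Qed.

Hypothesis osc0 : forall x, osc x = 0.

Let lim : E -> R := flimsup T1 f.

(** [upper T1 f m (- x)] is minus the infimum of the tail at x, so the left side is a supremum of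
    differences f k x - f l x. *)
Let upper_sum m x k : T1 m k -> Rle (f k x + upper T1 f m (- x)) (oscU m x).
Proof.
move=> mk; have H : Rle (upper T1 f m (- x)) (oscU m x - f k x).
  apply: (upper_le T1n f_norm) => l ml.
  have H := @upper_ge _ _ _ _ _ _ _ _ T2n diff_bound m (k, l) x (conj mk ml).
  by rewrite dualNE; apply: Rle_by H _; rewrite /diff /oscU /=; ring.
by apply: Rle_by H _; ring.
Qed.

Let upper_sum2 m x : Rle (upper T1 f m x + upper T1 f m (- x)) (oscU m x).
Proof.
have H : Rle (upper T1 f m x) (oscU m x - upper T1 f m (- x)).
  apply: (upper_le T1n f_norm) => k mk.
  by apply: Rle_by (upper_sum x mk) _; ring.
by apply: Rle_by H _; ring.
Qed.

Let lim_sublinear : sublinear lim.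
Proof. exact: flimsup_sublinear T1n T1le f_norm. Qed.

(** lim(x) + lim(-x) lies between 0, by subadditivity, and the oscillation, which vanishes. Oddness
    then makes the sublinear map linear. *)
Let limN x : lim (- x) = - lim x.
Proof.
have H : Rle (lim x + lim (- x)) 0.
  rewrite -(osc0 x); apply: (le_flimsup T2n diff_bound) => m.
  apply: Rle_trans (upper_sum2 m x).
  by apply: Rle_addl; apply: (flimsup_le_upper T1n f_norm).
apply: Rle_anti; first by apply: Rle_by H _; ring.
by apply: Rle_by (sublinear_opp x lim_sublinear) _; ring.
Qed.

Let lim_linear r x y : lim (r *: x + y) = r * lim x + lim y.
Proof.
have limD u v : lim (u + v) = lim u + lim v.
  apply: Rle_anti; first exact: lim_sublinear.1.
  have := lim_sublinear.1 (- u) (- v); rewrite -opprD !limN => /Rle_opp.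
  by rewrite opprD !opprK.
rewrite limD; congr (_ + _); apply: Rle_anti; last exact: sublinear_ray.
have := sublinear_ray (- x) r lim_sublinear.
by rewrite scalerN !limN mulrN => /Rle_opp; rewrite !opprK.
Qed.

Let lim_norm x : Rle (lim x) (norm x).
Proof. exact: (flimsup_le T1n f_norm). Qed.

Let lim_cont : exists r, forall x, Rle (Rabs (lim x)) (r * norm x).
Proof.
exists 1 => x; rewrite mul1r; apply/Rabs_le; split; first exact: lim_norm.
by rewrite -limN -normN; apply: lim_norm.
Qed.

(** f k x and F x both lie between the infimum and the supremum of tail M, whose distance is bounded
    by the upper difference of that tail. Locally this gets below r > 0, because its infimum over M
    is the oscillation 0. *)
Lemma limit_functional : exists F : cdual E, (forall x, Rle (F x) (norm x)) /\
  forall x r b, Rlt_on b 0 r ->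
    locally (fun c => exists M, forall k, (M <= k)%N -> Rclose c (f k x) (F x) r) b.
Proof.
exists (Dual (linear_cfun lim_linear) lim_linear lim_cont); split=> // x r b r0.
apply: contrapT => /not_locally[c [cb c0 H]].
apply: (r0 c cb c0); rewrite -(osc0 x); apply: (le_flimsup_on T2n diff_bound) => M.
apply: Rle_on_never => e ec e0 le; apply: (H e ec e0); exists M => k Mk /=.
have l1 := flimsup_le_upper T1n f_norm M x.
have l2 := flimsup_le_upper T1n f_norm M (- x).
rewrite -/lim limN in l2.
split; apply: Rle_on_trans le; apply: Rle_onW.
  apply: Rle_trans (upper_sum x Mk).
  by apply: Rle_by l2 _; ring.
have H1 := Rle_addl l1 (@upper_ge _ _ _ _ _ _ _ _ T1n f_norm M k (- x) Mk).
have H2 := Rle_trans H1 (upper_sum2 M x).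
by apply: Rle_by H2 _; rewrite dualNE /oscU; ring.
Qed.

End Oscillation.

(** * The dual unit ball through pointwise inequalities *)

Section DualBall.
Context {d : Order.disp_t} {A : completeBoolType d} {R : creals A} {E : cnormed R}.
Implicit Types (a b c : A) (r s t : R) (x y z : E) (f g h : cdual E).
Local Notation X := (csetR R).
Local Notation XE := (csetE E).
Local Notation XD := (csetDual E).

Lemma hull_unit_ball x : hull XE [set x | Rle (norm x) 1] x -> Rle (norm x) 1.
Proof.
have st : stable XE [set x | Rle (norm x) 1].
  apply: stable_le_pre; first by move=> y z b; apply: norm_local.
  by exists 0; rewrite -(scale0r 0) normZ Rabs0 mul0r; apply: Rle01.
exact: (hull_sub st (fun _ xS => xS)).
Qed.

Lemma idem_le1 a : Rle (idem a : R) 1.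
Proof.
apply: (Rle_on_compl (a := a)); first by apply: Rle_on_eq; apply: idem_in.
apply: (Rle_on_local (r := 0) (s := 1)) => //; first by rewrite idem_out.
exact/Rle_onW/Rle01.
Qed.

(** Locally, either the norm of x is invertible and x can be normalized, or it vanishes and so does
    x. *)
Lemma dual_norm_le1 f : (forall x, Rle (norm x) 1 -> Rle (f x) 1) ->
  forall x, Rle (f x) (norm x).
Proof.
move=> f1 x; apply: Rle_locally => c _ c0.
have [b [bc b0 nx]] := sign_cases (norm x) (lexx c) c0; exists b; split=> //.
have zero : rst X (norm x) b = rst X 0 b -> Rle_on b (f x) (norm x).
  move=> n0; have x0 : rst XE x b = rst XE 0 b.
    apply/rst_idemE; rewrite scaler0; apply: norm_eq0.
    rewrite normZ Rabs_pos; last exact: idem_ge0.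
    by have /rst_idem -> := n0; rewrite mulr0.
  apply: Rle_on_eq; rewrite n0 -[in RHS](dual0E f); exact: dual_local.
case: nx => [/zero //|[n0 [r' r'0 nr]]|[n0 _]]; last first.
  apply: zero; apply: Rle_on_anti; last exact/Rle_onW/norm_ge0.
  by have := Rle_on_opp n0; rewrite oppr0 opprK.
(* r' inverts the norm only on b, so the normalized vector is cut off to 0 outside b. *)
have /f1 : Rle (norm (idem b *: (r' *: x))) 1.
  rewrite !normZ (Rabs_pos (idem_ge0 b)) (Rabs_pos r'0) [r' * _]mulrC.
  by have /rst_idem -> := nr; rewrite mulr1; apply: idem_le1.
rewrite !dualZE => /(Rle_onW b) /(Rle_on_mull n0).
have e1 : rst X (norm x * (idem b * (r' * f x))) b = rst X (f x) b.
  rewrite mulrCA rst_idemM // mulrA -[in RHS](mul1r (f x)); exact: Rmul_local.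
by rewrite mulr1; apply: Rle_on_local.
Qed.

(** Replacing x by -x recovers the absolute value. The pointwise inequality defines a stable set, so
    the hull in the definition of the ball adds nothing. *)
Lemma dual_ballP f : dual_ball E (rst XD f \top%O) <-> forall x, Rle (f x) (norm x).
Proof.
rewrite /dual_ball /bracket csub_of_top; split=> [|fn]; last first.
  apply: sub_hull => /=; apply: Rsup_hull_le.
    exists (Rabs (f 0)); exists 0 => //; apply: sub_hull => /=.
    by rewrite -(scale0r 0) normZ Rabs0 mul0r; apply: Rle01.
  move=> _ [x /hull_unit_ball x1 <-]; apply/Rabs_le; split; first exact: Rle_trans (fn x) x1.
  by rewrite -dualNE; apply: Rle_trans (fn _) _; rewrite normN.
have st : stable XD [set f | forall x, Rle (f x) (norm x)].
  split; first by exists 0 => x; apply: norm_ge0.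
  move=> I a g h pa gn gh x; apply: (Rle_on_part pa) => i.
  apply: Rle_on_local (Rle_onW _ (gn i x)) => //.
  by have /rst_dualP/(_ x) := gh i.
move=> fH; apply: (hull_sub st) fH => g /= gn; apply: dual_norm_le1 => x x1; apply: Rle_trans gn.
(* Continuity of g bounds the set, so [Rsup] is its supremum and not the default 0. *)
apply: Rle_trans (Rabs_ge _) _; have [r rP] := dual_cont g.
apply: (Rsup_hull_ub (u := Rabs r)) => [_ [y /hull_unit_ball y1 <-]|].
  apply: Rle_trans (rP y) _.
  have := Rle_mull (norm_ge0 y) (Rabs_ge r); rewrite mulrC [_ * Rabs r]mulrC => /Rle_trans; apply.
  by have := Rle_mull (Rabs_ge0 r) y1; rewrite mulr1.
by exists x => //; apply: sub_hull.
Qed.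

End DualBall.

(** * Pointwise limits as weak star limits *)

Section WeakStarLimit.
Context {d : Order.disp_t} {A : completeBoolType d} {R : creals A} {E : cnormed R}.
Implicit Types (a b c : A) (r s t : R) (x y z : E).
Local Notation X := (csetR R).
Local Notation XE := (csetE E).
Local Notation XD := (csetDual E).
Variables (f : nat -> cdual E) (F : cdual E).
Hypothesis fF : forall x r b, Rlt_on b 0 r ->
  locally (fun c => exists M, forall k, (M <= k)%N -> Rclose c (f k x) (F x) r) b.

Lemma uniform_finite (m : nat) (xs : nat -> E) r b : Rlt_on b 0 r -> b <> \bot%O ->
  exists c, [/\ (c <= b)%O, c <> \bot%O & exists M, forall i k, (i < m)%N -> (M <= k)%N ->
    Rclose c (f k (xs i)) (F (xs i)) r].
Proof.
move=> rb b0; elim: m => [|m [c [cb c0 [M MP]]]]; first by exists b; split=> //; exists 0%N.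
have [e [ec e0 [N NP]]] := fF (xs m) rb cb c0.
exists e; split=> //; first exact: le_trans cb.
exists (maxn M N) => i k; rewrite ltnS leq_eqVlt geq_max => /orP[/eqP ->|im] /andP[Mk Nk].
  exact: NP.
by apply: Rclose_antitone ec _; apply: MP.
Qed.

(** A conditionally finite set is locally a finite list, so the bounds M found locally are uniform
    on it, and [mixN] glues them. The index k has value k + 1 in N, hence [k.+1]. *)
Lemma uniform_cfinite G r : Rlt 0 r -> cfinite_on (X := XE) \top%O G ->
  exists M : cN A, locally (fun c => exists2 m : posnat, (c <= M m)%O &
    forall x k, G (rst XE x \top%O) -> (val m <= k.+1)%N -> Rclose c (f k x) (F x) r) \top%O.
Proof.
move=> /Rlt_onT r0 finG; apply: (mixN (Q := fun c m => forall x k, G (rst XE x \top%O) ->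
    (val m <= k.+1)%N -> Rclose c (f k x) (F x) r)).
  by move=> m b c cb H x k Gx mk; apply: Rclose_antitone cb (H x k Gx mk).
move=> c _ c0; have [b [m [xs [bc b0 Gxs bP]]]] := cfinite_local finG (lex1 c) c0.
have [e [eb e0 [M MP]]] := uniform_finite m xs (Rlt_on_antitone (lex1 b) r0) b0.
exists e; split=> //; first exact: le_trans bc.
exists (posn M) => x k Gx Mk.
have H : locally (fun g => Rclose g (f k x) (F x) r) e.
  move=> g ge g0; have [g' [i [gg g'0 im xi]]] := bP x g Gx (le_trans ge eb) g0.
  exists g'; split=> //.
  have := Rclose_antitone (le_trans gg ge) (MP i k im Mk).
  by apply: Rclose_local => //; apply: dual_local.
by split; apply: Rle_on_locally; apply: locally_imp H => g _ [].
Qed.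

Lemma weak_star_climit (u : cN A -> cdual E) : (forall n, dual_ball E (rst XD (u n) \top%O)) ->
  dual_ball E (rst XD F \top%O) ->
  (forall (n : cN A) k c, (c <= n (posn k))%O -> rst XD (u n) c = rst XD (f k) c) ->
  climit (reltop (sigma_weak_star E) (dual_ball E)) (dual_ball E) u F.
Proof.
move=> uB FB uf U [_ UB [_ [[O Oopen ->] [OF _] OU]]].
have [a [S sS OE] Oball] := Oopen.
have aT : a = \top%O.
  by move: OF; rewrite OE => /csub_ofP[ta _]; apply: le_anti; rewrite lex1.
rewrite aT in Oball; have [G [r [finG r0 sub]]] := Oball F OF.
have [M MP] := uniform_cfinite r0 finG.
exists M => n Mn; apply: OU; split; last exact: uB.
apply: sub; apply/csub_ofP; split=> //; exists (u n) => //.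
exists (u n - F); last by rewrite addrC subrK.
have [x0 Gx0] : exists x, G (rst XE x \top%O).
  by have [[SG [[x SGx] _] ->] _] := finG; exists x; apply/csub_of_top.
apply: sub_hull; apply: Rsup_hull_le; first by exists (Rabs ((u n - F) x0)); exists x0.
move=> _ [x Gx <-].
have H : locally (fun c => Rclose c (u n x) (F x) r) \top%O.
  move=> c ct c0; have [e [ec e0 [m em eP]]] := MP c ct c0.
  have [g [ge g0 [l gl]]] := locally_step n (lexx e) e0.
  have ml := step_relE Mn g0 (le_trans ge em) gl; rewrite -(posnK l) in ml gl.
  exists g; split=> //; first exact: le_trans ec.
  have := Rclose_antitone ge (eP x _ Gx ml).
  by apply: Rclose_local => //; have /rst_dualP/(_ x) := uf _ _ _ gl => ->.
apply/Rabs_le; split; apply: Rle_locally; apply: locally_imp H => c _ [h1 h2].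
  exact: h1.
by apply: Rle_on_by h2 _; rewrite /=; ring.
Qed.

End WeakStarLimit.

Theorem theorem3p2 (d : Order.disp_t) (A : completeBoolType d) (R : creals A)
    (E : cnormed R) (C : set (obj (csetE E))) :
  cbanach E ->
  is_csub_on Order.top C ->
  ccompact (sigma_weak E) C ->
  cconvex C ->
  cbalanced C ->
  cclosure (norm_open E) (cspan C) = cfull (csetE E) ->
  cseq_compact (sigma_weak_star E) (dual_ball E).
Proof.
move=> _ [S sS ->] compactS _ _ closureS u u_cfun uB.
(* By stability u is determined by its values at the standard integers. *)
pose f n : cdual E := u (step_const (posn n)).
have u_norm n x : Rle (u n x) (norm x) by apply: (dual_ballP (u n)).1.
have [D [DS Ddense]] := dense_sequence f sS.
have v_ge n j : Rle (- norm (D j)) (f n (D j)).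
  by have := Rle_opp (u_norm (step_const (posn n)) (- D j)); rewrite normN dualNE opprK.
have [c cP] := cluster_values (fun n j => u_norm (step_const (posn n)) (D j)) v_ge.
pose Q (b : A) m n := forall i, (i < m)%N -> Rclose b (f n (D i)) (c i) (qR (tick m)).
have [||nu [nuS nuP]] := @increasing_choice _ A Q.
- by move=> m n b b' bb QQ i im; apply: Rclose_antitone bb (QQ i im).
- exact: cP.
have [phi [phi_cfun phi_lt phiE]] := subsequence nuS.
(* [nu k] is a conditional number, so g k is only locally one of the f n. *)
pose g k := u (nu k).
have g_norm k x : Rle (g k x) (norm x) := u_norm _ x.
have gf k n b : (b <= nu k (posn n))%O -> rst (csetDual E) (g k) b = rst (csetDual E) (f n) b.
  by move=> bk; apply: (cfun_local u_cfun); apply: rst_step.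
have oscD j : osc g (D j) = 0.
  apply: (osc_cauchy g_norm (c := c j) (N := j.+1)) => k jk.
  have H : locally (fun b => Rclose b (g k (D j)) (c j) (qR (tick k))) \top%O.
    apply: locally_imp (nuP k) => b _ [n bn Qn].
    by apply: Rclose_local (Qn j jk) => //; have /rst_dualP -> := gf k n b bn.
  by split; apply: Rle_on_locally; apply: locally_imp H => b _ [].
have oscf (b : A) w : (forall n, rst (csetR R) (f n w) b = rst (csetR R) 0 b) ->
    rst (csetR R) (osc g w) b = rst (csetR R) 0 b.
  move=> fw; apply: (osc_local0 g_norm) => k; apply: rst_locally => e eb e0.
  have [e' [ee e'0 [m em]]] := locally_step (nu k) (lexx e) e0.
  rewrite -(posnK m) in em; exists e'; split=> //; have /rst_dualP -> := gf _ _ _ em.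
  exact: rst_le (le_trans ee eb) (fw _).
have osc2 x : Rle (osc g x) (qR 2 * norm x).
  have -> : qR 2 * norm x = norm x + norm x.
    by rewrite (_ : 2 = 1 + 1)%R // qRD qR1 mulrDl mul1r.
  exact: osc_bound.
have oscS : forall x, S x -> osc g x = 0.
  apply: (compact_vanish (f := f) sS compactS (osc_sublinear g_norm) osc2) => //.
  - exact: osc_ge0.
  - exact: osc_even.
  - move=> x N Sx; apply: locally_imp (Ddense x N \top%O Sx) => b _ [j jP].
    by exists (D j).
have osc0 : forall x, osc g x = 0.
  exact: (closure_vanish (osc_sublinear g_norm) (osc_bound g_norm) (osc_ge0 g_norm)
    (osc_even g) oscS closureS).
have [F [F_norm F_lim]] := limit_functional g_norm osc0.
exists phi; split=> //; exists F; first exact/dual_ballP.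
apply: (weak_star_climit F_lim) => [n||n k b bn]; first exact: uB.
  exact/dual_ballP.
by apply: (cfun_local u_cfun); apply: phiE.
Qed.
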